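(* Let $\phi$ be a CNF formula whose incidence graph is planar and has $n$ vertices, and in which every clause contains at least four distinct variables. Then $\phi$ has a satisfying assignment, and such an assignment can be found in $O(n^{1.5})$ time.
   Context: The incidence graph of a CNF formula has as vertices the variables and clauses, with an edge between a variable $v$ and a clause $c$ if and only if $v$ occurs in $c$ (negated or unnegated). *)

(* Defs.v *)
From HB Require Import structures.
From mathcomp Require Import all_boot all_order all_algebra.
From mathcomp Require Import all_classical all_reals all_analysis.

Set Implicit Arguments.
Unset Strict Implicit.
Unset Printing Implicit Defensive.

Import Order.TTheory GRing.Theory Num.Theory.
Import numFieldNormedType.Exports.

Local Open Scope classical_set_scope.
Local Open Scope ring_scope.

(** * Planar graphs *)

Definition is_arc (R : realType) (a b : R * R) (A : set (R * R)) : Prop :=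
  exists g : R -> R * R,
    [/\ {within `[0, 1], continuous g},
        {in `[0, 1] &, injective g},
        g 0 = a, g 1 = b & A = g @` `[0, 1]].

(* [e] is meant to be symmetric and irreflexive; [arc x y] is the point set
   representing the undirected edge xy, and is irrelevant unless [e x y]. *)
Definition planar (R : realType) (T : finType) (e : rel T) : Prop :=
  exists (pos : T -> R * R) (arc : T -> T -> set (R * R)),
    [/\ injective pos,
        forall x y, e x y -> arc x y = arc y x,
        forall x y, e x y -> is_arc (pos x) (pos y) (arc x y),
        forall x y z, e x y -> arc x y (pos z) -> z = x \/ z = y
      & forall x y u v, e x y -> e u v -> [set x; y]%SET != [set u; v]%SET ->
          arc x y `&` arc u v `<=` range pos].

(** * CNF formulas *)

(* The literal (v, b) is the variable v if b = true, its negation otherwise. *)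
Definition literal (m : nat) : Type := ('I_m * bool)%type.

(* A clause is a finite set of literals, listed in some order without
   repetition. A clause may contain both a variable and its negation, a clause
   may be listed several times (each copy is then a vertex of the incidence
   graph), and a variable need not occur in any clause. *)
Record cnf := Cnf {
  nvars : nat;
  clauses : seq (seq (literal nvars));
  clauses_uniq : all uniq clauses
}.

Definition nclauses (phi : cnf) : nat := size (clauses phi).

Definition clause (phi : cnf) (j : 'I_(nclauses phi)) :
  seq (literal (nvars phi)) := nth [::] (clauses phi) j.

Definition clause_vars (phi : cnf) (j : 'I_(nclauses phi)) :
  {set 'I_(nvars phi)} := [set l.1 | l in clause j]%SET.

Definition assignment (phi : cnf) : Type := 'I_(nvars phi) -> bool.

Definition satisfies (phi : cnf) (a : assignment phi) : Prop :=
  forall j : 'I_(nclauses phi), exists2 l, l \in clause j & a l.1 = l.2.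

Definition ivertex (phi : cnf) : finType := ('I_(nvars phi) + 'I_(nclauses phi))%type.

Definition incidence (phi : cnf) : rel (ivertex phi) :=
  fun x y => match x, y with
  | inl v, inr j | inr j, inl v => v \in clause_vars j
  | _, _ => false
  end.
Arguments incidence : clear implicits.

(** * Word RAM

   Unit-cost random access machine with registers r_0, r_1, ... and a memory of
   w-bit words. Every instruction costs one step; no multiplication, shift
   or bitwise operation is available. *)

(* Operands are register indices, listed in the order i, j, k, except for the
   constant k of [IConst i k] and the jump target l of [IJz i l]. *)
Inductive instr :=
  | IConst of nat & nat       (* r_i := k *)
  | IAdd of nat & nat & nat   (* r_i := r_j + r_k *)
  | ISub of nat & nat & nat   (* r_i := r_j - r_k, truncated at 0 *)
  | ILoad of nat & nat        (* r_i := memory[r_j] *)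
  | IStore of nat & nat       (* memory[r_i] := r_j *)
  | IJz of nat & nat          (* if r_i = 0 then goto l *)
  | IHalt.

Definition program := seq instr.

Record config := Config {
  pc : nat;
  reg : nat -> nat;
  memory : nat -> nat
}.

Definition upd (f : nat -> nat) (i x : nat) : nat -> nat :=
  fun j => if j == i then x else f j.

(* A register write of a value that does not fit in w bits is an error; memory
   is only written from registers. *)
Definition set_reg (w : nat) (s : config) (i x : nat) : option config :=
  if (x < 2 ^ w)%N then Some (Config (pc s).+1 (upd (reg s) i x) (memory s))
  else None.

Definition ram_step (w : nat) (p : program) (s : config) : option config :=
  match onth p (pc s) with
  | Some (IConst i k) => set_reg w s i k
  | Some (IAdd i j k) => set_reg w s i (reg s j + reg s k)%N
  | Some (ISub i j k) => set_reg w s i (reg s j - reg s k)%N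
  | Some (ILoad i j) => set_reg w s i (memory s (reg s j))
  | Some (IStore i j) =>
      Some (Config (pc s).+1 (reg s) (upd (memory s) (reg s i) (reg s j)))
  | Some (IJz i l) =>
      Some (Config (if reg s i == 0%N then l else (pc s).+1) (reg s) (memory s))
  | Some IHalt | None => None
  end.

Definition ram_init (input : seq nat) : config :=
  Config 0 (fun=> 0%N) (nth 0%N input).

Definition halted (p : program) (s : config) : Prop :=
  onth p (pc s) = Some IHalt.

Definition halts_in (w : nat) (p : program) (input : seq nat) (t : nat)
    (s : config) : Prop :=
  iter t (obind (ram_step w p)) (Some (ram_init input)) = Some s /\ halted p s.

(** * Formulas as inputs, assignments as outputs *)

Definition encode_literal m (l : literal m) : seq nat :=
  [:: nat_of_ord l.1; nat_of_bool l.2].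

Definition encode_clause m (c : seq (literal m)) : seq nat :=
  size c :: flatten (map (@encode_literal m) c).

Definition encode (phi : cnf) : seq nat :=
  [:: nvars phi, nclauses phi
    & flatten (map (@encode_clause (nvars phi)) (clauses phi))].

Definition outputs (phi : cnf) (s : config) (a : assignment phi) : Prop :=
  forall v : 'I_(nvars phi), memory s v = nat_of_bool (a v).

(* Words of O(log n) bits; (trunc_log 2 n).+1 is the length of n in binary. *)
Definition word_size (k n : nat) : nat := (k * (trunc_log 2 n).+1)%N.

(* Main.v *)
Require Import Defs.
From HB Require Import structures.
From mathcomp Require Import all_boot all_order all_algebra.
From mathcomp Require Import all_classical all_reals all_analysis.
From mathcomp Require Import zify ring lra.

(* Planarity enters only through Hall's condition. A drawing of a bipartite
   graph is discretised on a fine square grid: each variable becomes a box of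
   cells, each clause the union of cell walks along its arcs, cut where they
   enter the boxes. This exhibits the graph as a minor of the grid, whose cycle
   space over F_2 is spanned by the unit squares, each edge lying on two of
   them. Deleting and contracting edges preserves such a generating family
   (MacLane); since a nonempty even subgraph of a simple bipartite graph has at
   least four edges, a graph with v vertices and e edges satisfies
   4 (e - v) <= 2 e, that is e <= 2 v. If every clause has four variables, a set
   S of clauses with neighbourhood N thus satisfies 4 |S| <= 2 (|S| + |N|), so
   |S| <= |N|.

   By Hall's condition the clauses can be matched injectively to variables
   occurring in them, and the matched variables are set so as to satisfy their
   clauses. The matching is found in two phases. First, every unmatched clause
   takes a variable of least label among its own, evicting the previous owner
   and increasing the label; labels stop at L, the square root of the number of
   variables rounded up, so this takes O(n L) steps. Hall's condition applied to
   the sets of variables of label at least l, for all l <= L, shows that at most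
   n / L clauses remain unmatched. Each of these is then matched along an
   augmenting path found by a depth-first search in O(n) steps. *)

Set Implicit Arguments.
Unset Strict Implicit.
Unset Printing Implicit Defensive.

Import Order.TTheory GRing.Theory Num.Theory.
Import numFieldNormedType.Exports.

(** * Edge bound for bipartite minors of the grid *)

Section CycleSpace.
Local Open Scope ring_scope.

(** The arcs of a drawing are merely continuous, so its faces are out of reach without the Jordan
    curve theorem. On a grid the faces are explicit, and the only topological input, that cycles
    bound, is a parity count along rays. The price is that discretisation must keep the branch sets
    disjoint. Arcs of different clauses can approach each other only at a shared variable, which is
    why variables become fat boxes swallowing the ends of arcs; elsewhere compactness gives a
    positive distance, and magnification makes it exceed the mesh. Walks of one clause may overlap,
    as they form a single branch set.

    The time bound requires that visiting a clause costs a constant, whatever its length. Hence only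
    the first seven literals are used: a variable has two literals, so seven of them involve four
    variables, and the edge bound applies to the truncated clauses. The size stored with each clause
    lets it be skipped in constant time, so the running time depends on the number of vertices
    only. *)

Lemma addrr_F2 (x : 'F_2) : x + x = 0.
Proof. exact: addrr_pchar2 (pchar_Fp (isT : prime 2)) x. Qed.

Lemma oppr_F2 (x : 'F_2) : - x = x.
Proof. by apply/esym/eqP; rewrite -addr_eq0 addrr_F2. Qed.

(** The boundary map on chains mod 2. A loop counts twice at its vertex and so vanishes. *)
Definition bdry (H C : finType) (src dst : H -> C) (z : H -> 'F_2) (a : C)
    : 'F_2 :=
  \sum_h ((src h == a)%:R + (dst h == a)%:R) * z h.

Lemma bdryD (H C : finType) (src dst : H -> C) (y z : H -> 'F_2) a :
  bdry src dst (fun h => y h + z h) a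
  = bdry src dst y a + bdry src dst z a.
Proof. by rewrite -big_split; apply: eq_bigr => h _; rewrite mulrDr. Qed.

Lemma bdry_sum (H C I : finType) (src dst : H -> C) (y : I -> 'F_2)
    (z : I -> H -> 'F_2) a :
  bdry src dst (fun h => \sum_i y i * z i h) a
  = \sum_i y i * bdry src dst (z i) a.
Proof.
rewrite /bdry; under eq_bigr do rewrite mulr_sumr.
rewrite exchange_big; apply: eq_bigr => i _; rewrite mulr_sumr.
by apply: eq_bigr => h _; rewrite mulrCA.
Qed.

Lemma bdry1 (H C : finType) (src dst : H -> C) (h0 : H) a :
  bdry src dst (fun h => (h == h0)%:R) a
  = (src h0 == a)%:R + (dst h0 == a)%:R.
Proof.
rewrite /bdry (bigD1 h0) //= eqxx mulr1 big1 ?addr0 // => h /negPf->.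
by rewrite mulr0.
Qed.

Section Maclane.
(* A graph embedded in a surface, with edges [H], vertices [C] and faces [F],
   has the graph with edges [E] and vertices [V] as a minor: [own] maps each
   vertex to the branch set containing it, and [eps] lifts the edges. *)
Variables (C F H V E : finType).
Variables (src dst : H -> C) (lf rg : H -> F) (inn : pred C).
Variables (s t : E -> V) (own : C -> option V) (eps : E -> H).
Let bd := bdry src dst.
Let bdG := bdry s t.

Hypothesis face_bound : forall (chi : F -> 'F_2) a,
  bd (fun h => chi (lf h) + chi (rg h)) a = 0.
(** On a torus a cycle that winds around need not bound; [inn] confines cycles to a region where
    they do. *)
Hypothesis cycle_face : forall z : H -> 'F_2,
  (forall h, z h != 0 -> inn (src h) && inn (dst h)) ->
  (forall a, bd z a = 0) ->
  exists J : F -> 'F_2, forall h, inn (src h) || inn (dst h) ->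
    z h = J (lf h) + J (rg h).
Hypothesis own_inn : forall a, own a -> inn a.
Hypothesis eps_ends : forall e,
  (own (src (eps e)) = Some (s e) /\ own (dst (eps e)) = Some (t e)) \/
  (own (src (eps e)) = Some (t e) /\ own (dst (eps e)) = Some (s e)).
Hypothesis eps_inj : injective eps.
Hypothesis st_neq : forall e, s e != t e.

Definition internal h := (own (src h) == own (dst h)) && own (src h).
Definition ladj a b := [exists h, internal h &&
  (((src h == a) && (dst h == b)) || ((src h == b) && (dst h == a)))].

Hypothesis own_conn : forall a b, own a -> own a = own b -> connect ladj a b.
Hypothesis girth4 : forall y : E -> 'F_2,
  (forall u, bdG y u = 0) -> (exists e, y e != 0) ->
  (4 <= #|[pred e | y e != 0%R]|)%N.

(** Internal edges get contracted and the lifts survive. The other edges touching a branch set are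
    deleted, and each deletion merges the two faces beside the edge ([fadj]). A merged face is named
    by its root under [rt], and [Fc k] is its boundary in the minor, zero when [k] is not a root. *)
Let kept h := internal h || (h \in codom eps).
Let fadj : rel F := fun f g => [exists h, [&& ~~ kept h,
  own (src h) || own (dst h) : bool &
  ((lf h == f) && (rg h == g)) || ((lf h == g) && (rg h == f))]].
Let rt := fingraph.root fadj.
Let Fc (k : F) (e : E) : 'F_2 :=
  (rt (lf (eps e)) == k)%:R + (rt (rg (eps e)) == k)%:R.

Lemma fadj_sym : connect_sym fadj.
Proof.
apply: sym_connect_sym => f g; rewrite /fadj.
by apply: eq_existsb => h; congr [&& _, _ & _]; rewrite orbC.
Qed.

Lemma internal_eps e : internal (eps e) = false.
Proof.
apply/negbTE; rewrite /internal; case: (eps_ends e) => -[-> ->] /=;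
  rewrite andbT; apply/eqP => -[] /eqP; rewrite ?(eq_sym (t e)) (negPf (st_neq e));
  by [].
Qed.

(** Summation over a branch set realises contraction: an internal edge is counted at both ends and
    cancels. *)
Lemma sum_bd_own (z : H -> 'F_2) u :
  (forall h, ~~ kept h -> own (src h) || own (dst h) -> z h = 0) ->
  \sum_(a | own a == Some u) bd z a = bdG (fun e => z (eps e)) u.
Proof.
move=> zd; rewrite /bd /bdG /bdry exchange_big /=.
transitivity (\sum_h ((own (src h) == Some u)%:R + (own (dst h) == Some u)%:R) * z h).
  have aux (c : C) : \sum_(a | own a == Some u) (c == a)%:R
      = (own c == Some u)%:R :> 'F_2.
    case: eqP => [oc|/eqP oc]; last first.
      by apply: big1 => a oa; case: (c =P a) => [cE|//]; rewrite cE oa in oc.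
    rewrite (bigD1 c) ?oc //= eqxx big1 ?addr0 // => a /andP[_].
    by rewrite eq_sym => /negPf->.
  by apply: eq_bigr => h _; rewrite -mulr_suml big_split /= !aux.
rewrite (bigID (mem (codom eps))) /= [X in _ + X]big1 ?addr0; last first.
  move=> h hn; have [/eqP ih|] := boolP (own (src h) == own (dst h)).
    by rewrite ih addrr_F2 mul0r.
  move=> ih; have [ow|] := boolP (own (src h) || own (dst h)).
    rewrite zd ?mulr0 //; by rewrite /kept /internal (negPf ih) (negPf hn).
  by case: (own (src h)) => //; case: (own (dst h)) => //= _; rewrite addrr_F2 mul0r.
rewrite -big_uniq; last exact/injectiveP.
rewrite codomE big_map big_enum /=; apply: eq_bigr => e _.
by case: (eps_ends e) => -[-> ->] //; rewrite addrC.
Qed.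

Lemma Fc_even k u : bdG (Fc k) u = 0.
Proof.
pose chi f : 'F_2 := (rt f == k)%:R.
rewrite -(@sum_bd_own (fun h => chi (lf h) + chi (rg h))).
  by apply: big1 => a _; apply: face_bound.
move=> h hk ho; suff -> : chi (rg h) = chi (lf h) by rewrite addrr_F2.
rewrite /chi; suff -> : rt (rg h) = rt (lf h) by [].
apply/esym/(fingraph.rootP fadj_sym)/connect1.
by apply/existsP; exists h; rewrite hk ho !eqxx.
Qed.

Lemma connect_chain a b : connect ladj a b ->
  exists w : H -> 'F_2, (forall h, w h != 0 -> internal h) /\
    forall c, bd w c = (a == c)%:R + (b == c)%:R.
Proof.
case/connectP => p; elim: p a => [|c p IH] a /=.
  move=> _ ->; exists (fun=> 0); split=> [h|c]; first by rewrite eqxx.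
  by rewrite addrr_F2 /bd /bdry big1 // => h _; rewrite mulr0.
case/andP => /existsP[h0 /andP[h0i h0e]] cp bE.
have [w [wi wb]] := IH _ cp bE.
exists (fun h => (h == h0)%:R + w h); split => [h|d].
  by case: (h =P h0) => [->//|_]; rewrite add0r; apply: wi.
rewrite /bd bdryD bdry1 -/bd wb.
case/orP: h0e => /andP[/eqP-> /eqP->].
  by rewrite -addrA (addrA (c == d)%:R) addrr_F2 add0r.
by rewrite (addrC (c == d)%:R) -addrA (addrA (c == d)%:R) addrr_F2 add0r.
Qed.

(** The default is never taken, since [a] itself qualifies; hence [rep] is constant on each branch
    set. *)
Let rep a := odflt a [pick b | own b == own a].

Lemma own_rep a : own (rep a) = own a.
Proof. by rewrite /rep; case: pickP => [b /eqP|]. Qed.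

Lemma rep_eq a b : own a = own b -> rep a = rep b.
Proof.
by move=> ab; rewrite /rep ab; case: pickP => // /(_ b); rewrite eqxx.
Qed.

(* Completes a cycle by paths inside the connected branch sets. *)
Lemma lift_cycle (y : E -> 'F_2) : (forall u, bdG y u = 0) ->
  exists z : H -> 'F_2, [/\ forall e, z (eps e) = y e,
    forall h, ~~ kept h -> z h = 0 & forall a, bd z a = 0].
Proof.
move=> yb; pose z0 h := \sum_e y e * (h == eps e)%:R.
have z0E e : z0 (eps e) = y e.
  rewrite /z0 (bigD1 e) //= eqxx mulr1 big1 ?addr0 // => f.
  by rewrite (inj_eq eps_inj) eq_sym => /negPf->; rewrite mulr0.
have z0k h : h \notin codom eps -> z0 h = 0.
  move=> hn; apply: big1 => e _; case: eqP => [hE|]; last by rewrite mulr0.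
  by rewrite hE codom_f in hn.
have tau_sum u : \sum_(a | own a == Some u) bd z0 a = 0.
  rewrite sum_bd_own; last by move=> h; rewrite negb_or => /andP[_ /z0k].
  by rewrite -[RHS](yb u); apply: eq_bigr => e _; rewrite z0E.
have tau0 a : own a = None -> bd z0 a = 0.
  move=> oa; rewrite /bd bdry_sum big1 // => e _.
  rewrite bdry1; case: (eps_ends e) => -[h1 h2];
  by do 2![case: eqP => [hE|_]; first by [rewrite hE oa in h1|rewrite hE oa in h2]];
     rewrite addr0 mulr0.
have /fin_all_exists2[w wi wb] a : exists2 w : H -> 'F_2,
    (forall h, w h != 0 -> internal h) &
    (own a -> forall c, bd w c = (a == c)%:R + (rep a == c)%:R).
  have [oa|oa] := boolP (own a : bool); last first.
    by exists (fun=> 0) => // h; rewrite eqxx.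
  have [] := @connect_chain a (rep a); first by apply: own_conn; rewrite ?own_rep.
  by move=> w [wi wb]; exists w.
(* Every vertex in the boundary of [z0] is joined to its representative. What accumulates at a
   representative is the boundary of [z0] summed over the branch set, which is zero by [tau_sum]. *)
exists (fun h => z0 h + \sum_a bd z0 a * w a h); split=> [e|h|c].
- rewrite z0E big1 ?addr0 // => a _; case: (eqVneq (w a (eps e)) 0) => [->|].
    by rewrite mulr0.
  by move/wi; rewrite internal_eps.
- rewrite negb_or => /andP[hi hn]; rewrite z0k // add0r big1 // => a _.
  case: (eqVneq (w a h) 0) => [->|/wi]; first by rewrite mulr0.
  by rewrite (negPf hi).
rewrite /bd bdryD bdry_sum -/bd.
transitivity (bd z0 c + \sum_a bd z0 a * ((a == c)%:R + (rep a == c)%:R)).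
  congr (_ + _); apply: eq_bigr => a _.
  case oa : (own a) => [u|]; last by rewrite tau0 // !mul0r.
  by rewrite wb // oa.
under eq_bigr do rewrite mulrDr.
rewrite big_split /= (bigD1 c) //= eqxx mulr1 [X in _ + X + _]big1 ?addr0; last first.
  by move=> a /negPf->; rewrite mulr0.
rewrite addrA addrr_F2 add0r.
case oc : (own c) => [u|]; last first.
  apply: big1 => a _; case: eqP => [rc|]; last by rewrite mulr0.
  by rewrite tau0 ?mul0r // -(own_rep a) rc.
have [rc|rc] := eqVneq (rep c) c; last first.
  apply: big1 => a _; case: eqP => [ra|]; last by rewrite mulr0.
  move: rc; rewrite -(@rep_eq a c) ?ra ?eqxx //.
  by rewrite -(own_rep a) ra.
rewrite -[RHS](tau_sum u) [RHS]big_mkcond /=; apply: eq_bigr => a _.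
rewrite -oc; case: (eqVneq (own a) (own c)) => [ac|ac].
  by rewrite (rep_eq ac) rc eqxx mulr1.
case: eqP => [ra|]; last by rewrite mulr0.
by move: ac; rewrite -(own_rep a) ra eqxx.
Qed.

(** The lifted cycle bounds some set [J] of faces. It vanishes on deleted edges, so [J] is constant
    on merged faces, and the cycle is the sum of their boundaries. *)
Lemma cycle_span (y : E -> 'F_2) : (forall u, bdG y u = 0) ->
  exists J : F -> 'F_2, forall e, y e = \sum_k J k * Fc k e.
Proof.
move=> /lift_cycle[z [zE zk zb]].
have [h|J JE] := cycle_face _ zb.
  apply: contraR => hn; rewrite zk // negb_or; apply/andP; split.
    apply: contra hn => /andP[/eqP oE o1].
    by rewrite !own_inn // -oE.
  apply: contra hn => /codomP[e ->].
  by case: (eps_ends e) => -[h1 h2]; rewrite !own_inn // ?h1 ?h2.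
have Jadj f g : fadj f g -> J f = J g.
  case/existsP => h /and3P[hk ho hfg].
  have : z h = J (lf h) + J (rg h).
    by apply: JE; case/orP: ho => /own_inn ->; rewrite ?orbT.
  rewrite zk // => /esym /eqP; rewrite addr_eq0.
  rewrite oppr_F2.
  by case/orP: hfg => /andP[/eqP-> /eqP->] /eqP.
have Jrt f : J f = J (rt f).
  have /connectP[p] := connect_root fadj f; rewrite -/rt.
  elim: p f => [|g p IH] f /= => [_ ->//|/andP[fg gp] fE].
  rewrite (Jadj _ _ fg) fE; apply: etrans (IH _ gp _) _; first rewrite -fE.
    by apply/esym/(fingraph.rootP fadj_sym)/connect1.
  by rewrite -fE; congr J; apply/esym/(fingraph.rootP fadj_sym)/connect1.
exists J => e; rewrite -zE JE; last first.
  by case: (eps_ends e) => -[h1 h2]; rewrite !own_inn // ?h1 ?h2.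
rewrite Jrt [J (rg _)]Jrt.
have aux f0 : J f0 = \sum_k J k * (f0 == k)%:R.
  rewrite (bigD1 f0) //= eqxx mulr1 big1 ?addr0 // => k.
  by rewrite eq_sym => /negPf->; rewrite mulr0.
by rewrite [J (rt (lf _))]aux [J (rt (rg _))]aux -big_split;
  apply: eq_bigr => k _; rewrite mulrDr.
Qed.

Theorem maclane_bound : (#|E| <= 2 * #|V|)%N.
Proof.
pose NZ : pred F := [pred k | [exists e, Fc k e != 0]].
pose A : 'M['F_2]_(#|E|, #|V|) := \matrix_(i, j)
  ((s (enum_val i) == enum_val j)%:R + (t (enum_val i) == enum_val j)%:R).
pose B : 'M['F_2]_(#|NZ|, #|E|) := \matrix_(i, j)
  Fc (enum_val i) (enum_val j).
have sub : (kermx A <= B)%MS.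
  apply/rV_subP => v /sub_kermxP vA.
  have [u|J JE] := @cycle_span (fun e => v ord0 (enum_rank e)).
    have /rowP/(_ (enum_rank u)) := vA.
    rewrite !mxE => vu; rewrite -[RHS]vu /bdG /bdry.
    rewrite [RHS](reindex (@enum_rank E)) /=; last first.
      by exists enum_val => x _; rewrite ?enum_rankK ?enum_valK.
    by apply: eq_bigr => e _; rewrite mxE !enum_rankK mulrC.
  apply/submxP; exists (\row_i J (enum_val i)); apply/rowP => j.
  rewrite mxE; have /= := JE (enum_val j); rewrite enum_valK => ->.
  rewrite (bigID NZ) /= [X in _ + X]big1 ?addr0; last first.
    move=> k /existsPn /(_ (enum_val j)); rewrite negbK => /eqP->.
    by rewrite mulr0.
  transitivity (\sum_(k in NZ) J k * Fc k (enum_val j)); first exact: eq_bigl.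
  rewrite big_enum_val; by apply: eq_bigr => i _; rewrite !mxE.
(* The rank of [A] is at most the number of vertices, so its kernel, the cycle space, has dimension
   at least edges minus vertices. *)
have m_ge : (#|E| <= #|NZ| + #|V|)%N.
  have := mxrankS sub; rewrite mxrank_ker => h.
  have := rank_leq_col A; have := rank_leq_row B; lia.
(* Double counting of the pairs of a merged face and an edge on its boundary. *)
have : (\sum_(k in NZ) 4 <= \sum_(e : E) 2)%N.
  apply: (@leq_trans (\sum_(k in NZ) \sum_(e : E) (Fc k e != 0%R))%N).
    apply: leq_sum => k /existsP[e ke].
    apply: leq_trans (girth4 (Fc_even k) (ex_intro _ e ke)) _.
    rewrite -sum1_card big_mkcond /=; apply: leq_sum => f _.
    by rewrite inE; case: (_ != _).
  rewrite exchange_big; apply: leq_sum => e _.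
  apply: (@leq_trans (\sum_(k : F) (rt (lf (eps e)) == k) + \sum_(k : F) (rt (rg (eps e)) == k))%N).
    rewrite -big_split big_mkcond /=; apply: leq_sum => k _.
    case: ifP => // _; rewrite /Fc; case: (_ == k); case: (_ == k);
      by rewrite ?addrr_F2 ?eqxx //= leq_b1.
  have aux f0 : (\sum_(k : F) (f0 == k) = 1)%N.
    by rewrite (bigD1 f0) //= eqxx big1 // => k; rewrite eq_sym => /negPf->.
  by rewrite !aux.
rewrite !sum_nat_const; move: m_ge.
by move: #|NZ| #|E| #|V| => a b c; lia.
Qed.

End Maclane.

(** Evenness supplies a second edge at every vertex met: from [e0], take [e1] at its [s] end, [e2]
    at its [t] end, then [e3] at the [s] end of [e2]. Simplicity keeps the four apart. *)
Lemma bip_girth4 (X Y E : finType) (s : E -> X) (t : E -> Y) (y : E -> 'F_2) :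
  (forall e f, s e = s f -> t e = t f -> e = f) ->
  (forall u, bdry (inl \o s : E -> X + Y)%type (inr \o t) y u = 0) ->
  (exists e, y e != 0) -> (4 <= #|[pred e | y e != 0%R]|)%N.
Proof.
move=> st_inj yb [e0 ye0].
have other (P : pred E) (e : E) : P e -> y e != 0 ->
    \sum_(f | P f) y f = 0 -> exists f, [/\ P f, y f != 0 & f != e].
  move=> Pe ye; rewrite (bigD1 e) //= => h.
  have [/existsP[f /and3P[h1 h2 h3]]|/existsPn hn] :=
    boolP [exists f, [&& P f, y f != 0 & f != e]]; first by exists f.
  move: h; rewrite big1 ?addr0 => [yE|f /andP[Pf fe]]; first by rewrite yE eqxx in ye.
  by have := hn f; rewrite Pf fe andbT /= negbK => /eqP.
have sx x : \sum_(f | s f == x) y f = 0.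
  rewrite -[RHS](yb (inl x)) /bdry big_mkcond /=; apply: eq_bigr => f _.
  rewrite (inj_eq (@inl_inj X Y)) addr0.
  by case: eqP; rewrite ?mul1r ?mul0r.
have ty x : \sum_(f | t f == x) y f = 0.
  rewrite -[RHS](yb (inr x)) /bdry big_mkcond /=; apply: eq_bigr => f _.
  rewrite (inj_eq (@inr_inj X Y)) add0r.
  by case: eqP; rewrite ?mul1r ?mul0r.
have [e1 [/eqP s1 y1 n1]] := other [pred f | s f == s e0] e0 (eqxx _) ye0 (sx (s e0)).
have [e2 [/eqP t2 y2 n2]] := other [pred f | t f == t e0] e0 (eqxx _) ye0 (ty (t e0)).
have [e3 [/eqP s3 y3 n3]] := other [pred f | s f == s e2] e2 (eqxx _) y2 (sx (s e2)).
have n12 : e1 != e2.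
  by apply: contra n1 => /eqP e12; apply/eqP/st_inj => //; rewrite e12.
have n30 : e3 != e0.
  apply: contra n2 => /eqP e30; apply/eqP/st_inj => //.
  by rewrite -e30 s3.
have n31 : e3 != e1.
  apply: contra n2 => /eqP e31; apply/eqP/st_inj => //.
  by rewrite -s1 -e31 s3.
have u4 : uniq [:: e0; e1; e2; e3].
  by rewrite /= !inE !negb_or ![e0 == _]eq_sym n1 n2 n30 n12 [e1 == e3]eq_sym n31
    [e2 == e3]eq_sym n3.
rewrite -(card_uniqP u4 : _ = 4)%N; apply: subset_leq_card; apply/fintype.subsetP => e.
by rewrite !inE => /or4P[]/eqP->.
Qed.

(** * The discrete torus and its cycles *)

Section Torus.
(* [(false, (i, j))] is the edge from [(i, j)] to [(i + 1, j)] and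
   [(true, (i, j))] the edge to [(i, j + 1)]; the face with lower left corner
   [(i, j)] is named [(i, j)]. The rows and columns of index [0] are kept free,
   so that the torus behaves like a planar grid. *)
Variable n : nat.
Let Z := 'I_n.+2.
Definition tdst (h : bool * (Z * Z)) : Z * Z :=
  if h.1 then (h.2.1, h.2.2 + 1) else (h.2.1 + 1, h.2.2).
Definition trg (h : bool * (Z * Z)) : Z * Z :=
  if h.1 then (h.2.1 - 1, h.2.2) else (h.2.1, h.2.2 - 1).
Definition tinn (c : Z * Z) := (c.1 != 0) && (c.2 != 0).
Let bd := @bdry (bool * (Z * Z))%type (Z * Z)%type snd tdst.

Lemma torus_bdryE z (a : Z * Z) : bd z a =
  z (false, a) + z (false, (a.1 - 1, a.2)) + z (true, a) + z (true, (a.1, a.2 - 1)).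
Proof.
have pickE (P : pred (Z * Z)) c (y : Z * Z -> 'F_2) : P =1 pred1 c ->
    \sum_x (P x)%:R * y x = y c.
  move=> Pc; rewrite (bigD1 c) //= Pc /= eqxx mul1r big1 ?addr0 // => x.
  by rewrite Pc /= => /negPf->; rewrite mul0r.
transitivity (\sum_(b : bool) \sum_(x : Z * Z)
    ((x == a)%:R + (tdst (b, x) == a)%:R) * z (b, x)).
  by rewrite pair_bigA; apply: eq_bigr => -[].
rewrite big_bool /=.
under eq_bigr do rewrite mulrDl.
under [X in _ + X]eq_bigr do rewrite mulrDl.
rewrite !big_split /= !(pickE (fun x => x == a) a) //.
rewrite (pickE (fun x => tdst (true, x) == a) (a.1, a.2 - 1)) => [|[i j]]; last first.
  case: a => p q; rewrite /tdst /= !xpair_eqE.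
  by rewrite [j == _]eq_sym subr_eq [q == _]eq_sym.
rewrite (pickE (fun x => tdst (false, x) == a) (a.1 - 1, a.2)) => [|[i j]]; last first.
  case: a => p q; rewrite /tdst /= !xpair_eqE.
  by rewrite [i == _]eq_sym subr_eq [p == _]eq_sym.
ring.
Qed.

Lemma torus_face_bound (chi : Z * Z -> 'F_2) a :
  bd (fun h => chi h.2 + chi (trg h)) a = 0.
Proof.
rewrite torus_bdryE /trg /=; case: a => i j /=.
set A := chi (i, j); set B := chi (i, j - 1).
set D := chi (i - 1, j); set E := chi (i - 1, j - 1).
have -> : A + B + (D + E) + (A + D) + (B + E)
  = (A + A) + (B + B) + (D + D) + (E + E) by ring.
by rewrite !addrr_F2.
Qed.

(** The face set is given by the parity of crossings with a ray down to row 0. Crossing one more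
    horizontal edge changes it by definition; for a vertical edge, [vert] compares neighbouring
    columns, climbing from the empty row 0 and using evenness at each vertex passed. *)
Lemma torus_cycle_face (z : bool * (Z * Z) -> 'F_2) :
  (forall h, z h != 0 -> tinn h.2 && tinn (tdst h)) ->
  (forall a, bd z a = 0) ->
  exists J : Z * Z -> 'F_2, forall h, tinn h.2 || tinn (tdst h) ->
    z h = J h.2 + J (trg h).
Proof.
move=> zs zb.
(* the number of edges of [z] crossed by a vertical ray *)
pose S (i : Z) m := \sum_(k < n.+2 | (k <= m)%N) z (false, (i, k)).
have inordS m : (m.+1 < n.+2)%N -> (inord m.+1 : Z) - 1 = inord m.
  move=> hm; apply/eqP; rewrite subr_eq; apply/eqP/val_inj.
  rewrite /= !inordK ?(ltnW hm) //.
  by rewrite modn_small // modn_small ?addn1.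
have SS i m : (m.+1 < n.+2)%N -> S i m.+1 = S i m + z (false, (i, inord m.+1)).
  move=> hm; rewrite /S (bigD1 (inord m.+1)) /= ?inordK // addrC.
  congr (_ + _); apply: eq_bigl => k.
  by rewrite -val_eqE /= inordK //; lia.
have z0 i : z (false, (i, 0)) = 0.
  by apply/eqP; apply: contraTT isT => /zs; rewrite /tinn eqxx andbF.
have v0 i : z (true, (i, 0)) = 0.
  by apply/eqP; apply: contraTT isT => /zs; rewrite /tinn eqxx andbF.
have ord00 : inord 0 = 0 :> Z by apply: val_inj; rewrite /= inordK.
have S0 i : S i 0 = 0.
  rewrite /S (bigD1 0) //= z0 big1 ?addr0 // => k /andP[k0].
  by rewrite -val_eqE /= -leqn0 k0.
have vert m i : (m < n.+2)%N -> S i m + S (i - 1) m = z (true, (i, inord m)).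
  elim: m => [|m IH] hm; first by rewrite !S0 ord00 v0 addr0.
  rewrite !SS // addrACA IH ?(ltnW hm) //.
  have := zb (i, inord m.+1); rewrite torus_bdryE /= inordS //.
  set a := z _; set b := z _; set c := z (true, (_, inord m.+1)).
  set d := z (true, _) => h.
  have : d + (a + b) + c = 0 by rewrite -h; ring.
  by move/eqP; rewrite addr_eq0 oppr_F2 => /eqP.
exists (fun f => S f.1 (val f.2)) => -[[] [i j]].
  by move=> _; have := vert j i (ltn_ord j); rewrite inord_val => <-.
move=> hi; change (z (false, (i, j)) = S i (val j) + S i (val (j - 1))); have j0 : j != 0.
  by move: hi; rewrite /tinn /tdst /= => /orP[] /andP[].
have jE : j = inord (val j).-1.+1.
  by apply: val_inj; rewrite /= inordK prednK ?lt0n.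
have jl : ((val j).-1.+1 < n.+2)%N by rewrite prednK ?lt0n // (ltn_ord j).
have -> : val (j - 1) = (val j).-1.
  by rewrite {1}jE inordS // [LHS]inordK // ltnW.
have -> : S i (val j) = S i (val j).-1 + z (false, (i, inord (val j).-1.+1)).
  by rewrite -SS // prednK ?lt0n.
by rewrite addrAC addrr_F2 add0r -jE.
Qed.

End Torus.

(** * Bipartite minors of the square grid *)

Definition gadj (a b : nat * nat) : bool :=
  ((a.1 == b.1) && ((a.2.+1 == b.2) || (b.2.+1 == a.2))) ||
  ((a.2 == b.2) && ((a.1.+1 == b.1) || (b.1.+1 == a.1))).

Theorem grid_minor_bound (X Y E : finType) (s : E -> X) (t : E -> Y) (M : nat)
    (B : X + Y -> pred (nat * nat)) :
  (forall e f, s e = s f -> t e = t f -> e = f) ->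
  (forall u a, B u a -> (0 < a.1 < M)%N && (0 < a.2 < M)%N) ->
  (forall u v a, B u a -> B v a -> u = v) ->
  (forall u a b, B u a -> B u b ->
     exists p, [/\ path gadj a p, last a p = b & all (B u) p]) ->
  (forall e, exists a b, [/\ B (inl (s e)) a, B (inr (t e)) b & gadj a b]) ->
  (#|E| <= 2 * (#|X| + #|Y|))%N.
Proof.
move=> st_inj Bin Bdis Bconn Badj; rewrite -card_sum.
(* Coordinates in branch sets lie strictly between 0 and [M], so row and column 0 of the torus stay
   free and successors never wrap around. *)
pose Z := 'I_M.+2.
pose emb (a : nat * nat) : Z * Z := (inord a.1, inord a.2).
pose own (c : Z * Z) := [pick u | B u (val c.1, val c.2)].
have emb1 u a : B u a -> val (emb a).1 = a.1.
  by move=> /Bin /andP[/andP[_ h] _]; rewrite /emb /= inordK // ltnW // ltnS ltnW.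
have emb2 u a : B u a -> val (emb a).2 = a.2.
  by move=> /Bin /andP[_ /andP[_ h]]; rewrite /emb /= inordK // ltnW // ltnS ltnW.
have ownE u a : B u a -> own (emb a) = Some u.
  move=> ua; rewrite /own (emb1 _ _ ua) (emb2 _ _ ua) -surjective_pairing.
  by case: pickP => [v /(Bdis _ _ _ ua)->//|/(_ u)]; rewrite ua.
have ownP c u : own c = Some u -> B u (val c.1, val c.2) /\ emb (val c.1, val c.2) = c.
  rewrite /own; case: pickP => // v Bv [<-]; split=> //.
  by rewrite /emb /= !inord_val -surjective_pairing.
have gedge a b u v : gadj a b -> B u a -> B v b -> exists h : bool * (Z * Z),
    (h.2 = emb a /\ tdst h = emb b) \/ (h.2 = emb b /\ tdst h = emb a).
  have aux i : (i < M)%N -> (inord i : Z) + 1 = inord i.+1.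
    move=> im; apply: val_inj; rewrite /= !inordK ?(ltn_trans im) ?ltnS ?(ltnW im) //.
    by rewrite modnDmr addn1 modn_small // !ltnS ltnW.
  case: a b => [i j] [k l] ab /Bin /andP[/andP[_ /= iM] /andP[_ /= jM]].
  move=> /Bin /andP[/andP[_ /= kM] /andP[_ /= lM]].
  move: ab; rewrite /gadj /= => /orP[|] /andP[/eqP-> /orP[]/eqP h].
  - by exists (true, emb (k, j)); left; rewrite /tdst /emb /= aux // h.
  - by exists (true, emb (k, l)); right; rewrite /tdst /emb /= aux // h.
  - by exists (false, emb (i, l)); left; rewrite /tdst /emb /= aux // h.
  - by exists (false, emb (k, l)); right; rewrite /tdst /emb /= aux // h.
have /fin_all_exists[eps epsP] e : exists h : bool * (Z * Z),
    (own h.2 = Some (inl (s e)) /\ own (tdst h) = Some (inr (t e))) \/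
    (own h.2 = Some (inr (t e)) /\ own (tdst h) = Some (inl (s e))).
  have [a [b [Ba Bb ab]]] := Badj e.
  have [h hP] := gedge _ _ _ _ ab Ba Bb; exists h.
  by case: hP => -[-> ->]; [left|right]; rewrite (ownE _ _ Ba) (ownE _ _ Bb).
apply: (@maclane_bound _ _ _ _ _ snd (@tdst M) snd (@trg M) (@tinn M)
  (inl \o s) (inr \o t) own eps) => //.
- exact: torus_face_bound.
- exact: torus_cycle_face.
- move=> c; case oc : (own c) => [u|//] _.
  have [/Bin /andP[/= /andP[h _] /andP[h' _]] _] := ownP _ _ oc.
  by rewrite /tinn -!val_eqE /= -!lt0n h h'.
- move=> e f ef; have := epsP e; have := epsP f; rewrite ef.
  move=> [] [-> ->] [] [] // [h1] [h2]; exact: st_inj.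
- move=> a b; case oa : (own a) => [u|//] _ /esym ob.
  have [Ba <-] := ownP _ _ oa; have [Bb <-] := ownP _ _ ob.
  have [p [pp <- pB]] := Bconn _ _ _ Ba Bb.
  elim: p (val a.1, val a.2) Ba pp pB => //= c p IH d Bd /andP[dc cp] /andP[Bc Bp].
  apply: connect_trans (IH _ Bc cp Bp); apply: connect1.
  have [h hP] := gedge _ _ _ _ dc Bd Bc.
  apply/existsP; exists h; rewrite /internal.
  by case: hP => -[-> ->]; rewrite !(ownE u) // !eqxx //= orbT.
- by move=> y; apply: bip_girth4.
Qed.

End CycleSpace.

(** * From planar drawings to Hall's condition *)

Section Walks.

Definition gconn (P : pred (nat * nat)) a b :=
  exists p, [/\ path gadj a p, last a p = b & all P p].

Lemma gadjC a b : gadj a b = gadj b a.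
Proof.
by rewrite /gadj [a.1 == _]eq_sym [a.2 == b.2]eq_sym [_ || (_ == a.2)]orbC
  [_ || (_ == a.1)]orbC.
Qed.

Lemma gconn_trans P b a c : gconn P a b -> gconn P b c -> gconn P a c.
Proof.
move=> [p [pp <- pP]] [q [qp qE qP]]; exists (p ++ q).
by rewrite cat_path pp qp last_cat qE all_cat pP qP.
Qed.

Lemma gconn_sym (P : pred (nat * nat)) a b : P a -> gconn P a b -> gconn P b a.
Proof.
move=> Pa [p [pp <- pP]]; exists (rev (belast a p)); split.
- by rewrite rev_path; under eq_path do rewrite gadjC.
- by case: p pp pP => //= c p _ _; rewrite rev_cons last_rcons.
rewrite all_rev; move: pP; elim: p a Pa {pp} => //= c p IH a Pa /andP[Pc Pp].
by rewrite Pa IH.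
Qed.

Local Open Scope ring_scope.
Variable R : realType.
Implicit Types (p q : R * R) (a : nat * nat) (m : R).

Definition cell p : nat * nat := (Num.truncn p.1, Num.truncn p.2).

Definition cpt a : R * R := (a.1%:R, a.2%:R).

Definition sup_near m p q := (`|p.1 - q.1| <= m) && (`|p.2 - q.2| <= m).

Lemma sup_near_triangle q m k p r :
  sup_near m p q -> sup_near k q r -> sup_near (m + k) p r.
Proof.
move=> /andP[h1 h2] /andP[h3 h4]; apply/andP; split.
  have -> : p.1 - r.1 = (p.1 - q.1) + (q.1 - r.1) by ring.
  by apply: le_trans (ler_normD _ _) _; lra.
have -> : p.2 - r.2 = (p.2 - q.2) + (q.2 - r.2) by ring.
by apply: le_trans (ler_normD _ _) _; lra.
Qed.

Lemma sup_near_sym m p q : sup_near m p q = sup_near m q p.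
Proof. by rewrite /sup_near distrC [`|p.2 - _|]distrC. Qed.

Lemma sup_near_le k m p q : k <= m -> sup_near k p q -> sup_near m p q.
Proof. by move=> km /andP[h1 h2]; apply/andP; split; lra. Qed.

Lemma sup_near_cell p : 0 <= p.1 -> 0 <= p.2 -> sup_near 1 (cpt (cell p)) p.
Proof.
move=> /truncn_itv/andP[h1 h2] /truncn_itv/andP[h3 h4].
move: h2 h4; rewrite -!natr1 => h2 h4.
by rewrite /sup_near /cell /= !ler_norml; apply/andP; split; lra.
Qed.

(** Cells of points at distance at most 1 may be diagonal neighbours, so the walk turns at a corner
    cell, which takes one coordinate from each. This corner is what raises the bound from 1 to 2. *)
Lemma cell_step p q : 0 <= p.1 -> 0 <= p.2 -> 0 <= q.1 -> 0 <= q.2 ->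
  sup_near 1 p q -> gconn (fun a => sup_near 2 (cpt a) q) (cell p) (cell q).
Proof.
have step (x y : R) : 0 <= x -> 0 <= y -> `|x - y| <= 1 ->
    (Num.truncn x == Num.truncn y) || ((Num.truncn x).+1 == Num.truncn y)
    || ((Num.truncn y).+1 == Num.truncn x).
  move=> /truncn_itv/andP[h1 h2] /truncn_itv/andP[h3 h4].
  rewrite ler_norml => /andP[h5 h6].
  have : (Num.truncn x < (Num.truncn y).+2)%N.
    by rewrite -(ltr_nat R) -[_.+2%:R]natr1; lra.
  have : (Num.truncn y < (Num.truncn x).+2)%N.
    by rewrite -(ltr_nat R) -[_.+2%:R]natr1; lra.
  lia.
move=> p1 p2 q1 q2 /andP[n1 n2].
have nq := sup_near_cell q1 q2; have np := sup_near_cell p1 p2.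
have nq2 : sup_near 2 (cpt (cell q)) q by apply: sup_near_le nq; lra.
have ncorner : sup_near 2 (cpt ((cell q).1, (cell p).2)) q.
  case/andP: nq => h1 h2; case/andP: np => h3 h4; apply/andP; split.
    by apply: le_trans h1 _; lra.
  rewrite /=; have -> : (Num.truncn p.2)%:R - q.2 = ((Num.truncn p.2)%:R - p.2) + (p.2 - q.2) by ring.
  by apply: le_trans (ler_normD _ _) _; move: h4 n2; rewrite /=; lra.
apply: (@gconn_trans _ ((cell q).1, (cell p).2)).
  have [->|ne] := eqVneq (cell q).1 (cell p).1.
    by exists [::]; rewrite -surjective_pairing.
  exists [:: ((cell q).1, (cell p).2)]; split=> //=; last by rewrite ncorner.
  rewrite andbT /gadj /= eqxx /=; have := step _ _ p1 q1 n1.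
  by rewrite /= eq_sym in ne; rewrite (negPf ne).
have [->|ne] := eqVneq (cell p).2 (cell q).2.
  by exists [::]; rewrite -surjective_pairing.
exists [:: cell q]; split=> //=; last by rewrite nq2.
rewrite andbT /gadj /= eqxx /=; have := step _ _ p2 q2 n2.
by rewrite /= in ne; rewrite (negPf ne) /= => ->.
Qed.

(** Boxes are convex in each coordinate: move one step towards [b] and induct on the l1 distance,
    each absolute value being a sum of two truncated differences. *)
Lemma box_conn m p a b : sup_near m (cpt a) p -> sup_near m (cpt b) p ->
  gconn (fun c => sup_near m (cpt c) p) a b.
Proof.
pose dist a b := ((a.1 - b.1) + (b.1 - a.1) + ((a.2 - b.2) + (b.2 - a.2)))%N.
move dE : (dist a b) => d.
elim: d => [|d IH] in a dE *; move=> Na Nb.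
  exists [::]; split=> //=; rewrite [a]surjective_pairing [b]surjective_pairing.
  by rewrite /dist in dE; congr (_, _); lia.
have conv (i j k : nat) (x : R) : `|i%:R - x| <= m -> `|k%:R - x| <= m ->
    (i <= j <= k)%N -> `|j%:R - x| <= m.
  rewrite !ler_norml => /andP[h1 h2] /andP[h3 h4] /andP[].
  by rewrite -!(ler_nat R) => h5 h6; apply/andP; split; lra.
suff [a' [aa' Na' da']] : exists a', [/\ gadj a a', sup_near m (cpt a') p & dist a' b = d].
  apply: gconn_trans (IH _ da' Na' Nb).
  by exists [:: a']; rewrite /= aa' Na'.
case/andP: Na => Na1 Na2; case/andP: Nb => Nb1 Nb2.
have [h|h|h] := ltngtP a.1 b.1.
- exists (a.1.+1, a.2); split; rewrite /gadj /sup_near /=.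
  + by rewrite !eqxx orbT.
  + by rewrite Na2 (conv a.1 _ b.1) // leqnSn.
  by rewrite /dist /= in dE *; lia.
- exists (a.1.-1, a.2); split; rewrite /gadj /sup_near /=.
  + by rewrite eqxx prednK ?eqxx ?orbT //; lia.
  + by rewrite Na2 (conv b.1 _ a.1) //; lia.
  by rewrite /dist /= in dE *; lia.
have [h'|h'|h'] := ltngtP a.2 b.2.
- exists (a.1, a.2.+1); split; rewrite /gadj /sup_near /=.
  + by rewrite !eqxx.
  + by rewrite Na1 (conv a.2 _ b.2) // leqnSn.
  by rewrite /dist /= in dE *; lia.
- exists (a.1, a.2.-1); split; rewrite /gadj /sup_near /=.
  + by rewrite eqxx prednK ?eqxx ?orbT //; lia.
  + by rewrite Na1 (conv b.2 _ a.2) //; lia.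
  by rewrite /dist /= in dE *; lia.
by rewrite /dist in dE; lia.
Qed.

Local Open Scope classical_set_scope.

(** The times whose cell can be reached form a clopen part of the unit interval: by continuity the
    points at nearby times are within 1, and [cell_step] bridges them in either direction.
    Connectedness then reaches time 1. *)
Lemma walk_of_path (g : R -> R * R) : {within `[0, 1], continuous g} ->
  (forall t : R, 0 <= t <= 1 -> 0 <= (g t).1 /\ 0 <= (g t).2) ->
  exists w, [/\ path gadj (cell (g 0)) w, last (cell (g 0)) w = cell (g 1) &
    forall a, a \in w -> exists2 t : R, 0 <= t <= 1 & sup_near 2 (cpt a) (g t)].
Proof.
move=> gc gpos.
pose P (t : R) := exists w, [/\ path gadj (cell (g 0)) w, last (cell (g 0)) w = cell (g t) &
    forall a, a \in w -> exists2 t : R, 0 <= t <= 1 & sup_near 2 (cpt a) (g t)].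
have Pstep (s t : R) : 0 <= s <= 1 -> 0 <= t <= 1 -> sup_near 1 (g s) (g t) -> P s -> P t.
  move=> s01 t01 nst [p [pp pl pn]].
  have [s1 s2] := gpos s s01; have [t1 t2] := gpos t t01.
  have [q [qp ql /allP qn]] := cell_step s1 s2 t1 t2 nst.
  exists (p ++ q); split; first by rewrite cat_path pp pl qp.
    by rewrite last_cat pl.
  by move=> a; rewrite mem_cat => /orP[/pn//|/qn]; exists t.
have loc (t : R) : 0 <= t <= 1 -> \forall s \near t, 0 <= s <= 1 -> sup_near 1 (g t) (g s).
  move=> t01; have /subspace_continuousP/(_ t) gt := gc.
  have /gt : `[0, 1]%classic t by rewrite /= in_itv.
  move=> /cvg_ball /(_ 1 ltr01) gnear.
  have : within `[0, 1] (nbhs t) [set x | ball (g t) 1 (g x)] by exact: gnear.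
  rewrite /within /=.
  apply: filterS => s h s01; have /h : `[0, 1]%classic s by rewrite /= in_itv.
   rewrite ball_prod_normE /ball_ /= prod_normE.
  by rewrite gt_max /sup_near => /andP[/ltW -> /ltW ->].
suff : P 1 by [].
apply: contrapT => nP1.
have /connectedP/(_ (fun b : bool => if b then [set t | 0 <= t <= 1 /\ P t]
   else [set t | 0 <= t <= 1 /\ ~ P t])) := @segment_connected R 0 1.
apply; split.
- case; [exists 0|exists 1]; split=> //; rewrite ?lexx ?ler01 //.
  by exists [::].
- apply/seteqP; split=> t /=; rewrite in_itv /=; last by move=> [] [].
  by move=> t01; have [Pt|nPt] := pselect (P t); [right|left].
- split; apply/seteqP; split=> t //= [].
  + move=> ct [t01 Pt]; have [s [[s01 nPs] /(_ s01) nst]] := ct _ (loc t t01).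
    by apply: nPs; apply: Pstep nst Pt.
  + move=> [t01 nPt] ct; have [s [[s01 Ps] /(_ s01) nst]] := ct _ (loc t t01).
    by apply: nPt; apply: Pstep Ps; rewrite // sup_near_sym.
Qed.


Lemma all_take_find (T : Type) (P : pred T) (w : seq T) :
  all (predC P) (take (find P w) w).
Proof. by elim: w => //= x w IH; case: ifP => //= ->. Qed.

(** The margins come from cells of a walk lying within 2 of its arc. Staying [m + 2] away keeps a
    walk out of foreign boxes of radius [m]; a cell outside its own box comes from a point of the
    arc outside radius [m - 2]; a cell shared by two walks would put two such points within 4; and
    [3] keeps cells off the axes. *)
Lemma scaled_drawing_bound (X Y E : finType) (s : E -> X) (t : E -> Y)
    (px : X -> R * R) (py : Y -> R * R) (g : E -> R -> R * R) (m K : R) :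
  (forall e f, s e = s f -> t e = t f -> e = f) -> 1 <= m ->
  (forall e, {within `[0, 1], continuous (g e)}) ->
  (forall e, g e 0 = px (s e)) -> (forall e, g e 1 = py (t e)) ->
  (forall e (u : R), 0 <= u <= 1 ->
     [&& 3 <= (g e u).1, (g e u).1 <= K, 3 <= (g e u).2 & (g e u).2 <= K]) ->
  (forall y, [&& m + 3 <= (py y).1, (py y).1 <= K, m + 3 <= (py y).2 & (py y).2 <= K]) ->
  (forall y y', y != y' -> ~~ sup_near (m + m) (py y) (py y')) ->
  (forall e y (u : R), y != t e -> 0 <= u <= 1 -> ~~ sup_near (m + 2) (g e u) (py y)) ->
  (forall e f (u v : R), s e != s f -> 0 <= u <= 1 -> 0 <= v <= 1 ->
     ~~ sup_near (m - 2) (g e u) (py (t e)) ->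
     ~~ sup_near (m - 2) (g f v) (py (t f)) -> ~~ sup_near 4 (g e u) (g f v)) ->
  (forall e, ~~ sup_near (m + 2) (px (s e)) (py (t e))) ->
  (#|E| <= 2 * (#|X| + #|Y|))%N.
Proof.
move=> st_inj m1 gc g0 g1 gb pyb h1 h2 h3 h4.
have gpos e (u : R) : 0 <= u <= 1 -> 0 <= (g e u).1 /\ 0 <= (g e u).2.
  by move=> /(gb e) /and4P[? _ ? _]; split; lra.
have /fin_all_exists[w wP] e := walk_of_path (gc e) (gpos e).
pose D y a := sup_near m (cpt a) (py y).
pose pre e := take (find (D (t e)) (w e)) (w e).
pose c0 x := cell (px x).
have u0 : 0 <= (0 : R) <= 1 by rewrite lexx ler01.
have u1 : 0 <= (1 : R) <= 1 by rewrite lexx ler01.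
have nc0 e : sup_near 1 (cpt (c0 (s e))) (g e 0).
  by rewrite /c0 -g0; apply: sup_near_cell; case: (gpos e 0 u0).
have c0D e : ~~ D (t e) (c0 (s e)).
  apply: contra (h4 e) => dc; rewrite -g0.
  by apply: (sup_near_le (k := 1 + m)); [lra|apply: sup_near_triangle dc; rewrite sup_near_sym].
have preP e a : a \in c0 (s e) :: pre e -> ~~ D (t e) a /\
    exists2 u : R, 0 <= u <= 1 & sup_near 2 (cpt a) (g e u).
  rewrite inE => /orP[/eqP->|ap]; split=> //.
  - by exists 0 => //; apply: sup_near_le (nc0 e); lra.
  - by have /allP/(_ _ ap) := all_take_find (D (t e)) (w e).
  - by have [_ _] := wP e; apply; apply: mem_take ap.
(* All walks of a clause start in [c0 x], which makes their union connected; a clause without edges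
   gets the empty set. *)
pose B (u : X + Y) : pred (nat * nat) := match u with
  | inl x => fun a => [exists e, (s e == x) && (a \in c0 x :: pre e)]
  | inr y => D y end.
have BlP x a : B (inl x) a -> exists e, [/\ s e = x, ~~ D (t e) a &
    exists2 u : R, 0 <= u <= 1 & sup_near 2 (cpt a) (g e u)].
  by move=> /existsP[e /andP[/eqP <- /preP[]]]; exists e.
have Bdisj x y a : B (inl x) a -> D y a -> False.
  move=> /BlP[e [_ nD [u u01 na]]] Da.
  have [yt|yt] := eqVneq y (t e); first by rewrite -yt Da in nD.
  have /negP := h2 e y u yt u01; apply; rewrite addrC.
  by apply: sup_near_triangle Da; rewrite sup_near_sym.
pose M := (Num.truncn (K + m + 3)).+1.
apply: (@grid_minor_bound X Y E s t M B) => //.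
- have aux (n : nat) : 1 <= n%:R :> R -> n%:R <= K + m + 2 -> (0 < n < M)%N.
    move=> n1 nK; apply/andP; split; first by rewrite -(ler_nat R).
    rewrite /M -(ltr_nat R); apply: le_lt_trans (truncnS_gt _); lra.
  move=> [x|y] a.
    move=> /BlP[e [_ _ [u u01 /andP[]]]]; have /and4P[? ? ? ?] := gb e u u01.
    by rewrite !ler_norml /= => /andP[? ?] /andP[? ?]; rewrite !aux //; lra.
  rewrite /B /D => /andP[]; have /and4P[? ? ? ?] := pyb y.
  by rewrite !ler_norml /= => /andP[? ?] /andP[? ?]; rewrite !aux //; lra.
- move=> [x|y] [x'|y'] a Ba Bb.
  + have [e [se nDe [u u01 nu]]] := BlP _ _ Ba.
    have [f [sf nDf [v v01 nv]]] := BlP _ _ Bb.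
    congr inl; apply: contrapT => /eqP xx; rewrite -se -sf in xx.
    suff /negP : ~~ sup_near 4 (g e u) (g f v).
      apply; apply: (sup_near_le (k := 2 + 2)); first lra.
      by apply: sup_near_triangle nv; rewrite sup_near_sym.
    apply: h3 xx u01 v01 _ _.
    * apply: contra nDe => nn; apply: (sup_near_le (k := 2 + (m - 2))); first lra.
      exact: sup_near_triangle nu nn.
    * apply: contra nDf => nn; apply: (sup_near_le (k := 2 + (m - 2))); first lra.
      exact: sup_near_triangle nv nn.
  + by case: (Bdisj _ _ _ Ba Bb).
  + by case: (Bdisj _ _ _ Bb Ba).
  + congr inr; apply: contrapT => /eqP /h1 /negP; apply.
    by apply: sup_near_triangle Bb; rewrite sup_near_sym.
- move=> [x|y] a b; last exact: box_conn.
  have Bc0 e : s e = x -> B (inl x) (c0 x).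
    by move=> se; apply/existsP; exists e; rewrite se eqxx inE eqxx.
  have to0 d : B (inl x) d -> gconn (B (inl x)) (c0 x) d.
    move=> /existsP[e /andP[/eqP se]]; rewrite inE => /orP[/eqP->|dp].
      by exists [::].
    have [wp _ _] := wP e; rewrite g0 se -/(c0 x) in wp.
    have pp : path gadj (c0 x) (pre e) by apply: take_path.
    exists (take (index d (pre e)).+1 (pre e)); split; first exact: take_path.
      rewrite (take_nth d) ?index_mem // last_rcons nth_index //.
    apply/allP => c /mem_take cp; apply/existsP; exists e.
    by rewrite se eqxx inE cp orbT.
  move=> Ba Bb; apply: (@gconn_trans _ (c0 x)); last exact: to0.
  apply: gconn_sym (to0 _ Ba); by have /existsP[e /andP[/eqP /Bc0]] := Ba.
- move=> e; have [wp wl _] := wP e; rewrite g0 -/(c0 (s e)) g1 in wp wl.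
  have hasD : has (D (t e)) (w e).
    have : D (t e) (last (c0 (s e)) (w e)).
      rewrite wl; apply: (sup_near_le m1); apply: sup_near_cell;
      by rewrite -g1; case: (gpos e 1 u1).
    case: (w e) => [|c p] /=; first by rewrite (negPf (c0D e)).
    move=> Dl; change (has (D (t e)) (c :: p)); apply/hasP.
    by exists (last c p) => //; exact: mem_last.
  exists (last (c0 (s e)) (pre e)), (nth (0, 0)%N (w e) (find (D (t e)) (w e))); split.
  + by apply/existsP; exists e; rewrite eqxx mem_last.
  + exact: nth_find.
  move: wp; rewrite -{1}(cat_take_drop (find (D (t e)) (w e)) (w e)) cat_path.
  by move=> /andP[_]; rewrite (drop_nth (0, 0)%N) -?has_find //= => /andP[].
Qed.


(** * Separation by compactness, and magnification *)

Lemma compact_sep (A B : set (R * R)) : compact A -> compact B ->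
  (forall p, A p -> B p -> False) ->
  exists2 d : R, 0 < d & forall p q, A p -> B q -> ~~ sup_near d p q.
Proof.
move=> cA cB AB.
have [[a Aa]|A0] := pselect (A !=set0); last first.
  by exists 1 => // p q Ap; case: A0; exists p.
have [[b Bb]|B0] := pselect (B !=set0); last first.
  by exists 1 => // p q _ Bq; case: B0; exists q.
pose f (x : (R * R) * (R * R)) : R := `|x.1 - x.2|.
have [||c cAB cmin] := @compact_EVT_min _ R f (A `*` B) _ (compact_setX cA cB).
- by exists (a, b).
- apply: continuous_subspaceT => x; apply: cvg_norm; apply: cvgB.
    exact: cvg_fst.
  exact: cvg_snd.
move: cAB; rewrite inE => -[/= Ac Bc].
have fc0 : 0 < f c.
  rewrite normr_gt0 subr_eq0; apply/eqP => cc; apply: (AB _ Ac).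
  by rewrite cc.
(* Halved because [sup_near] is not strict, so the minimal distance itself may be attained. *)
exists (f c / 2) => [|p q Ap Bq]; first by rewrite divr_gt0.
apply/negP => /andP[h1 h2].
have : f c <= f (p, q) by apply: cmin; rewrite inE.
apply/negP; rewrite -ltNge /f prod_normE gt_max /=; apply/andP; split.
  by apply: le_lt_trans h1 _; rewrite ltr_pdivrMr // ltr_pMr // ltr1n.
by apply: le_lt_trans h2 _; rewrite ltr_pdivrMr // ltr_pMr // ltr1n.
Qed.

Lemma fin_pos_min (I : finType) (Q : I -> R -> Prop) :
  (forall i d e, 0 < d -> d <= e -> Q i e -> Q i d) ->
  (forall i, exists2 d : R, 0 < d & Q i d) -> exists2 d : R, 0 < d & forall i, Q i d.
Proof.
move=> Qd /fin_all_exists2[d d0 dQ].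
have m0 : 0 < \big[Order.min/1]_i d i by apply: lt_bigmin.
exists (\big[Order.min/1]_i d i) => // i.
by apply: Qd (dQ i) => //; apply: bigmin_le.
Qed.

Lemma fin_max (I : finType) (Q : I -> R -> Prop) :
  (forall i d e, d <= e -> Q i d -> Q i e) ->
  (forall i, exists d : R, Q i d) -> exists d : R, forall i, Q i d.
Proof.
move=> Qd /fin_all_exists[d dQ].
exists (\big[Order.max/0]_i d i) => i.
by apply: Qd (dQ i); apply: le_bigmax.
Qed.

Definition rescale (l v : R) p : R * R := (l * p.1 + v, l * p.2 + v).

Lemma sup_near_rescale l v k p q : 0 < l ->
  sup_near (l * k) (rescale l v p) (rescale l v q) = sup_near k p q.
Proof.
move=> l0; rewrite /sup_near /rescale /=.
have aux (x y : R) : `|l * x + v - (l * y + v)| = l * `|x - y|.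
  by rewrite -[in RHS](gtr0_norm l0) -normrM; congr `|_|; ring.
by rewrite !aux !ler_pM2l.
Qed.

Lemma continuous_rescale l v : continuous (rescale l v).
Proof.
move=> p.
have h1 : (l * x.1 + v) @[x --> p] --> l * p.1 + v.
  by apply: cvgD; [apply: cvgMl_tmp; exact: cvg_fst|exact: cvg_cst].
have h2 : (l * x.2 + v) @[x --> p] --> l * p.2 + v.
  by apply: cvgD; [apply: cvgMl_tmp; exact: cvg_snd|exact: cvg_cst].
exact: cvg_pair h1 h2.
Qed.

(** Arcs of different clauses meet only at a common variable end. Their parts [far] away from these
    ends are therefore disjoint compact sets, at some distance [d]; magnification turns [d] and the
    separation [r] of the variables from one another, from foreign arcs and from the clauses into
    the margins of [scaled_drawing_bound]. *)
Theorem bipartite_drawing_bound (X Y E : finType) (s : E -> X) (t : E -> Y)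
    (px : X -> R * R) (py : Y -> R * R) (g : E -> R -> R * R) :
  (forall e f, s e = s f -> t e = t f -> e = f) ->
  injective py -> (forall x y, px x <> py y) ->
  (forall e, {within `[0, 1], continuous (g e)}) ->
  (forall e, g e 0 = px (s e)) -> (forall e, g e 1 = py (t e)) ->
  (forall e y (u : R), 0 <= u <= 1 -> g e u = py y -> y = t e) ->
  (forall e f (u v : R), s e != s f -> 0 <= u <= 1 -> 0 <= v <= 1 ->
     g e u = g f v -> g e u = py (t e)) ->
  (#|E| <= 2 * (#|X| + #|Y|))%N.
Proof.
move=> st_inj py_inj pxy gc g0 g1 gF1 gF2.
pose arc e := g e @` `[0, 1]%classic.
have carc e : compact (arc e).
  by apply: continuous_compact (gc e) _; exact: segment_compact.
have garc e (u : R) : 0 <= u <= 1 -> arc e (g e u).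
  by move=> u01; exists u => //=; rewrite in_itv.
have arcP e p : arc e p -> exists2 u : R, 0 <= u <= 1 & p = g e u.
  by move=> [u /=]; rewrite in_itv /= => u01 <-; exists u.
have near_lt d d' p q : d <= d' -> ~~ sup_near d' p q -> ~~ sup_near d p q.
  by move=> dd; apply: contra; apply: sup_near_le.
have [r1 r10 r1P] : exists2 d : R, 0 < d & forall yy : Y * Y, yy.1 != yy.2 ->
    ~~ sup_near d (py yy.1) (py yy.2).
  apply: fin_pos_min => [i d e _ de h /h|[y y'] /=]; first exact: near_lt.
  have [->|yy] := eqVneq y y'; first by exists 1.
  have [||p -> /py_inj /eqP|d d0 dP] := @compact_sep [set py y] [set py y'].
  - exact: compact_set1.
  - exact: compact_set1.
  - by rewrite (negPf yy).
  by exists d => // _; apply: dP.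
have [r2 r20 r2P] : exists2 d : R, 0 < d & forall ey : E * Y, ey.2 != t ey.1 ->
    forall u : R, 0 <= u <= 1 -> ~~ sup_near d (g ey.1 u) (py ey.2).
  apply: fin_pos_min => [i d e _ de h /h h' u /h'|[e y] /=]; first exact: near_lt.
  have [->|yy] := eqVneq y (t e); first by exists 1.
  have [||p|d d0 dP] := @compact_sep (arc e) [set py y].
  - exact: carc.
  - exact: compact_set1.
  - move=> /arcP[u u01 ->] /= /(gF1 _ _ _ u01) /eqP; by rewrite (negPf yy).
  by exists d => // _ u u01; apply: dP => //; apply: garc.
have [r3 r30 r3P] : exists2 d : R, 0 < d & forall e : E,
    ~~ sup_near d (px (s e)) (py (t e)).
  apply: fin_pos_min => [i d e _|e]; first exact: near_lt.
  have [||p|d d0 dP] := @compact_sep [set px (s e)] [set py (t e)].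
  - exact: compact_set1.
  - exact: compact_set1.
  - by move=> -> /= /pxy.
  by exists d => //; apply: dP.
pose r := Num.min r1 (Num.min r2 r3).
have r0 : 0 < r by rewrite !lt_min r10 r20.
have rr1 : r <= r1 by rewrite ge_min lexx.
have rr2 : r <= r2 by rewrite !ge_min lexx orbT.
have rr3 : r <= r3 by rewrite !ge_min lexx !orbT.
pose far e := arc e `&` [set p | r / 8 <= `|p - py (t e)|].
have cfar e : compact (far e).
  apply: compact_closedI (carc e) _.
  apply: (@preimage_closed _ _ (fun p => `|p - py (t e)|) [set x | r / 8 <= x]).
    by move=> p _; apply: cvg_norm; apply: cvgB; [exact: cvg_id|exact: cvg_cst].
  exact: closed_ge.
have [d d0 dP] : exists2 d : R, 0 < d & forall ef : E * E, s ef.1 != s ef.2 ->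
    forall p q, far ef.1 p -> far ef.2 q -> ~~ sup_near d p q.
  apply: fin_pos_min => [i d e _ de h /h h' p q fp /(h' _ _ fp)|[e f] /=].
    exact: near_lt.
  case: (eqVneq (s e) (s f)) => [_|ss]; first by exists 1.
  have [||p|d d0 dP] := @compact_sep (far e) (far f); try exact: cfar.
    move=> [/arcP[u u01 ->] fu] [/arcP[v v01 uv] _].
    move: fu; rewrite /= (gF2 e f u v ss u01 v01 uv) subrr normr0.
    by rewrite leNgt divr_gt0.
  by exists d => // _; apply: dP.
have [K1 K1P] : exists K : R, forall e p, arc e p -> `|p| <= K.
  apply: fin_max => [i k l kl h p /h|e]; first by move/le_trans; apply.
  have [K [_ KP]] := compact_bounded (carc e).
  by exists (K + 1) => p; apply: KP; rewrite ltrDl.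
have [K2 K2P] : exists K : R, forall y, `|py y| <= K.
  by apply: fin_max => [i k l kl /le_trans|y]; [apply|exists `|py y|].
pose K0 := Num.max K1 K2.
have K0P1 e (u : R) : 0 <= u <= 1 -> `|g e u| <= K0.
  by move=> /garc h; rewrite le_max (K1P e).
have K0P2 y : `|py y| <= K0 by rewrite le_max K2P orbT.
pose l := 16 / r + 4 / d; pose m := l * (r / 4); pose v := m + 3 + l * K0.
have l16 : 16 <= l * r.
  by rewrite mulrDl divfK ?gt_eqF // lerDl mulr_ge0 ?divr_ge0 // ltW.
have l4 : 4 <= l * d.
  by rewrite mulrDl (divfK (lt0r_neq0 d0)) lerDr mulr_ge0 ?divr_ge0 // ltW.
have l0 : 0 < l by rewrite addr_gt0 ?divr_gt0.
have m4 : 4 <= m by rewrite /m; lra.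
have coords p : `|p| <= K0 -> [/\ m + 3 <= (rescale l v p).1,
    (rescale l v p).1 <= l * K0 + v, m + 3 <= (rescale l v p).2 &
    (rescale l v p).2 <= l * K0 + v].
  rewrite prod_normE ge_max !ler_norml => /andP[/andP[h1 h2] /andP[h3 h4]].
  have := ler_wpM2l (ltW l0) h1; have := ler_wpM2l (ltW l0) h2.
  have := ler_wpM2l (ltW l0) h3; have := ler_wpM2l (ltW l0) h4.
  by rewrite /rescale /v /= !mulrN; split; lra.
apply: (@scaled_drawing_bound X Y E s t (rescale l v \o px) (rescale l v \o py)
   (fun e => rescale l v \o g e) m (l * K0 + v)) => //=.
- lra.
- move=> e; apply: within_continuous_comp (gc e).
  by move=> p _; apply: continuous_rescale.
- by move=> e; rewrite g0.
- by move=> e; rewrite g1.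
- move=> e u u01; have := coords _ (K0P1 e u u01); rewrite /rescale /=.
  by move=> [h1 h2 h3 h4]; apply/and4P; split; lra.
- move=> y; have := coords _ (K0P2 y); rewrite /rescale /=.
  by move=> [h1 h2 h3 h4]; apply/and4P; split; lra.
- move=> y y' yy; apply: (@near_lt _ (l * r1)); last first.
    by rewrite sup_near_rescale //; apply: (r1P (y, y')).
  have := ler_wpM2l (ltW l0) rr1; rewrite /m; lra.
- move=> e y u yt u01; apply: (@near_lt _ (l * r2)); last first.
    by rewrite sup_near_rescale //; apply: (r2P (e, y)).
  have := ler_wpM2l (ltW l0) rr2; rewrite /m; lra.
- move=> e f u w ss u01 w01.
  have tofar e' (u' : R) : 0 <= u' <= 1 ->
      ~~ sup_near (m - 2) (rescale l v (g e' u')) (rescale l v (py (t e'))) ->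
      far e' (g e' u').
    move=> u01' nn; split; first exact: garc.
    rewrite /= leNgt; apply: contra nn; rewrite prod_normE gt_max => /andP[/ltW h1 /ltW h2].
    apply: (sup_near_le (k := l * (r / 8))); first by rewrite /m; lra.
    by rewrite sup_near_rescale //; apply/andP.
  move=> /(tofar _ _ u01) fe /(tofar _ _ w01) ff; apply: (@near_lt _ (l * d)) => //.
  by rewrite sup_near_rescale //; apply: (dP (e, f)).
- move=> e; apply: (@near_lt _ (l * r3)); last by rewrite sup_near_rescale.
  have := ler_wpM2l (ltW l0) rr3; rewrite /m; lra.
Qed.

End Walks.

(** * Hall's condition for planar formulas *)

Section Hall.
Local Open Scope classical_set_scope.
Local Open Scope ring_scope.

(** The edge bound is applied to the subgraph between [S] and its neighbourhood. [N] may be smaller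
    than [clause_vars] because the algorithm reads only a part of each clause. *)
Theorem planar_hall (R : realType) (phi : cnf)
    (N : 'I_(nclauses phi) -> {set 'I_(nvars phi)}) :
  planar R (incidence phi) ->
  (forall j, N j \subset clause_vars j) -> (forall j, 4 <= #|N j|)%N ->
  forall S : {set 'I_(nclauses phi)},
    (#|S| <= #|(\bigcup_(j in S) N j)%SET|)%N.
Proof.
move=> [pos [arc [pos_inj arc_sym arcP arc_pos arc_cross]]] Nsub N4 S.
pose U := (\bigcup_(j in S) N j)%SET.
pose X : finType := {j : 'I_(nclauses phi) | j \in S}.
pose Y : finType := {v : 'I_(nvars phi) | v \in U}.
pose E : finType := {p : 'I_(nclauses phi) * 'I_(nvars phi) | (p.1 \in S) && (p.2 \in N p.1)}.
have sP (e : E) : (val e).1 \in S by case/andP: (valP e).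
have tP (e : E) : (val e).2 \in U.
  by case/andP: (valP e) => eS eN; apply/bigcupP; exists (val e).1.
pose s (e : E) : X := Sub (val e).1 (sP e).
pose t (e : E) : Y := Sub (val e).2 (tP e).
have inc (e : E) : incidence phi (inr (val e).1) (inl (val e).2).
  by case/andP: (valP e) => _; apply: (fintype.subsetP (Nsub _)).
have /fin_all_exists[g gP] (e : E) : exists g : R -> R * R,
    [/\ {within `[0, 1], continuous g}, g 0 = pos (inr (val e).1),
        g 1 = pos (inl (val e).2) & forall u : R, 0 <= u <= 1 ->
          arc (inr (val e).1) (inl (val e).2) (g u)].
  have [g [gc _ g0 g1 gA]] := arcP _ _ (inc e); exists g; split=> // u u01.
  by rewrite gA; exists u => //=; rewrite in_itv.
have cardE : (4 * #|S| <= #|E|)%N.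
  rewrite card_sig -[X in (_ <= X)%N]sum1_card.
  rewrite (eq_bigl (fun p => (p.1 \in S) && (p.2 \in N p.1))); last by move=> p; rewrite inE.
  rewrite -(pair_big_dep (fun j => j \in S) (fun j v => v \in N j) (fun _ _ => 1%N)) /=.
  rewrite mulnC -sum_nat_const; apply: leq_sum => j _; by rewrite sum1_card.
suff : (#|E| <= 2 * (#|X| + #|Y|))%N.
  rewrite [#|X|]card_sig [#|Y|]card_sig => h.
  have := leq_trans cardE h.
  rewrite (eq_card (B := mem S)) // (eq_card (A := [pred x | x \in U]) (B := mem U)) //.
  by rewrite -/U; lia.
apply: (@bipartite_drawing_bound R X Y E s t (fun x => pos (inr (val x)))
  (fun y => pos (inl (val y))) g).
- move=> e f [h1] [h2]; apply: val_inj; rewrite /= in h1 h2 *.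
  by rewrite [val e]surjective_pairing [val f]surjective_pairing h1 h2.
- by move=> y y' /pos_inj [] /val_inj.
- by move=> x y /pos_inj.
- by move=> e; case: (gP e).
- by move=> e; case: (gP e).
- by move=> e; case: (gP e).
- move=> e y u u01 gE; have [_ _ _ /(_ u u01)] := gP e; rewrite gE.
  by move=> /arc_pos => /(_ (inc e)) [//|[yE]]; apply: val_inj.
- move=> e f u v ss u01 v01 gE.
  have [_ _ _ /(_ u u01) ge] := gP e; have [_ _ _ /(_ v v01) gf] := gP f.
  have ef : [set inr (val e).1; inl (val e).2]%SET
      != [set inr (val f).1; inl (val f).2]%SET :> {set ivertex phi}.
    apply: contra ss => /eqP/setP/(_ (inr (val e).1)).
    by rewrite !inE eqxx /= orbF => /esym/eqP[h]; apply/eqP/val_inj.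
  (* A common point is the position of a vertex, hence of an end of both edges; the clause ends
     differ, so it is the variable end. *)
  have [|z _ zE] := arc_cross _ _ _ _ (inc e) (inc f) ef (g e u).
    by split=> //; rewrite gE.
  have := arc_pos _ _ z (inc e); have := arc_pos _ _ z (inc f).
  rewrite zE {1}gE => /(_ gf) hf /(_ ge) [] zz; rewrite zz // in hf zE *.
  case: hf => // -[h]; case/eqP: ss; exact: val_inj.
Qed.

End Hall.

(** * A while language compiled to the word RAM *)

Section While.

(** [EDbl] replaces multiplication, which the machine lacks; unlike a sum of two copies it evaluates
    its operand once. *)
Inductive exp :=
  | EVar of nat
  | ECst of nat
  | EAdd of exp & exp
  | ESub of exp & exp
  | EDbl of exp
  | EMem of exp.

Inductive cmd :=
  | CSkip
  | CAsg of nat & exp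
  | CSto of exp & exp
  | CSeq of cmd & cmd
  | CIf of exp & cmd & cmd
  | CWhile of exp & cmd.

Definition state : Type := ((nat -> nat) * (nat -> nat))%type.

Fixpoint ev (s : state) (e : exp) : nat :=
  match e with
  | EVar r => s.1 r
  | ECst k => k
  | EAdd a b => ev s a + ev s b
  | ESub a b => ev s a - ev s b
  | EDbl a => ev s a + ev s a
  | EMem a => s.2 (ev s a)
  end.

Variable W : nat.

(** Truncated differences and values read from registers or memory stay below [W] as long as all
    stored words do, so only constants, sums and doublings are tested. *)
Fixpoint safe (s : state) (e : exp) : bool :=
  match e with
  | EVar r => true
  | ECst k => k < W
  | EAdd a b => [&& safe s a, safe s b & ev s a + ev s b < W]
  | ESub a b => safe s a && safe s b
  | EDbl a => safe s a && (ev s a + ev s a < W)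
  | EMem a => safe s a
  end.

(* One tick per assignment, store or test. *)
Inductive run : cmd -> state -> nat -> state -> Prop :=
  | RSkip s : run CSkip s 0 s
  | RAsg r e s : safe s e -> run (CAsg r e) s 1 (upd s.1 r (ev s e), s.2)
  | RSto a b s : safe s a -> safe s b ->
      run (CSto a b) s 1 (s.1, upd s.2 (ev s a) (ev s b))
  | RSeq c1 c2 s1 s2 s3 t1 t2 : run c1 s1 t1 s2 -> run c2 s2 t2 s3 ->
      run (CSeq c1 c2) s1 (t1 + t2) s3
  | RIfT e c1 c2 s s' t : safe s e -> ev s e != 0 -> run c1 s t s' ->
      run (CIf e c1 c2) s t.+1 s'
  | RIfF e c1 c2 s s' t : safe s e -> ev s e = 0 -> run c2 s t s' ->
      run (CIf e c1 c2) s t.+1 s'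
  | RWhileF e c s : safe s e -> ev s e = 0 -> run (CWhile e c) s 1 s
  | RWhileT e c s s1 s2 t1 t2 : safe s e -> ev s e != 0 -> run c s t1 s1 ->
      run (CWhile e c) s1 t2 s2 -> run (CWhile e c) s (t1 + t2).+1 s2.

Definition ok (c : cmd) (s : state) (Q : nat -> state -> Prop) : Prop :=
  exists t s', run c s t s' /\ Q t s'.

Lemma ok_conseq c s (Q Q' : nat -> state -> Prop) :
  ok c s Q -> (forall t s', Q t s' -> Q' t s') -> ok c s Q'.
Proof. by move=> [t [s' [r q]]] QQ; exists t, s'; split=> //; apply: QQ. Qed.

Lemma ok_skip s (Q : nat -> state -> Prop) : Q 0 s -> ok CSkip s Q.
Proof. by move=> q; exists 0, s; split=> //; constructor. Qed.

Lemma ok_asg r e s (Q : nat -> state -> Prop) :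
  safe s e -> Q 1 (upd s.1 r (ev s e), s.2) -> ok (CAsg r e) s Q.
Proof. by move=> se q; exists 1, (upd s.1 r (ev s e), s.2); split=> //; constructor. Qed.

Lemma ok_sto a b s (Q : nat -> state -> Prop) :
  safe s a -> safe s b -> Q 1 (s.1, upd s.2 (ev s a) (ev s b)) -> ok (CSto a b) s Q.
Proof.
by move=> sa sb q; exists 1, (s.1, upd s.2 (ev s a) (ev s b)); split=> //; constructor.
Qed.

Lemma ok_seq c1 c2 s (Q : nat -> state -> Prop) :
  ok c1 s (fun t1 s1 => ok c2 s1 (fun t2 s2 => Q (t1 + t2) s2)) ->
  ok (CSeq c1 c2) s Q.
Proof.
move=> [t1 [s1 [r1 [t2 [s2 [r2 q]]]]]]; exists (t1 + t2), s2; split=> //.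
exact: RSeq r1 r2.
Qed.

Lemma ok_if e c1 c2 s (Q : nat -> state -> Prop) : safe s e ->
  (ev s e != 0 -> ok c1 s (fun t => Q t.+1)) ->
  (ev s e = 0 -> ok c2 s (fun t => Q t.+1)) ->
  ok (CIf e c1 c2) s Q.
Proof.
move=> se h1 h2; have [e0|e0] := eqVneq (ev s e) 0.
  have [t [s' [r q]]] := h2 e0; exists t.+1, s'; split=> //; exact: RIfF.
have [t [s' [r q]]] := h1 e0; exists t.+1, s'; split=> //; exact: RIfT.
Qed.

(* The index of [I] is a time budget; what is left of it is passed on to [Q]. *)
Lemma ok_while e c (I Q : nat -> state -> Prop) n s :
  (forall k s, I k s -> [/\ safe s e, ev s e = 0 -> 0 < k /\ Q k.-1 s &
     ev s e != 0 -> ok c s (fun t s' => exists k', t + k' < k /\ I k' s')]) ->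
  I n s -> ok (CWhile e c) s (fun t s' => exists k, t + k <= n /\ Q k s').
Proof.
move=> IH; move: {2}n (leqnn n) => b; elim: b n s => [|b IHb] n s nb In.
  have [se h0 h1] := IH _ _ In; have [e0|e0] := eqVneq (ev s e) 0.
    by have [] := h0 e0; lia.
  by have [t [s' [_ [k' []]]]] := h1 e0; lia.
have [se h0 h1] := IH _ _ In; have [e0|e0] := eqVneq (ev s e) 0.
  have [n0 q] := h0 e0; exists 1, s; split; first exact: RWhileF.
  by exists n.-1; split=> //; lia.
have [t [s' [r [k' [tk Ik]]]]] := h1 e0.
have kb : k' <= b by lia.
have [t' [s2 [r2 [k2 [t'k q]]]]] := IHb k' s' kb Ik.
exists (t + t').+1, s2; split; first exact: RWhileT r r2.
by exists k2; split=> //; lia.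
Qed.

End While.

(** * Compilation at a bounded number of machine steps per tick *)

Section Compile.
(* Registers below [nv] hold the program variables, the others are scratch. *)
Variable nv : nat.

(** The registers from [d] upwards serve as evaluation stack, with the result left in [d]. A
    register is copied by adding zero. *)
Fixpoint compile_exp (d : nat) (e : exp) : seq instr :=
  match e with
  | EVar r => [:: IConst d 0; IAdd d r d]
  | ECst k => [:: IConst d k]
  | EAdd a b => compile_exp d a ++ compile_exp d.+1 b ++ [:: IAdd d d d.+1]
  | ESub a b => compile_exp d a ++ compile_exp d.+1 b ++ [:: ISub d d d.+1]
  | EDbl a => compile_exp d a ++ [:: IAdd d d d]
  | EMem a => compile_exp d a ++ [:: ILoad d d]
  end.

(** Jump targets are absolute, hence the start address [p]. An unconditional jump tests a register
    that has just been cleared. *)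
Fixpoint compile (p : nat) (c : cmd) : seq instr :=
  match c with
  | CSkip => [::]
  | CAsg r e => compile_exp nv e ++ [:: IConst nv.+1 0; IAdd r nv nv.+1]
  | CSto a b => compile_exp nv a ++ compile_exp nv.+1 b ++ [:: IStore nv nv.+1]
  | CSeq c1 c2 => let k1 := compile p c1 in k1 ++ compile (p + size k1) c2
  | CIf e c1 c2 =>
      let ke := compile_exp nv e in
      let k1 := compile (p + size ke).+1 c1 in
      let p2 := (p + size ke + size k1).+3 in
      let k2 := compile p2 c2 in
      ke ++ IJz nv p2 :: k1 ++ [:: IConst nv 0, IJz nv (p2 + size k2) & k2]
  | CWhile e c =>
      let ke := compile_exp nv e in
      let k := compile (p + size ke).+1 c in
      ke ++ IJz nv (p + size ke + size k).+3 :: k ++ [:: IConst nv 0; IJz nv p]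
  end.

Fixpoint evars (e : exp) : bool :=
  match e with
  | EVar r => r < nv
  | ECst k => true
  | EAdd a b | ESub a b => evars a && evars b
  | EDbl a | EMem a => evars a
  end.

(** [K] bounds the machine steps per tick: the code of the expressions involved and at most three
    further instructions, for a test and the jump after a branch. *)
Fixpoint wf (K : nat) (c : cmd) : bool :=
  match c with
  | CSkip => true
  | CAsg r e => [&& r < nv, evars e & (size (compile_exp nv e)).+2 <= K]
  | CSto a b => [&& evars a, evars b &
      (size (compile_exp nv a) + size (compile_exp nv.+1 b)).+1 <= K]
  | CSeq c1 c2 => wf K c1 && wf K c2
  | CIf e c1 c2 => [&& evars e, (size (compile_exp nv e)).+3 <= K, wf K c1 & wf K c2]
  | CWhile e c => [&& evars e, (size (compile_exp nv e)).+3 <= K & wf K c]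
  end.

Variables (w : nat) (p : program).

Definition steps n s s' := iter n (obind (ram_step w p)) (Some s) = Some s'.

Lemma steps_trans n1 n2 s1 s2 s3 :
  steps n1 s1 s2 -> steps n2 s2 s3 -> steps (n1 + n2) s1 s3.
Proof. by move=> h1 h2; rewrite /steps addnC iterD h1. Qed.

Lemma steps1 s s' : ram_step w p s = Some s' -> steps 1 s s'.
Proof. by []. Qed.

Definition seg a (k : seq instr) := forall i, i < size k -> onth p (a + i) = onth k i.

Lemma onth_cat (T : Type) (s1 s2 : seq T) i :
  onth (s1 ++ s2) i = if i < size s1 then onth s1 i else onth s2 (i - size s1).
Proof. by elim: s1 i => [|x s1 IH] [|i] //=; rewrite ?IH. Qed.

Lemma seg_cat a k1 k2 : seg a (k1 ++ k2) -> seg a k1 /\ seg (a + size k1) k2.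
Proof.
move=> h; split=> i hi.
  by rewrite h ?size_cat ?onth_cat ?hi //; lia.
rewrite -addnA h ?size_cat; last by lia.
by rewrite onth_cat ltnNge leq_addr /= addKn.
Qed.

Lemma seg_cons a x k : seg a (x :: k) -> onth p a = Some x /\ seg a.+1 k.
Proof.
rewrite -cat1s => /seg_cat[h1 h2]; split.
  by have := h1 0 isT; rewrite addn0.
by rewrite addn1 in h2.
Qed.

Let W := 2 ^ w.

Definition bounded (f : nat -> nat) := forall i, f i < W.

Lemma bounded_upd f i x : bounded f -> x < W -> bounded (upd f i x).
Proof. by move=> fb xW j; rewrite /upd; case: ifP. Qed.

Lemma step_set a rg m i x ins : onth p a = Some ins -> x < W ->
  (match ins with
   | IConst i' k => (i' = i) /\ k = x
   | IAdd i' j k => (i' = i) /\ rg j + rg k = x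
   | ISub i' j k => (i' = i) /\ rg j - rg k = x
   | ILoad i' j => (i' = i) /\ m (rg j) = x
   | _ => False end) ->
  ram_step w p (Config a rg m) = Some (Config a.+1 (upd rg i x) m).
Proof.
by rewrite /ram_step /= => -> xW; case: ins => //= [? ?|? ? ?|? ? ?|? ?] [-> ->];
  rewrite /set_reg xW.
Qed.

Lemma eval_ext m rg1 rg2 e : evars e -> (forall i, i < nv -> rg2 i = rg1 i) ->
  (safe W (rg2, m) e = safe W (rg1, m) e) * (ev (rg2, m) e = ev (rg1, m) e).
Proof.
move=> + h; elim: e => //=.
- by move=> r rn; rewrite h.
- by move=> x IHx y IHy /andP[xv yv]; rewrite !(IHx xv) !(IHy yv).
- by move=> x IHx y IHy /andP[xv yv]; rewrite !(IHx xv) !(IHy yv).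
- by move=> x IHx xv; rewrite !(IHx xv).
- by move=> x IHx xv; rewrite !(IHx xv).
Qed.

Lemma compile_exp_ok e d a rg m : nv <= d -> evars e -> seg a (compile_exp d e) ->
  bounded rg -> bounded m -> safe W (rg, m) e ->
  exists rg', [/\ steps (size (compile_exp d e)) (Config a rg m)
       (Config (a + size (compile_exp d e)) rg' m),
     rg' d = ev (rg, m) e, bounded rg' & forall i, i < d -> rg' i = rg i].
Proof.
have W0 : 0 < W by rewrite expn_gt0.
have bin e1 e2 (op : nat -> nat -> nat) (ins : nat -> nat -> nat -> instr) :
    (forall e d a rg, e = e1 \/ e = e2 -> nv <= d -> evars e -> seg a (compile_exp d e) ->
      bounded rg -> bounded m -> safe W (rg, m) e ->
      exists rg', [/\ steps (size (compile_exp d e)) (Config a rg m)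
        (Config (a + size (compile_exp d e)) rg' m),
       rg' d = ev (rg, m) e, bounded rg' & forall i, i < d -> rg' i = rg i]) ->
    forall d a rg, nv <= d -> evars e1 && evars e2 ->
    seg a (compile_exp d e1 ++ compile_exp d.+1 e2 ++ [:: ins d d d.+1]) ->
    bounded rg -> bounded m -> safe W (rg, m) e1 -> safe W (rg, m) e2 ->
    (forall a' rg', onth p a' = Some (ins d d d.+1) -> rg' d = ev (rg, m) e1 ->
       rg' d.+1 = ev (rg, m) e2 -> bounded rg' ->
       ram_step w p (Config a' rg' m) = Some (Config a'.+1
         (upd rg' d (op (ev (rg, m) e1) (ev (rg, m) e2))) m)) ->
    op (ev (rg, m) e1) (ev (rg, m) e2) < W ->
    exists rg', [/\ steps (size (compile_exp d e1 ++ compile_exp d.+1 e2 ++ [:: ins d d d.+1]))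
      (Config a rg m)
      (Config (a + size (compile_exp d e1 ++ compile_exp d.+1 e2 ++ [:: ins d d d.+1])) rg' m),
       rg' d = op (ev (rg, m) e1) (ev (rg, m) e2), bounded rg' &
       forall i, i < d -> rg' i = rg i].
  move=> IH {}d {}a {}rg nd /andP[v1 v2] /seg_cat[g1 /seg_cat[g2 /seg_cons[g3 _]]] rb mb s1 s2 st oW.
  have [rg1 [st1 E1 b1 f1]] := IH e1 d a rg (or_introl erefl) nd v1 g1 rb mb s1.
  have f1' i : i < nv -> rg1 i = rg i by move=> h; apply: f1; lia.
  have s2' : safe W (rg1, m) e2 by rewrite (@eval_ext m rg rg1).
  have nd' : nv <= d.+1 by lia.
  have [rg2 [st2 E2 b2 f2]] := IH e2 d.+1 _ rg1 (or_intror erefl) nd' v2 g2 b1 mb s2'.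
  have E2' : rg2 d.+1 = ev (rg, m) e2 by rewrite E2 (@eval_ext m rg rg1).
  have E1' : rg2 d = ev (rg, m) e1 by rewrite f2 // E1.
  exists (upd rg2 d (op (ev (rg, m) e1) (ev (rg, m) e2))); split.
  - rewrite !size_cat !addnA; apply: steps_trans (steps_trans st1 st2) _.
    by rewrite /= addn1; apply: steps1; apply: st.
  - by rewrite /upd eqxx.
  - exact: bounded_upd.
  - by move=> i id; rewrite /upd ltn_eqF // f2 ?f1 //; lia.
elim: e d a rg => [r|k|e1 IH1 e2 IH2|e1 IH1 e2 IH2|e IH|e IH] d a rg nd /=.
- move=> rn /seg_cons[g1 /seg_cons[g2 _]] rb mb _.
  exists (upd (upd rg d 0) d (rg r)); split.
  + have <- : (a.+1).+1 = a + 2 by lia.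
    apply: (@steps_trans 1 1 _ (Config a.+1 (upd rg d 0) m)).
      by apply: steps1; apply: step_set g1 _ _.
    apply: steps1; apply: step_set g2 _ _; first exact: rb.
    by rewrite /upd eqxx ltn_eqF ?addn0 //; lia.
  + by rewrite /upd eqxx.
  + by apply: bounded_upd; [apply: bounded_upd|apply: rb].
  + by move=> i id; rewrite /upd ltn_eqF.
- move=> _ /seg_cons[g1 _] rb mb kW; exists (upd rg d k); split.
  + by rewrite addn1; apply: steps1; apply: step_set g1 _ _.
  + by rewrite /upd eqxx.
  + exact: bounded_upd.
  + by move=> i id; rewrite /upd ltn_eqF.
- move=> vs g rb mb /and3P[s1 s2 sW].
  apply: (bin e1 e2 addn IAdd) => //.
    by move=> e d' a' rg' [->|->]; [apply: IH1|apply: IH2].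
  by move=> a' rg' o h1 h2 b'; apply: step_set o _ _ => //; rewrite h1 h2.
- move=> vs g rb mb /andP[s1 s2].
  have sub_lt rg' : bounded rg' -> rg' d = ev (rg, m) e1 -> ev (rg, m) e1 - ev (rg, m) e2 < W.
    by move=> b' <-; apply: leq_ltn_trans (leq_subr _ _) (b' d).
  have [rg1 [_ E1 b1 _]] := IH1 d a rg nd (proj1 (andP vs)) (proj1 (seg_cat g)) rb mb s1.
  apply: (bin e1 e2 subn ISub) => //.
  + by move=> e d' a' rg' [->|->]; [apply: IH1|apply: IH2].
  + move=> a' rg' o h1 h2 b'; apply: step_set o _ _; last by rewrite h1 h2.
    exact: sub_lt h1.
  + exact: sub_lt E1.
- move=> vs /seg_cat[g1 /seg_cons[g2 _]] rb mb /andP[s1 sW].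
  have [rg1 [st1 E1 b1 f1]] := IH d a rg nd vs g1 rb mb s1.
  exists (upd rg1 d (ev (rg, m) e + ev (rg, m) e)); split.
  + rewrite size_cat addnA addn1; rewrite -addn1; apply: steps_trans st1 _.
    by apply: steps1; rewrite addn1; apply: step_set g2 _ _ => //; rewrite E1.
  + by rewrite /upd eqxx.
  + exact: bounded_upd.
  + by move=> i id; rewrite /upd ltn_eqF // f1.
- move=> vs /seg_cat[g1 /seg_cons[g2 _]] rb mb s1.
  have [rg1 [st1 E1 b1 f1]] := IH d a rg nd vs g1 rb mb s1.
  exists (upd rg1 d (m (ev (rg, m) e))); split.
  + rewrite size_cat addnA addn1; rewrite -addn1; apply: steps_trans st1 _.
    by apply: steps1; rewrite addn1; apply: step_set g2 _ _ => //; rewrite ?E1.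
  + by rewrite /upd eqxx.
  + exact: bounded_upd.
  + by move=> i id; rewrite /upd ltn_eqF // f1.
Qed.

Lemma compile_ok K c s t s' : run W c s t s' -> forall a rg, wf K c ->
  seg a (compile a c) -> bounded rg -> bounded s.2 ->
  (forall i, i < nv -> rg i = s.1 i) ->
  exists n rg', [/\ n <= K * t,
    steps n (Config a rg s.2) (Config (a + size (compile a c)) rg' s'.2),
    bounded rg', bounded s'.2 & forall i, i < nv -> rg' i = s'.1 i].
Proof.
have W0 : 0 < W by rewrite expn_gt0.
have evalP e a rg (s0 : state) : evars e -> seg a (compile_exp nv e) -> bounded rg ->
    bounded s0.2 -> (forall i, i < nv -> rg i = s0.1 i) -> safe W s0 e ->
    exists rg', [/\ steps (size (compile_exp nv e)) (Config a rg s0.2)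
       (Config (a + size (compile_exp nv e)) rg' s0.2),
     rg' nv = ev s0 e, bounded rg' & forall i, i < nv -> rg' i = s0.1 i].
  case: s0 => rs m /= ve g rb mb rE se.
  rewrite -(@eval_ext m rs rg) // in se.
  have [rg' [st E b f]] := compile_exp_ok (leqnn nv) ve g rb mb se.
  exists rg'; split=> //; first by rewrite E (@eval_ext m rs rg).
  by move=> i inv; rewrite f ?rE.
have jz a r l rg m : onth p a = Some (IJz r l) ->
    steps 1 (Config a rg m) (Config (if rg r == 0 then l else a.+1) rg m).
  by move=> o; apply: steps1; rewrite /ram_step o.
have goto a l rg m : onth p a = Some (IConst nv 0) -> onth p a.+1 = Some (IJz nv l) ->
    steps 2 (Config a rg m) (Config l (upd rg nv 0) m).
  move=> o1 o2; apply: (@steps_trans 1 1 _ (Config a.+1 (upd rg nv 0) m)).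
    by apply: steps1; apply: step_set o1 _ _.
  have := jz _ _ _ (upd rg nv 0) m o2.
  by have -> : upd rg nv 0 nv = 0 by rewrite /upd eqxx.
elim=> {c s t s'} /=.
- move=> s a rg _ _ rb mb rE; exists 0, rg; split=> //.
  by rewrite addn0.
- move=> r e s se a rg /and3P[rn ve eK] /seg_cat[g1 /seg_cons[g2 /seg_cons[g3 _]]] rb mb rE.
  have [rg1 [st1 E1 b1 f1]] := evalP _ _ _ _ ve g1 rb mb rE se.
  exists (size (compile_exp nv e) + (1 + 1)), (upd (upd rg1 nv.+1 0) r (ev s e)); split.
  + by rewrite muln1 addn2.
  + rewrite size_cat /= (addnA a); apply: steps_trans st1 _.
    apply: (@steps_trans 1 1 _ (Config (a + size (compile_exp nv e)).+1 (upd rg1 nv.+1 0) s.2)).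
      by apply: steps1; apply: step_set g2 _ _.
    rewrite addn2; apply: steps1; apply: step_set g3 _ _; first by rewrite -E1.
    by rewrite /upd eqxx (ltn_eqF (ltnSn nv)) addn0.
  + apply: bounded_upd; last by rewrite -E1.
    exact: bounded_upd.
  + by [].
  + move=> i inv; rewrite /upd; case: eqP => // _.
    by rewrite ltn_eqF ?f1 //; lia.
- move=> x y s sx sy a rg /and3P[vx vy xyK] /seg_cat[g1 /seg_cat[g2 /seg_cons[g3 _]]] rb mb rE.
  have [rg1 [st1 E1 b1 f1]] := evalP _ _ _ _ vx g1 rb mb rE sx.
  have sy' : safe W (rg1, s.2) y.
    by rewrite (@eval_ext s.2 s.1 rg1) // -surjective_pairing.
  have [rg2 [st2 E2 b2 f2]] := compile_exp_ok (leqnSn nv) vy g2 b1 mb sy'.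
  have E2' : rg2 nv.+1 = ev s y.
    by rewrite E2 (@eval_ext s.2 s.1 rg1) // -surjective_pairing.
  have E1' : rg2 nv = ev s x by rewrite f2 // E1.
  exists (size (compile_exp nv x) + size (compile_exp nv.+1 y) + 1), rg2; split.
  + by rewrite muln1 addn1.
  + rewrite !size_cat /= !addnA addn1; rewrite -addn1.
    apply: steps_trans (steps_trans st1 st2) _.
    by apply: steps1; rewrite /ram_step /= g3 /= E1' E2' addn1.
  + by [].
  + by apply: bounded_upd => //; rewrite -E2'.
  + by move=> i inv; rewrite f2 ?f1 //; lia.
- move=> c1 c2 s1 s2 s3 t1 t2 _ IH1 _ IH2 a rg /andP[w1 w2] /seg_cat[g1 g2] rb mb rE.
  have [n1 [rg1 [k1 st1 b1 m1 f1]]] := IH1 a rg w1 g1 rb mb rE.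
  have [n2 [rg2 [k2 st2 b2 m2 f2]]] := IH2 _ rg1 w2 g2 b1 m1 f1.
  exists (n1 + n2), rg2; split=> //; first by rewrite mulnDr leq_add.
  by rewrite size_cat addnA; apply: steps_trans st1 st2.
- move=> e c1 c2 s s' t se e0 _ IH a rg /and4P[ve eK w1 _].
  move=> /seg_cat[g1 /seg_cons[g2 /seg_cat[g3 /seg_cons[g4 /seg_cons[g5 _]]]]] rb mb rE.
  have [rg1 [st1 E1 b1 f1]] := evalP _ _ _ _ ve g1 rb mb rE se.
  have [n1 [rg2 [k1 st2 b2 m2 f2]]] := IH _ rg1 w1 g3 b1 mb f1.
  exists (size (compile_exp nv e) + 1 + n1 + 2), (upd rg2 nv 0); split.
  + by rewrite mulnS; lia.
  + apply: (steps_trans (s2 := Config ((a + size (compile_exp nv e)).+1 + size (compile (a + size (compile_exp nv e)).+1 c1)) rg2 s'.2)).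
      apply: steps_trans st2; apply: steps_trans st1 _.
      by have := jz _ _ _ rg1 s.2 g2; rewrite E1 (negPf e0).
    have := goto _ _ rg2 s'.2 g4 g5; congr (steps _ _ (Config _ _ _)).
    by rewrite !size_cat /= !size_cat /=; lia.
  + by apply: bounded_upd.
  + by [].
  + by move=> i inv; rewrite /upd ltn_eqF ?f2.
- move=> e c1 c2 s s' t se e0 _ IH a rg /and4P[ve eK _ w2].
  move=> /seg_cat[g1 /seg_cons[g2 /seg_cat[_ /seg_cons[_ /seg_cons[_ g3]]]]] rb mb rE.
  have [rg1 [st1 E1 b1 f1]] := evalP _ _ _ _ ve g1 rb mb rE se.
  have pE : ((a + size (compile_exp nv e)).+1 + size (compile (a + size (compile_exp nv e)).+1 c1)).+2
     = (a + size (compile_exp nv e) + size (compile (a + size (compile_exp nv e)).+1 c1)).+3 by lia.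
  rewrite pE in g3.
  have [n1 [rg2 [k1 st2 b2 m2 f2]]] := IH _ rg1 w2 g3 b1 mb f1.
  exists (size (compile_exp nv e) + 1 + n1), rg2; split=> //.
  + by rewrite mulnS; lia.
  + apply: (steps_trans (s2 := Config (a + size (compile_exp nv e) + size (compile (a + size (compile_exp nv e)).+1 c1)).+3 rg1 s.2)).
      apply: steps_trans st1 _.
      by have := jz _ _ _ rg1 s.2 g2; rewrite E1 e0 eqxx.
    move: st2; congr (steps _ _ (Config _ _ _)).
    by rewrite !size_cat /= !size_cat /=; lia.
- move=> e c s se e0 a rg /and3P[ve eK wc] /seg_cat[g1 /seg_cons[g2 _]] rb mb rE.
  have [rg1 [st1 E1 b1 f1]] := evalP _ _ _ _ ve g1 rb mb rE se.
  exists (size (compile_exp nv e) + 1), rg1; split=> //; first by rewrite muln1; lia.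
  apply: steps_trans st1 _; have := jz _ _ _ rg1 s.2 g2; rewrite E1 e0 eqxx.
  by congr (steps _ _ (Config _ _ _)); rewrite !size_cat /= !size_cat /=; lia.
- move=> e c s s1 s2 t1 t2 se e0 _ IH1 _ IH2 a rg wc g rb mb rE.
  have /and3P[ve eK wc'] := wc.
  have /seg_cat[g1 /seg_cons[g2 /seg_cat[g3 /seg_cons[g4 /seg_cons[g5 _]]]]] := g.
  have [rg1 [st1 E1 b1 f1]] := evalP _ _ _ _ ve g1 rb mb rE se.
  have [n1 [rg2 [k1 st2 b2 m2 f2]]] := IH1 _ rg1 wc' g3 b1 mb f1.
  have b3 : bounded (upd rg2 nv 0) by apply: bounded_upd.
  have f3 i : i < nv -> upd rg2 nv 0 i = s1.1 i.
    by move=> inv; rewrite /upd ltn_eqF ?f2.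
  have [n2 [rg3 [k2 st3 b4 m4 f4]]] := IH2 a _ wc g b3 m2 f3.
  exists (size (compile_exp nv e) + 1 + n1 + 2 + n2), rg3; split=> //.
    by rewrite mulnS mulnDr; lia.
  apply: steps_trans st3.
  apply: (steps_trans (s2 := Config ((a + size (compile_exp nv e)).+1 + size (compile (a + size (compile_exp nv e)).+1 c)) rg2 s1.2)).
    apply: steps_trans st2; apply: steps_trans st1 _.
    by have := jz _ _ _ rg1 s.2 g2; rewrite E1 (negPf e0).
  exact: goto.
Qed.

End Compile.

Lemma ok_halts nv K w (c : cmd) (input : seq nat) (Q : nat -> state -> Prop) :
  wf nv K c -> (forall i, nth 0 input i < 2 ^ w) ->
  ok (2 ^ w) c (fun=> 0, nth 0 input) Q ->
  exists t s, [/\ Q t s & exists n f,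
    halts_in w (rcons (compile nv 0 c) IHalt) input n f /\ n <= K * t /\ memory f = s.2].
Proof.
move=> wc ib [t [s [r q]]]; exists t, s; split=> //.
set p := rcons _ _.
have g : seg p 0 (compile nv 0 c).
  by move=> i ik; rewrite /p add0n -cats1 onth_cat ik.
have [n [rg [nK st _ _ _]]] := compile_ok r wc g (fun i => expn_gt0 2 w) ib (fun _ _ => erefl).
exists n, (Config (0 + size (compile nv 0 c)) rg s.2); split=> //; split=> //.
by rewrite /halted /p -cats1 /= onth_cat add0n ltnn subnn.
Qed.

(** * The matching algorithm *)

(** [xV] and [xC] count variables and clauses, [xB] is the base of the arrays, [xL] the label limit.
    [xp], [xk], [xu] serve [scan]; [xb] is the least label found, [xd] the stack depth, [xo] an
    output sign; [xc] and [xv] are mostly counters, [xt] is scratch. [xh] (clause at hand), [xs]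
    (root of the search) and [xf] (variable found) hold successors, leaving 0 for none. *)
Local Notation xV := 0 (only parsing).
Local Notation xC := 1 (only parsing).
Local Notation xB := 2 (only parsing).
Local Notation xL := 3 (only parsing).
Local Notation xc := 4 (only parsing).
Local Notation xh := 5 (only parsing).
Local Notation xp := 6 (only parsing).
Local Notation xk := 7 (only parsing).
Local Notation xu := 8 (only parsing).
Local Notation xv := 9 (only parsing).
Local Notation xb := 10 (only parsing).
Local Notation xt := 11 (only parsing).
Local Notation xd := 12 (only parsing).
Local Notation xf := 13 (only parsing).
Local Notation xo := 14 (only parsing).
Local Notation xs := 15 (only parsing).

Declare Scope cmd_scope.
Delimit Scope cmd_scope with cmd.
Local Notation "c1 ;; c2" := (CSeq c1 c2) (at level 80, right associativity) : cmd_scope.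

(* The arrays are interleaved above the address held in register [xB]:
   entry [i] of array [k < 8] is stored at [xB + 8 * i + k]. *)
Definition arr_addr (k : nat) (e : exp) : exp :=
  EAdd (EVar xB) (EAdd (EDbl (EDbl (EDbl e))) (ECst k)).
Definition arr_get k e := EMem (arr_addr k e).
Definition arr_set k e f := CSto (arr_addr k e) f.
Definition arr (B : nat) (m : nat -> nat) (k i : nat) := m (B + (8 * i + k)).

(** Fresh memory reads 0, so owners, homes and stack entries are stored as successors. A mark is the
    successor of the clause whose search set it, so marks need no clearing between searches. *)
Local Notation aStart := 0 (only parsing).
Local Notation aLab := 1 (only parsing).
Local Notation aOwn := 2 (only parsing).
Local Notation aHome := 3 (only parsing).
Local Notation aMark := 4 (only parsing).
Local Notation aStk := 5 (only parsing).
Local Notation aOut := 6 (only parsing).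

Definition pred_exp (r : nat) : exp := ESub (EVar r) (ECst 1).
Definition succ_exp (r : nat) : exp := EAdd (EVar r) (ECst 1).

(* Clauses are truncated to seven literals: these still involve four variables.
   [scan] runs [body] with the variable of each of the first seven literals of the
   clause [xh - 1] in register [xu], and the address of the literal in [xp]. *)
Definition scan (body : cmd) : cmd :=
  (CAsg xp (arr_get aStart (pred_exp xh)) ;;
   CAsg xk (EMem (EVar xp)) ;;
   (* With truncated subtraction this is the minimum with 7. *)
   CAsg xk (ESub (EVar xk) (ESub (EVar xk) (ECst 7))) ;;
   CAsg xp (succ_exp xp) ;;
   CWhile (EVar xk)
     (CAsg xu (EMem (EVar xp)) ;;
      body ;;
      CAsg xp (EAdd (EVar xp) (ECst 2)) ;;
      CAsg xk (pred_exp xk)))%cmd.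

Definition minlab_body : cmd :=
  (CAsg xt (arr_get aLab (EVar xu)) ;;
   CIf (ESub (EVar xb) (EVar xt)) (CAsg xb (EVar xt) ;; CAsg xv (EVar xu)) CSkip)%cmd.

(** The minimum starts at [xL], so it stays there exactly when no variable is below the limit; the
    clause then gives up. Otherwise [xh] becomes the evicted clause, or 0 if the variable was
    free. *)
Definition bid : cmd :=
  (CAsg xb (EVar xL) ;; scan minlab_body ;;
   CIf (ESub (EVar xL) (EVar xb))
     (arr_set aLab (EVar xv) (succ_exp xb) ;;
      CAsg xt (arr_get aOwn (EVar xv)) ;;
      arr_set aOwn (EVar xv) (EVar xh) ;;
      CAsg xh (EVar xt))
     (CAsg xh (ECst 0)))%cmd.

Definition auction_loop : cmd :=
  (CAsg xc (ECst 0) ;;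
   CWhile (ESub (EVar xC) (EVar xc))
     (CAsg xh (succ_exp xc) ;; CWhile (EVar xh) bid ;; CAsg xc (succ_exp xc)))%cmd.

Definition home_loop : cmd :=
  (CAsg xv (ECst 0) ;;
   CWhile (ESub (EVar xV) (EVar xv))
     (CAsg xt (arr_get aOwn (EVar xv)) ;;
      CIf (EVar xt) (arr_set aHome (pred_exp xt) (succ_exp xv)) CSkip ;;
      CAsg xv (succ_exp xv)))%cmd.

Definition unmarked_body : cmd :=
  (CAsg xt (arr_get aMark (EVar xu)) ;;
   CIf (ESub (EVar xs) (EVar xt)) (CAsg xf (succ_exp xu)) CSkip)%cmd.

(** Unwinds the stack from the top: each clause takes the variable in [xf] and hands its former one
    to the clause below, which had reached it through that very variable. *)
Definition augment : cmd :=
  CWhile (EVar xd)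
    (CAsg xd (pred_exp xd) ;;
     CAsg xh (arr_get aStk (EVar xd)) ;;
     arr_set aOwn (pred_exp xf) (EVar xh) ;;
     CAsg xt (arr_get aHome (pred_exp xh)) ;;
     arr_set aHome (pred_exp xh) (EVar xf) ;;
     CAsg xf (EVar xt))%cmd.

(** The top clause is rescanned from its first literal at each visit, which costs a constant.
    [augment] leaves the stack empty and thereby ends the search as well. *)
Definition dfs_step : cmd :=
  (CAsg xh (arr_get aStk (pred_exp xd)) ;;
   CAsg xf (ECst 0) ;;
   scan unmarked_body ;;
   CIf (EVar xf)
     (arr_set aMark (pred_exp xf) (EVar xs) ;;
      CAsg xt (arr_get aOwn (pred_exp xf)) ;;
      CIf (EVar xt)
        (arr_set aStk (EVar xd) (EVar xt) ;; CAsg xd (succ_exp xd))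
        augment)
     (CAsg xd (pred_exp xd)))%cmd.

Definition search : cmd :=
  (CAsg xs (succ_exp xc) ;;
   CAsg xd (ECst 0) ;;
   arr_set aStk (EVar xd) (EVar xs) ;;
   CAsg xd (ECst 1) ;;
   CWhile (EVar xd) dfs_step)%cmd.

Definition search_loop : cmd :=
  (CAsg xc (ECst 0) ;;
   CWhile (ESub (EVar xC) (EVar xc))
     (CAsg xt (arr_get aHome (EVar xc)) ;;
      CIf (EVar xt) CSkip search ;;
      CAsg xc (succ_exp xc)))%cmd.

Definition sign_body : cmd :=
  (* The two truncated differences are both 0 exactly when the variables agree. *)
  CIf (EAdd (ESub (EVar xu) (EVar xv)) (ESub (EVar xv) (EVar xu))) CSkip
    (CAsg xo (EMem (succ_exp xp))).

Definition out_loop : cmd :=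
  (CAsg xv (ECst 0) ;;
   CWhile (ESub (EVar xV) (EVar xv))
     (CAsg xh (arr_get aOwn (EVar xv)) ;;
      CAsg xo (ECst 0) ;;
      CIf (EVar xh) (scan sign_body) CSkip ;;
      arr_set aOut (EVar xv) (EVar xo) ;;
      CAsg xv (succ_exp xv)))%cmd.

(** Signs are collected in [aOut] first because the output cells, from address 0 on, can overlap the
    formula, which [out_loop] still reads. *)
Definition copy_loop : cmd :=
  (CAsg xv (ECst 0) ;;
   CWhile (ESub (EVar xV) (EVar xv))
     (CAsg xt (arr_get aOut (EVar xv)) ;;
      CSto (EVar xv) (EVar xt) ;;
      CAsg xv (succ_exp xv)))%cmd.

Definition skip_clause : cmd :=
  (CAsg xt (EMem (EVar xp)) ;;
   CAsg xp (EAdd (succ_exp xp) (EDbl (EVar xt))))%cmd.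

Definition length_loop : cmd :=
  (CAsg xp (ECst 2) ;;
   CAsg xc (EVar xC) ;;
   CWhile (EVar xc) (skip_clause ;; CAsg xc (pred_exp xc)))%cmd.

Definition start_loop : cmd :=
  (CAsg xp (ECst 2) ;;
   CAsg xc (ECst 0) ;;
   CWhile (ESub (EVar xC) (EVar xc))
     (arr_set aStart (EVar xc) (EVar xp) ;; skip_clause ;; CAsg xc (succ_exp xc)))%cmd.

(** [xt] is the square of [xL], advanced by [2 * xL + 1] for want of multiplication. *)
Definition sqrt_loop : cmd :=
  (CAsg xL (ECst 0) ;;
   CAsg xt (ECst 0) ;;
   CWhile (ESub (EVar xV) (EVar xt))
     (CAsg xt (EAdd (succ_exp xt) (EDbl (EVar xL))) ;; CAsg xL (succ_exp xL)))%cmd.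

Definition solver : cmd :=
  (CAsg xV (EMem (ECst 0)) ;;
   CAsg xC (EMem (ECst 1)) ;;
   length_loop ;;
   (* The arrays start above both the input and the output cells. *)
   CAsg xB (EAdd (EVar xp) (EVar xV)) ;;
   start_loop ;; sqrt_loop ;; auction_loop ;; home_loop ;; search_loop ;;
   out_loop ;; copy_loop)%cmd.

Lemma ev_arr_addr s k e : ev s (arr_addr k e) = s.1 xB + (8 * ev s e + k).
Proof. by rewrite /=; lia. Qed.

Lemma safe_arr_addr W s k e : safe W s e -> s.1 xB + (8 * ev s e + k) < W ->
  safe W s (arr_addr k e).
Proof. by move=> se h; rewrite /= se /=; lia. Qed.

Lemma arr_upd B m k i x k' i' : k < 8 -> k' < 8 ->
  arr B (upd m (B + (8 * i + k)) x) k' i'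
  = if (k' == k) && (i' == i) then x else arr B m k' i'.
Proof.
move=> k8 k8'; rewrite /arr /upd.
by have -> : (B + (8 * i' + k') == B + (8 * i + k)) = ((k' == k) && (i' == i)) by lia.
Qed.

Lemma arr_upd_same B m k i x : k < 8 ->
  arr B (upd m (B + (8 * i + k)) x) k = upd (arr B m k) i x.
Proof. by move=> k8; apply: funext => j; rewrite arr_upd // eqxx. Qed.

Lemma arr_upd_other B m k i x k' : k < 8 -> k' < 8 -> k' != k ->
  arr B (upd m (B + (8 * i + k)) x) k' = arr B m k'.
Proof. by move=> k8 k8' ne; apply: funext => j; rewrite arr_upd // (negPf ne). Qed.

Lemma low_upd B m k i x a : a < B -> upd m (B + (8 * i + k)) x a = m a.
Proof. by move=> aB; rewrite /upd ltn_eqF //; lia. Qed.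

Ltac regs := repeat match goal with |- context [upd ?f ?i ?x ?j] =>
  let b := eval vm_compute in (Nat.eqb i j) in
  match b with
  | true => change (upd f i x j) with x
  | false => change (upd f i x j) with (f j)
  end end.

Ltac arrs := repeat match goal with
  |- context [arr ?b (upd ?m (?b + (8 * ?i + ?k)) ?x) ?k'] =>
  let e := eval vm_compute in (Nat.eqb k k') in
  match e with
  | true => rewrite (@arr_upd_same b m k i x isT)
  | false => rewrite (@arr_upd_other b m k i x k' isT isT isT)
  end end.

Section Correctness.

(** The formula is seen only through its memory layout: [off c] is the address of clause [c] and
    [ls c] lists its first seven literals. *)
Variables (W V C : nat) (off : nat -> nat) (ls : nat -> seq (nat * nat)) (m0 : nat -> nat).
Let B := off C + V.
Hypothesis ls_size : forall c, c < C -> minn (m0 (off c)) 7 = size (ls c).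
Hypothesis ls_mem : forall c i, c < C -> i < size (ls c) ->
  m0 (off c + 1 + 2 * i) = (nth (0, 0) (ls c) i).1 /\
  m0 (off c + 2 + 2 * i) = (nth (0, 0) (ls c) i).2.
Hypothesis off0 : off 0 = 2.
Hypothesis offS : forall c, c < C -> off c.+1 = off c + 1 + 2 * m0 (off c).
Hypothesis ls_var : forall c l, c < C -> l \in ls c -> l.1 < V.
Hypothesis W_big : B + 8 * (V + C) + 200 < W.
Let nb c := unzip1 (ls c).
(** [T] is any superset of the neighbourhoods, so that it can be a level set of labels or the set of
    marked variables. *)
Hypothesis hall : forall S T : seq nat, uniq S ->
  (forall c, c \in S -> c < C /\ {subset nb c <= T}) -> size S <= size T.

Lemma off_mono c d : c <= d -> d <= C -> off c <= off d.
Proof.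
move=> cd; elim: d cd => [|d IH] cd dC; first by have -> : c = 0 by lia.
have [->//|ne] := eqVneq c d.+1.
by have := IH (ltac:(lia)) (ltac:(lia)); rewrite offS //; lia.
Qed.

Definition readonly (m : nat -> nat) :=
  (forall a, a < off C -> m a = m0 a) /\ (forall c, c < C -> arr B m aStart c = off c).

Lemma ok_get r k e s (Q : nat -> state -> Prop) : s.1 xB = B -> k < 8 ->
  safe W s e -> ev s e <= V + C + 10 ->
  Q 1 (upd s.1 r (arr B s.2 k (ev s e)), s.2) -> ok W (CAsg r (arr_get k e)) s Q.
Proof.
move=> sB k8 se eb q; apply: ok_asg.
  by apply: safe_arr_addr => //; rewrite sB; lia.
by rewrite [ev _ _]/(s.2 (ev s (arr_addr k e))) ev_arr_addr sB.
Qed.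

Lemma ok_set k e f s (Q : nat -> state -> Prop) : s.1 xB = B -> k < 8 ->
  safe W s e -> safe W s f -> ev s e <= V + C + 10 ->
  Q 1 (s.1, upd s.2 (B + (8 * ev s e + k)) (ev s f)) -> ok W (arr_set k e f) s Q.
Proof.
move=> sB k8 se sf eb q; apply: ok_sto => //.
  by apply: safe_arr_addr => //; rewrite sB; lia.
by rewrite ev_arr_addr sB.
Qed.

Lemma readonly_upd m k i x : 0 < k < 8 -> readonly m ->
  readonly (upd m (B + (8 * i + k)) x).
Proof.
move=> /andP[k0 k8] [low st]; split=> [a aC|c cC].
  by rewrite low_upd ?low // /B; lia.
by rewrite arr_upd // eq_sym gtn_eqF //= st.
Qed.

Lemma ok_scan body tb (J : nat -> (nat -> nat) -> Prop) rg m c :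
  c < C -> rg xB = B -> rg xh = c.+1 -> readonly m ->
  (forall i r r', (forall x, x \notin [:: xp; xk; xu] -> r' x = r x) ->
     J i r -> J i r') ->
  (forall i r, i < size (ls c) -> J i r -> r xu = (nth (0, 0) (ls c) i).1 ->
     r xp = off c + 1 + 2 * i ->
     ok W body (r, m) (fun t s' => [/\ t <= tb, s'.2 = m, s'.1 xp = r xp,
        s'.1 xk = r xk & J i.+1 s'.1])) ->
  J 0 rg ->
  ok W (scan body) (rg, m)
    (fun t s' => [/\ t <= 7 * tb + 40, s'.2 = m & J (size (ls c)) s'.1]).
Proof.
move=> cC rB rh [low st] stab bodyP J0.
have offC : off c + 1 + 2 * m0 (off c) <= off C.
  by rewrite -offS //; apply: off_mono.
have lsz := ls_size cC.
apply: ok_seq; apply: ok_asg.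
  by apply: safe_arr_addr; rewrite /= ?rh ?rB; lia.
rewrite /= -/(arr_addr _ _).
have -> : m (ev (rg, m) (arr_addr aStart (pred_exp xh))) = off c.
  by rewrite ev_arr_addr /= rB rh subn1; apply: st.
apply: ok_seq; apply: ok_asg => //=.
apply: ok_seq; apply: ok_asg => /=; first by lia.
apply: ok_seq; apply: ok_asg => /=; first by rewrite /upd /=; lia.
have -> : upd rg 6 (off c) 6 = off c by [].
have -> : upd (upd rg 6 (off c)) 7 (m (off c)) 7 = m0 (off c) by rewrite /upd /= low //; lia.
have -> : m0 (off c) - (m0 (off c) - 7) = size (ls c) by rewrite -lsz; lia.
set n := size (ls c) in lsz bodyP *.
have n7 : n <= 7 by lia.
set rg1 := upd _ 6 _.
pose I k (s : state) := exists i, [/\ i <= n, s.2 = m, s.1 xk = n - i,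
  s.1 xp = off c + 1 + 2 * i & J i s.1 /\ k = (n - i) * (tb + 4) + 1].
apply: (ok_conseq (Q := fun t s' => exists k, t + k <= n * (tb + 4) + 1 /\
   (s'.2 = m /\ J n s'.1))); last first.
  move=> t s' [k [tn [h1 h2]]]; split=> //.
  have : n * (tb + 4) <= 7 * (tb + 4) by rewrite leq_mul2r n7 orbT.
  lia.
apply: (ok_while (I := I) (Q := fun _ s' => s'.2 = m /\ J n s'.1)) => [k [r m'] [i [/= iN -> rk rp [Ji ->]]]|]; last first.
  exists 0; split=> //; rewrite /= ?subn0 ?muln0 ?addn0 //.
  split=> //; apply: stab J0 => x; rewrite !inE !negb_or => /and3P[h1 h2 h3].
  by rewrite /rg1 /upd (negPf h1) (negPf h2).
split=> //=; rewrite rk.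
  by move=> ni; split; [lia|split=> //]; have -> : n = i by lia.
move=> ni; have iN' : i < n by lia.
have aoff : off c + 1 + 2 * i < off C by rewrite -lsz in iN'; lia.
apply: ok_seq; apply: ok_asg => //=.
rewrite rp low // (proj1 (ls_mem cC iN')).
have Ji' : J i (upd r 8 (nth (0, 0) (ls c) i).1).
  apply: stab Ji => x; rewrite !inE !negb_or => /and3P[h1 h2 h3].
  by rewrite /upd (negPf h3).
apply: ok_seq; apply: ok_conseq (bodyP i _ iN' Ji' _ _) _ => //.
move=> t [r' m''] /= [tt -> rp' rk' Jr].
apply: ok_seq; apply: ok_asg => /=; first by rewrite rp' /upd /= rp; lia.
apply: ok_asg => /=; first by lia.
exists ((n - i.+1) * (tb + 4) + 1); split.
  have -> : n - i = (n - i.+1).+1 by lia.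
  by rewrite mulSn; lia.
exists i.+1; split=> //=.
- by rewrite /upd /= rk' /upd /= rk; lia.
- by rewrite /upd /= rp' /upd /= rp; lia.
- split=> //; apply: stab Jr => x; rewrite !inE !negb_or => /and3P[h1 h2 h3].
  by rewrite /upd (negPf h1) (negPf h2).
Qed.

Lemma nb_var c u : c < C -> u \in nb c -> u < V.
Proof. by move=> cC /mapP[l ll ->]; apply: ls_var ll. Qed.

Lemma updE f i x j : upd f i x j = if j == i then x else f j.
Proof. by []. Qed.

(** * The auction with bounded labels *)

Section Auction.
Variable L : nat.

(* [own v] is [d.+1] if [v] is held by clause [d] and [0] if it is free;
   [n] clauses have been inserted and [h] is the evicted one, if nonzero. *)
Record auction (n h : nat) (lab own : nat -> nat) : Prop := Auction {
  auction_free : forall v, v < V -> own v = 0 -> lab v = 0;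
  auction_own : forall v d, v < V -> own v = d.+1 -> [/\ d < C, d < n, v \in nb d &
    forall u, u \in nb d -> lab v <= (lab u).+1];
  auction_inj : forall v v', v < V -> v' < V -> own v = own v' -> own v != 0 -> v = v';
  auction_h : forall v, v < V -> own v = h -> h = 0;
  auction_hn : h <= n;
  auction_done : forall d, d < n -> d.+1 != h ->
    (exists2 v, v < V & own v = d.+1) \/ (forall u, u \in nb d -> L <= lab u);
  auction_lab : forall v, v < V -> lab v <= L
}.

Lemma auction_init : auction 0 0 (fun=> 0) (fun=> 0).
Proof. by split. Qed.

Lemma auction_insert n lab own : n < C -> auction n 0 lab own ->
  auction n.+1 n.+1 lab own.
Proof.
move=> nC [h1 h2 h3 h4 h5 h6 h7]; split=> //.
- by move=> v d vV /(h2 _ _ vV)[? ? ? ?]; split=> //; apply: ltnW.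
- by move=> v vV /(h2 _ _ vV)[_]; rewrite ltnn.
- by move=> d; rewrite ltnS leq_eqVlt eqSS => /orP[/eqP->|dn _]; [rewrite eqxx|apply: h6].
Qed.

Lemma auction_fail n d lab own : auction n d.+1 lab own ->
  (forall u, u \in nb d -> L <= lab u) -> auction n 0 lab own.
Proof.
move=> [h1 h2 h3 h4 h5 h6 h7] dL; split=> // e en _.
by have [->|ne] := eqVneq e d; [right|apply: h6].
Qed.

(** The slackness [lab v <= (lab u).+1] holds after the bid since [v] had the least label. It
    persists because labels only grow, and that of an owned variable changes only together with its
    owner. *)
Lemma auction_bid n d lab own v : n <= C -> auction n d.+1 lab own ->
  v \in nb d -> lab v < L -> (forall u, u \in nb d -> lab v <= lab u) ->
  auction n (own v) (upd lab v (lab v).+1) (upd own v d.+1).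
Proof.
move=> nC [h1 h2 h3 h4 h5 h6 h7] vd vL vmin.
have dC : d < C by lia.
have vV := nb_var dC vd.
have labS u : lab u <= upd lab v (lab v).+1 u by rewrite updE; case: eqP => [->|].
split.
- by move=> v' v'V; rewrite !updE; case: eqP => // _; apply: h1.
- move=> v' e v'V; rewrite !updE; case: (eqVneq v' v) => [->{v' v'V}|_].
    by move=> [<-]; split=> // u ud; rewrite ltnS; apply: leq_trans (labS u); apply: vmin.
  move=> /(h2 _ _ v'V)[? ? ? h]; split=> // u /h h'.
  by apply: leq_trans h' _; rewrite ltnS.
- move=> a b aV bV; rewrite !updE; case: (eqVneq a v) => [->|av]; case: (eqVneq b v) => [->|bv] //.
  + by move=> /esym /(h4 _ bV).
  + by move=> /(h4 _ aV).
  + exact: h3.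
- move=> a aV; rewrite updE; case: (eqVneq a v) => [_ /esym /(h4 _ vV)//|av ab].
  case: (eqVneq (own v) 0) => // ne; case/eqP: av.
  by apply: h3 => //; rewrite ab.
- case ov : (own v) => [//|e]; by have [] := h2 _ _ vV ov.
- move=> e en eh; have [->|ne] := eqVneq e d.
    by left; exists v => //; rewrite updE eqxx.
  have [|[u uV uo]|eL] := h6 e en; first by rewrite eqSS.
    left; exists u => //; rewrite updE; case: eqP => // uv.
    by rewrite -uv uo eqxx in eh.
  by right=> u /eL h; apply: leq_trans h (labS u).
- by move=> u uV; rewrite updE; case: eqP => // _; apply: h7.
Qed.

(** Let [l <= L]. The clauses of [U] saw only labels at least [L], and by slackness the owners of
    the variables of level [l + 1] see only labels at least [l]. Hall's condition makes each level
    exceed the next by at least [size U]; [L] levels telescope. *)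
Lemma auction_unmatched lab own (U : seq nat) : auction C 0 lab own -> uniq U ->
  (forall d, d \in U -> d < C /\ forall v, v < V -> own v != d.+1) ->
  L * size U <= V.
Proof.
move=> [h1 h2 h3 _ _ h6 h7] Uu UP.
pose lev l := [seq v <- iota 0 V | l <= lab v].
have levP l v : (v \in lev l) = (v < V) && (l <= lab v).
  by rewrite mem_filter mem_iota add0n andbC.
have step l : l < L.+1 -> size U + size (lev l.+1) <= size (lev l).
  move=> lL; rewrite -(size_map (fun v => (own v).-1) (lev l.+1)) -size_cat.
  have own0 v : v \in lev l.+1 -> own v != 0.
    by rewrite levP => /andP[vV vl]; apply: contraTN vl => /eqP/(h1 _ vV)->.
  apply: hall.
    rewrite cat_uniq Uu /=; apply/andP; split.
    + apply/hasPn => _ /mapP[v vl ->]; apply/negP => /UP[_].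
      have v0 := own0 _ vl; move: vl; rewrite levP => /andP[vV _] /(_ v vV).
      by rewrite prednK ?lt0n ?eqxx.
    + rewrite map_inj_in_uniq ?filter_uniq ?iota_uniq // => v v' vl vl' e.
      have v0 := own0 _ vl; have v0' := own0 _ vl'.
      move: vl vl'; rewrite !levP => /andP[vV _] /andP[vV' _].
      apply: h3 => //; by rewrite -[own v]prednK ?lt0n // e prednK ?lt0n.
  move=> d; rewrite mem_cat => /orP[/UP[dC du]|/mapP[v vl ->]].
    split=> // u ud; rewrite levP (nb_var dC ud) /=.
    have [//|[v vV vo]|/(_ u ud) h] := h6 d dC.
      by have := du v vV; rewrite vo eqxx.
    lia.
  have v0 := own0 _ vl; move: vl; rewrite levP => /andP[vV vl].
  have vo : own v = (own v).-1.+1 by rewrite prednK ?lt0n.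
  have [dC _ _ h] := h2 _ _ vV vo; split=> // u ud.
  by rewrite levP (nb_var dC ud) /=; have := h _ ud; lia.
have main k : k <= L -> k * size U + size (lev k) <= V.
  elim: k => [|k IH] kL.
    by rewrite add0n (leq_trans (size_subseq (filter_subseq _ _))) // size_iota.
  rewrite mulSn; apply: leq_trans (IH (ltnW kL)).
  by have := step k; lia.
by apply: leq_trans (main L (leqnn L)); apply: leq_addr.
Qed.

(** The potential of the auction: a successful bid raises it by one, and it never exceeds
    [L * V]. *)
Definition total (lab : nat -> nat) := \sum_(i < V) lab i.

Lemma total_upd lab v x : v < V -> total (upd lab v x) + lab v = total lab + x.
Proof.
move=> vV; rewrite /total (bigD1 (Ordinal vV)) //= [in RHS](bigD1 (Ordinal vV)) //=.
rewrite updE eqxx (eq_bigr (fun i : 'I_V => lab i)); first by lia.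
by move=> i; rewrite updE -val_eqE /= => /negPf->.
Qed.

Lemma total_le lab : (forall v, v < V -> lab v <= L) -> total lab <= L * V.
Proof.
move=> h; rewrite mulnC -[X in X * _]card_ord -sum_nat_const.
by apply: leq_sum => i _; apply: h.
Qed.

Definition env (r : nat -> nat) := [/\ r xV = V, r xC = C, r xB = B & r xL = L].

Hypothesis L_le : L <= V + 2.

Lemma ok_minlab rg m c : c < C -> env rg -> rg xh = c.+1 -> rg xb = L ->
  readonly m ->
  ok W (scan minlab_body) (rg, m) (fun t s' => [/\ t <= 68, s'.2 = m,
    forall x, x \notin [:: xp; xk; xu; xt; xb; xv] -> s'.1 x = rg x,
    forall u, u \in nb c -> s'.1 xb <= arr B m aLab u &
    s'.1 xb <= L /\ (s'.1 xb < L -> s'.1 xv \in nb c /\ arr B m aLab (s'.1 xv) = s'.1 xb)]).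
Proof.
move=> cC [rV rC rB rL] rh rb ro.
pose J i (r : nat -> nat) := [/\ forall x, x \notin [:: xp; xk; xu; xt; xb; xv] -> r x = rg x,
    forall j, j < i -> r xb <= arr B m aLab (nth (0, 0) (ls c) j).1 &
    r xb <= L /\ (r xb < L -> r xv \in nb c /\ arr B m aLab (r xv) = r xb)].
apply: ok_conseq (@ok_scan _ 4 J _ _ _ cC rB rh ro _ _ _) _.
- move=> i r r' rr [h1 h2 h3]; split.
  + move=> x xn; rewrite rr ?h1 //; apply: contra xn; rewrite !inE.
    by case/or3P => ->; rewrite ?orbT.
  + by move=> j /h2; rewrite rr.
  + by rewrite !rr.
- move=> i r iN [h1 h2 [h3 h4]] ru rp.
  have unb : r xu \in nb c by rewrite ru; apply: map_f; apply: mem_nth.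
  have uV := nb_var cC unb.
  apply: ok_seq; apply: ok_get => //=; [by rewrite h1|lia|].
  apply: ok_if => //= [gt|le].
    apply: ok_seq; apply: ok_asg => //=; apply: ok_asg => //=; split=> //.
    rewrite /upd /= in gt *; split.
    + by move=> x xn; rewrite -h1 //; move: xn; rewrite !inE;
        do 6?[case: eqP => //= _].
    + move=> j; rewrite /= ltnS leq_eqVlt => /orP[/eqP->|/h2 h]; first by rewrite ru.
      lia.
    + by rewrite /=; split=> //; lia.
  apply: ok_skip; split=> //.
  rewrite /upd /= in le *; split=> //=.
  + by move=> x xn; rewrite -h1 //; move: xn; rewrite !inE; do 4?[case: eqP => //= _].
  + move=> j; rewrite ltnS leq_eqVlt => /orP[/eqP->|/h2 h]; last by lia.
    rewrite -ru; lia.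
- by split=> //; split; rewrite rb // ltnn.
move=> t s' [tt -> [h1 h2 h3]]; split=> //.
move=> u /(nthP 0)[j]; rewrite size_map => jN <-.
by rewrite (nth_map (0, 0)) //; apply: h2.
Qed.

Lemma ok_bid n d rg m : env rg -> readonly m -> n <= C -> rg xh = d.+1 ->
  auction n d.+1 (arr B m aLab) (arr B m aOwn) ->
  ok W bid (rg, m) (fun t s' => [/\ t <= 80, env s'.1, s'.1 xc = rg xc, readonly s'.2 &
    [/\ arr B s'.2 aHome = arr B m aHome, arr B s'.2 aMark = arr B m aMark,
        auction n (s'.1 xh) (arr B s'.2 aLab) (arr B s'.2 aOwn) &
        (s'.1 xh = 0 /\ arr B s'.2 aLab = arr B m aLab) \/
        total (arr B s'.2 aLab) = (total (arr B m aLab)).+1]]).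
Proof.
move=> en ro nC rh au; have [rV rC rB rL] := en.
have dC : d < C by have := auction_hn au; lia.
apply: ok_seq; apply: ok_asg => //=.
apply: ok_seq; apply: ok_conseq (@ok_minlab _ m d dC _ _ _ ro) _ => //=.
move=> t [r m'] /= [tt -> fr bmin [bL bv]].
have f x : x \notin [:: xp; xk; xu; xt; xb; xv] -> r x = rg x.
  move=> xn; rewrite fr //; move: xn; rewrite !inE !negb_or /upd.
  by case/and5P => _ _ _ _ /andP[/negPf-> _].
have env' : env r by split; rewrite f.
apply: ok_if => //= [bl|bl].
  have bl' : r xb < L by move: bl; rewrite (f 3) // rL; lia.
  have [vd vb] := bv bl'; have vV := nb_var dC vd.
  have vmin u : u \in nb d -> arr B m aLab (r xv) <= arr B m aLab u.
    by rewrite vb; apply: bmin.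
  have au' := auction_bid nC au vd _ vmin; rewrite vb in au'; have {}au' := au' bl'.
  have [eV eC eB eL] := env'.
  apply: ok_seq; apply: ok_set => //=; [lia|lia|].
  apply: ok_seq; apply: ok_get => //=; first lia.
  apply: ok_seq; apply: ok_set => //=; first by rewrite /upd /=; lia.
  apply: ok_asg => //=.
  regs; arrs; regs; rewrite (f 5) // rh addn1.
  split=> //.
  + lia.
  + by rewrite f.
  + by apply: readonly_upd => //; apply: readonly_upd.
  + rewrite addn1; split=> //; right.
    have := @total_upd (arr B m aLab) (r xv) (r xb).+1 vV; rewrite vb; lia.
apply: ok_asg; first by rewrite /=; lia.
split=> //=.
- lia.
- by rewrite /upd /= f.
- split=> //; last by left.
  rewrite /upd /=; apply: auction_fail au _ => u /bmin.
  by move: bl; rewrite (f 3) // rL; lia.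
Qed.

Lemma ok_auction rg m : env rg -> readonly m ->
  arr B m aLab = (fun=> 0) -> arr B m aOwn = (fun=> 0) ->
  ok W auction_loop (rg, m) (fun t s' =>
    [/\ t <= 90 * (L * V) + 100 * C + 2, env s'.1, readonly s'.2 &
    [/\ arr B s'.2 aHome = arr B m aHome, arr B s'.2 aMark = arr B m aMark &
        auction C 0 (arr B s'.2 aLab) (arr B s'.2 aOwn)]]).
Proof.
move=> en ro lab0 own0.
pose keep (s : state) := [/\ env s.1, readonly s.2, arr B s.2 aHome = arr B m aHome &
  arr B s.2 aMark = arr B m aMark].
pose pot (s : state) := L * V - total (arr B s.2 aLab).
pose I k (s : state) := exists n, [/\ keep s, n <= C, s.1 xc = n,
  auction n 0 (arr B s.2 aLab) (arr B s.2 aOwn) &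
  k = 90 * pot s + 100 * (C - n) + 1].
apply: ok_seq; apply: ok_asg => /=; first by lia.
apply: (ok_conseq (Q := fun t s' => exists k, t + k <= 90 * (L * V) + 100 * C + 1 /\
   (keep s' /\ auction C 0 (arr B s'.2 aLab) (arr B s'.2 aOwn)))); last first.
  by move=> t s' [k [tn [[h1 h2 h3 h4] h5]]]; split=> //; lia.
have [rV rC rB rL] := en.
apply: (ok_while (I := I) (Q := fun _ s' => keep s' /\
   auction C 0 (arr B s'.2 aLab) (arr B s'.2 aOwn))); last first.
  exists 0; split=> //; first by rewrite lab0 own0; apply: auction_init.
  rewrite /pot /= lab0 /total big1 // subn0 subn0; lia.
move=> k s [n [[[sV sC sB sL] sro sH sM] nC sn au ->]].
split=> //=; rewrite sC sn.
  move=> Cn; split; first lia; split; first by split.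
  by have nE : n = C by [lia]; rewrite nE in au.
move=> Cn; have nC' : n < C by lia.
apply: ok_seq; apply: ok_asg => /=; first by rewrite sn; lia.
(* The surplus of 90 while a clause is evicted pays for a bid that raises no label, which ends the
   chain of evictions. *)
pose I' k (s' : state) := [/\ keep s', s'.1 xc = n, 
  auction n.+1 (s'.1 xh) (arr B s'.2 aLab) (arr B s'.2 aOwn) &
  k = 90 * pot s' + (if s'.1 xh == 0 then 1 else 91)].
apply: ok_seq; apply: ok_conseq.
  apply: (ok_while (I := I') (n := 90 * pot s + 91) (Q := fun k s' => [/\ keep s', s'.1 xc = n,
    auction n.+1 0 (arr B s'.2 aLab) (arr B s'.2 aOwn) & k = 90 * pot s'])); last first.
    split=> //=; rewrite /upd /= ?sn ?addn1 //; exact: auction_insert.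
  move=> k' s' [[sE' sro' sH' sM'] sc' au' ->].
  split=> //=.
    by move=> h0; rewrite h0 /= in au' *; split; [lia|split=> //; lia].
  case hE : (s'.1 xh) => [//|d] _ /=.
  rewrite hE in au'; rewrite (surjective_pairing s').
  apply: ok_conseq (ok_bid sE' sro' nC' hE au') _.
  move=> t [r m'] /= [t80 en' rc' ro' [H' M' au2 alt]].
  exists (90 * pot (r, m') + (if r xh == 0 then 1 else 91)); split; last first.
    by split=> //=; [split=> //=; rewrite ?H' ?M'|rewrite rc'].
  have tl := total_le (auction_lab au2).
  case: alt => [[-> labE]|tS]; rewrite /pot /= in tl *.
    by rewrite labE /=; lia.
  rewrite tS in tl *; case: ifP => _; lia.
move=> t [r m'] /= [k' [tk [[[eV eC eB eL] ro' H' M'] rc au' kE]]].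
apply: ok_asg => /=; first by rewrite rc; lia.
exists (90 * pot (r, m') + 100 * (C - n.+1) + 1); split; first lia.
by exists n.+1; split=> //; last by rewrite /= /upd /= rc addn1.
Qed.

End Auction.

(** * Augmenting paths by depth-first search *)

Definition matching (own home : nat -> nat) :=
  (forall v d, v < V -> own v = d.+1 -> [/\ d < C, v \in nb d & home d = v.+1]) /\
  (forall d v, d < C -> home d = v.+1 -> v < V /\ own v = d.+1).

Definition unmarked c (mark : nat -> nat) := count (fun v => mark v != c.+1) (iota 0 V).

Lemma unmarked_upd c mark v : v < V -> mark v != c.+1 ->
  (unmarked c (upd mark v c.+1)).+1 = unmarked c mark.
Proof.
move=> vV mv; rewrite /unmarked.
have vi : v \in iota 0 V by rewrite mem_iota.
have cE P : count P (iota 0 V) = P v + count P (rem v (iota 0 V)).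
  by rewrite (permP (perm_to_rem vi)).
rewrite !cE updE !eqxx mv /= add0n add1n; congr _.+1.
apply: eq_in_count => u ur; rewrite updE; case: (u =P v) => // uv.
by move: ur; rewrite uv mem_rem_uniqF ?iota_uniq.
Qed.

(* The stack [stk] holds successors of clauses; [c] is the clause at its bottom,
   and the variables marked [c.+1] are those reached from [c]. *)
Record dfs (c d : nat) (own home mark stk : nat -> nat) : Prop := Dfs {
  dfs_match : matching own home;
  dfs_c : c < C;
  dfs_root : home c = 0;
  dfs_stk0 : stk 0 = c.+1;
  dfs_stk : forall i, i < d -> exists2 e, e < C & stk i = e.+1;
  dfs_link : forall i e e', i.+1 < d -> stk i = e.+1 -> stk i.+1 = e'.+1 ->
    exists v, [/\ v \in nb e, home e' = v.+1 & mark v = c.+1];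
  dfs_inj : forall i j, i < d -> j < d -> stk i = stk j -> i = j;
  dfs_marked : forall v, v < V -> mark v = c.+1 -> exists2 e, own v = e.+1 &
    (exists2 i, i < d & stk i = e.+1) \/ (forall u, u \in nb e -> mark u = c.+1);
  dfs_mark : forall v, v < V -> mark v <= c.+1;
  dfs_cnt : d + unmarked c mark <= V.+1
}.

Lemma dfs_init c own home mark stk : c < C -> matching own home -> home c = 0 ->
  (forall v, v < V -> mark v <= c) -> dfs c 1 own home mark (upd stk 0 c.+1).
Proof.
move=> cC mt hc mc; split=> //.
- by move=> [|//] _; exists c.
- by case=> [|//] [].
- by move=> v vV mv; have := mc v vV; rewrite mv ltnn.
- by move=> v vV; apply: leqW; apply: mc.
- by rewrite add1n ltnS -[X in _ <= X](size_iota 0 V); apply: count_size.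
Qed.

Lemma dfs_pop c d e own home mark stk : dfs c d.+2 own home mark stk ->
  stk d.+1 = e.+1 -> (forall u, u \in nb e -> mark u = c.+1) ->
  dfs c d.+1 own home mark stk.
Proof.
move=> [h1 h2 h3 h4 h5 h6 h7 h8 h9 h10] se em; split=> //.
- by move=> i id; apply: h5; apply: ltnW.
- by move=> i x y id; apply: h6; apply: ltnW.
- by move=> i j id jd; apply: h7; apply: ltnW.
- move=> v vV /(h8 _ vV)[x vx al]; exists x => //.
  case: al => [[i]|]; last by right.
  rewrite ltnS leq_eqVlt => /orP[/eqP->|id] si; last by left; exists i.
  by right; move: si; rewrite se => -[<-].
- lia.
Qed.

(** A failed search would contradict Hall's condition: the marked variables [T] have distinct owners
    whose variables all lie in [T], and so do those of the root, which holds none. That is one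
    clause more than [T] has variables. *)
Lemma dfs_stuck c own home mark stk : dfs c 1 own home mark stk ->
  (forall u, u \in nb c -> mark u = c.+1) -> False.
Proof.
move=> [[m1 m2] h2 h3 h4 h5 h6 h7 h8 h9 h10] cm.
pose T := [seq v <- iota 0 V | mark v == c.+1].
have TP v : (v \in T) = (v < V) && (mark v == c.+1).
  by rewrite mem_filter mem_iota add0n andbC.
have ownT v : v \in T -> exists e, [/\ v < V, own v = e.+1, home e = v.+1, e < C &
    {subset nb e <= T}].
  rewrite TP => /andP[vV /eqP mv]; have [e ve al] := h8 v vV mv.
  have [eC _ he] := m1 _ _ vV ve; exists e; split=> // u ue.
  rewrite TP (nb_var eC ue); case: al => [[[|//] _]|/(_ u ue)->]; last by rewrite eqxx.
  by rewrite h4 => -[ce]; rewrite cm ?eqxx // ce.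
have : size (c :: [seq (own v).-1 | v <- T]) <= size T.
  apply: hall.
    rewrite /=; apply/andP; split.
      apply/mapP => -[v /ownT[e [_ -> he _ _]]] /= cE.
      by rewrite cE he in h3.
    rewrite map_inj_in_uniq ?filter_uniq ?iota_uniq // => u v.
    move=> /ownT[x [_ -> ux _ _]] /ownT[y [_ -> vy _ _]] /= xy.
    by move: ux; rewrite xy vy => -[].
  move=> e; rewrite inE => /orP[/eqP->|/mapP[v /ownT[x [_ -> _ xC xT]] ->]] //.
  by split=> // u uc; rewrite TP (nb_var h2 uc) cm /=.
by rewrite /= size_map ltnn.
Qed.

Lemma dfs_push c d e v e2 own home mark stk : dfs c d.+1 own home mark stk ->
  stk d = e.+1 -> v \in nb e -> v < V -> mark v != c.+1 -> own v = e2.+1 ->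
  dfs c d.+2 own home (upd mark v c.+1) (upd stk d.+1 e2.+1).
Proof.
move=> [h1 h2 h3 h4 h5 h6 h7 h8 h9 h10] se ve vV mv ov.
have [e2C ve2 he2] := h1.1 _ _ vV ov.
have keep u : mark u = c.+1 -> upd mark v c.+1 u = c.+1 by rewrite updE; case: eqP.
(* The home of [e2] is the unmarked [v], whereas stack entries have marked homes, or none at the
   root. *)
have e2n i : i < d.+1 -> stk i != e2.+1.
  case: i => [_|i id].
    rewrite h4; apply/eqP => -[ce]; by rewrite ce he2 in h3.
  apply/eqP => si; have [x _ sx] := h5 i (ltnW id).
  have [u [_ hu mu]] := h6 _ _ _ id sx si.
  by move: hu mu mv; rewrite he2 => -[->] ->; rewrite eqxx.
split=> //.
- move=> i; rewrite ltnS leq_eqVlt updE => /orP[/eqP->|id].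
    by rewrite eqxx; exists e2.
  by rewrite ltn_eqF //; apply: h5.
- move=> i x y; rewrite ltnS leq_eqVlt !updE eqSS => /orP[/eqP[->]|id].
    rewrite eqxx ltn_eqF // se => -[<-] [<-]; exists v; split=> //.
    by rewrite updE eqxx.
  have -> : (i == d.+1) = false by lia.
  have -> : (i == d) = false by lia.
  move=> sx sy.
  by have [u [? ? ?]] := h6 _ _ _ id sx sy; exists u; split=> //; apply: keep.
- move=> i j; rewrite !ltnS !updE => id jd.
  case: (eqVneq i d.+1) => [->|ni]; case: (eqVneq j d.+1) => [->|nj] //.
  + by move=> /esym/eqP; rewrite (negPf (e2n _ _)) //; lia.
  + by move=> /eqP; rewrite (negPf (e2n _ _)) //; lia.
  + by apply: h7; lia.
- move=> u uV; rewrite updE; case: (eqVneq u v) => [-> _|_ mu].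
    by exists e2 => //; left; exists d.+1 => //; rewrite updE eqxx.
  have [x ux al] := h8 u uV mu; exists x => //; case: al => [[i id si]|al].
    left; exists i; first exact: ltnW.
    by rewrite updE ltn_eqF.
  by right=> y /al; apply: keep.
- by move=> u uV; rewrite updE; case: eqP => // _; apply: h9.
- by have := unmarked_upd vV mv; lia.
Qed.

(* The [d] lowest stack entries remain to be moved, the topmost one to the
   variable [f.-1], which no clause holds any more. *)
Record augment_inv (c d f : nat) (own home stk : nat -> nat) : Prop := AugmentInv {
  aug_c : c < C;
  aug_root : home c = 0;
  aug_stk0 : stk 0 = c.+1;
  aug_stk : forall i, i < d -> exists2 e, e < C & stk i = e.+1;
  aug_link : forall i e e', i.+1 < d -> stk i = e.+1 -> stk i.+1 = e'.+1 ->
    exists2 v, v \in nb e & home e' = v.+1;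
  aug_inj : forall i j, i < d -> j < d -> stk i = stk j -> i = j;
  aug_top : forall e, stk d.-1 = e.+1 -> exists2 v, f = v.+1 & v \in nb e;
  aug_own : forall v e, v < V -> v.+1 != f -> own v = e.+1 ->
    [/\ e < C, v \in nb e & home e = v.+1];
  aug_home : forall e v, e < C -> home e = v.+1 -> v < V /\ own v = e.+1;
  aug_free : forall e, e < C -> home e != f
}.

Lemma augment_init c d e v own home mark stk : dfs c d.+1 own home mark stk ->
  stk d = e.+1 -> v \in nb e -> own v = 0 -> augment_inv c d.+1 v.+1 own home stk.
Proof.
move=> [[m1 m2] h2 h3 h4 h5 h6 h7 h8 h9 h10] se ve ov; split=> //.
- by move=> i x y id sx sy; have [u [? ? _]] := h6 _ _ _ id sx sy; exists u.
- by move=> x; rewrite se => -[<-]; exists v.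
- by move=> u x uV _; apply: m1.
- move=> x xC; apply/eqP => hx; have [_] := m2 _ _ xC hx.
  by rewrite ov.
Qed.

(** The variable released by [e] belongs to the clause below by [aug_link], so it becomes the one
    that clause can take. *)
Lemma augment_step c d e f own home stk : augment_inv c d.+2 f own home stk ->
  stk d.+1 = e.+1 ->
  augment_inv c d.+1 (home e) (upd own f.-1 e.+1) (upd home e f) stk.
Proof.
move=> [h1 h2 h3 h4 h5 h6 h7 h8 h9 h10] se.
have [w fE we] := h7 _ se; rewrite fE /=.
have [x xC sx] := h4 d (leqnSn _).
have [v vx hv] := h5 d x e (leqnn _) sx se.
have eC : e < C by have [y yC] := h4 d.+1 (leqnn _); rewrite se => -[->].
have [vV ov] := h9 _ _ eC hv.
have wV := nb_var eC we.
have sne i : i < d.+1 -> stk i != e.+1.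
  move=> id; apply/eqP => si; have := h6 i d.+1 (ltnW id) (leqnn _).
  by rewrite si se => /(_ erefl) ie; rewrite ie ltnn in id.
split=> //.
- rewrite updE; case: eqP => // ce; have := sne 0 isT.
  by rewrite h3 ce eqxx.
- by move=> i id; apply: h4; apply: ltnW.
- move=> i y z id sy sz; have [u uy hz] := h5 i y z (ltnW id) sy sz.
  exists u => //; rewrite updE; case: eqP => // ze.
  by have := sne _ id; rewrite sz ze eqxx.
- by move=> i j id jd; apply: h6; apply: ltnW.
- by move=> y /=; rewrite sx => -[<-]; exists v.
- move=> u y uV; rewrite hv eqSS => uv; rewrite !updE.
  case: (eqVneq u w) => [-> [<-]|uw].
    by split=> //; rewrite eqxx.
  move=> oy; have uf : u.+1 != f by rewrite fE eqSS.
  have [yC uy hy] := h8 u y uV uf oy.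
  split=> //; case: eqP => // ye.
  by move: hy; rewrite ye hv => -[] /eqP; rewrite eq_sym (negPf uv).
- move=> y u yC; rewrite !updE; case: (eqVneq y e) => [->|ye].
    by move=> [<-]; rewrite eqxx.
  move=> hy; have [uV oy] := h9 _ _ yC hy; split=> //.
  case: eqP => // uw; have := h10 y yC; by rewrite hy uw fE eqxx.
- move=> y yC; rewrite updE; case: (eqVneq y e) => [_|ye].
    by rewrite -fE eq_sym; apply: h10.
  apply/eqP => hy; rewrite hv in hy; have [_] := h9 _ _ yC hy.
  by rewrite ov => -[] /eqP; rewrite eq_sym (negPf ye).
Qed.

Lemma augment_last c f own home stk : augment_inv c 1 f own home stk ->
  matching (upd own f.-1 c.+1) (upd home c f).
Proof.
move=> [h1 h2 h3 h4 h5 h6 h7 h8 h9 h10].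
have [w fE wc] := h7 _ h3; rewrite fE /=; have wV := nb_var h1 wc.
split=> [v e vV|e v eC]; rewrite !updE.
  case: (eqVneq v w) => [-> [<-]|vw oe]; first by rewrite eqxx.
  have vf : v.+1 != f by rewrite fE eqSS.
  have [eC ve he] := h8 v e vV vf oe.
  by split=> //; case: eqP => // ec; rewrite ec h2 in he.
case: (eqVneq e c) => [->|ec]; first by move=> [<-]; rewrite eqxx.
move=> he; have [vV oe] := h9 _ _ eC he; split=> //.
by case: eqP => // vw; have := h10 e eC; rewrite he vw fE eqxx.
Qed.

Definition base (r : nat -> nat) := [/\ r xV = V, r xC = C & r xB = B].

Lemma ok_home rg m : base rg -> readonly m -> arr B m aHome = (fun=> 0) ->
  (forall v d, v < V -> arr B m aOwn v = d.+1 -> d < C /\ v \in nb d) ->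
  (forall v v', v < V -> v' < V -> arr B m aOwn v = arr B m aOwn v' ->
     arr B m aOwn v != 0 -> v = v') ->
  ok W home_loop (rg, m) (fun t s' =>
    [/\ t <= 6 * V + 2, base s'.1, readonly s'.2, arr B s'.2 aMark = arr B m aMark &
        arr B s'.2 aOwn = arr B m aOwn /\ matching (arr B s'.2 aOwn) (arr B s'.2 aHome)]).
Proof.
move=> [rV rC rB] ro home0 ownP own_inj.
pose keep (s : state) := [/\ base s.1, readonly s.2, arr B s.2 aMark = arr B m aMark &
  arr B s.2 aOwn = arr B m aOwn].
pose hom n home := (forall v d, v < n -> arr B m aOwn v = d.+1 -> home d = v.+1) /\
  (forall d v, home d = v.+1 -> v < n /\ arr B m aOwn v = d.+1).
pose I k (s : state) := exists n, [/\ keep s, n <= V, s.1 xv = n, hom n (arr B s.2 aHome) &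
  k = 6 * (V - n) + 1].
apply: ok_seq; apply: ok_asg; first by rewrite /=; lia.
apply: (ok_conseq (Q := fun t s' => exists k, t + k <= 6 * V + 1 /\
   (keep s' /\ hom V (arr B s'.2 aHome)))); last first.
  move=> t s' [k [tk [[h1 h2 h3 h4] [h5 h6]]]]; split=> //; first lia.
  split=> //; rewrite h4; split=> [v d vV vd|d v dC dv]; last exact: h6.
  by have [] := ownP v d vV vd; split=> //; apply: h5.
apply: (ok_while (I := I) (Q := fun _ s' => keep s' /\ hom V (arr B s'.2 aHome))); last first.
  by exists 0; split=> //; [rewrite /= home0; split|rewrite subn0].
move=> k [r m'] [n [[[/= sV sC sB] /= sro sM sO] nV /= sn [h1 h2] ->]].
split=> //=; rewrite sV sn.
  by move=> Vn; have nE : n = V by [lia]; rewrite nE in h1 h2; split=> //; lia.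
move=> Vn; have nV' : n < V by lia.
apply: ok_seq; apply: ok_get => //=; first lia.
rewrite sO sn; apply: ok_seq; apply: ok_if => //=; regs.
  case oE : (arr B m aOwn n) => [//|d] _.
  have [dC dn] := ownP _ _ nV' oE.
  apply: ok_set => //=; regs; rewrite ?sn; [lia|lia|lia|].
  rewrite subSS subn0 addn1.
  apply: ok_asg => /=; regs; first by rewrite sn; lia.
  exists (6 * (V - n.+1) + 1); split; first lia.
  exists n.+1; split=> //=; regs; rewrite ?sn ?addn1 //.
  - split=> //=; arrs => //; exact: readonly_upd.
  - arrs; split=> [v e|e v]; rewrite updE.
      rewrite ltnS leq_eqVlt => /orP[/eqP->|vn]; first by rewrite oE => -[<-]; rewrite eqxx.
      move=> ve; case: eqP => [ed|_]; last exact: h1.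
      have vE : v = n by apply: own_inj; rewrite ?ve ?oE ?ed //; lia.
      by rewrite vE ltnn in vn.
    case: eqP => [-> [<-]//|_ /h2[vn ve]]; split=> //; lia.
move=> o0; apply: ok_skip.
apply: ok_asg => /=; regs; first by rewrite sn; lia.
exists (6 * (V - n.+1) + 1); split; first lia.
exists n.+1; split=> //=; regs; rewrite ?sn ?addn1 //.
split=> [v e|e v /h2[vn ve]]; last by split=> //; lia.
rewrite ltnS leq_eqVlt => /orP[/eqP->|vn]; first by rewrite o0.
exact: h1.
Qed.

Lemma ok_unmarked rg m c e : c < C -> base rg -> rg xh = e.+1 -> e < C -> rg xf = 0 ->
  rg xs = c.+1 -> readonly m ->
  ok W (scan unmarked_body) (rg, m) (fun t s' => [/\ t <= 61, s'.2 = m,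
    forall x, x \notin [:: xp; xk; xu; xt; xf] -> s'.1 x = rg x,
    s'.1 xf = 0 -> forall u, u \in nb e -> c < arr B m aMark u &
    forall v, s'.1 xf = v.+1 -> v \in nb e /\ arr B m aMark v <= c]).
Proof.
move=> cC [rV rC rB] rh eC rf rs ro.
pose J i (r : nat -> nat) := [/\ forall x, x \notin [:: xp; xk; xu; xt; xf] -> r x = rg x,
    r xf = 0 -> forall j, j < i -> c < arr B m aMark (nth (0, 0) (ls e) j).1 &
    forall v, r xf = v.+1 -> v \in nb e /\ arr B m aMark v <= c].
apply: ok_conseq (@ok_scan _ 3 J _ _ _ eC rB rh ro _ _ _) _.
- move=> i r r' rr [h1 h2 h3]; split.
  + move=> x xn; rewrite rr ?h1 //; apply: contra xn; rewrite !inE.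
    by case/or3P => ->; rewrite ?orbT.
  + by rewrite rr.
  + by move=> v; rewrite rr //; apply: h3.
- move=> i r iN [h1 h2 h3] ru rp.
  have unb : r xu \in nb e by rewrite ru; apply: map_f; apply: mem_nth.
  have uV := nb_var eC unb.
  apply: ok_seq; apply: ok_get => //=; [by rewrite h1|lia|].
  apply: ok_if => //=; regs; rewrite h1 // rs.
    move=> gt; apply: ok_asg => /=; regs; first lia.
    split=> //; split=> /=; regs.
    + by move=> x xn; rewrite -h1 //; move: xn; rewrite !inE /upd;
        do 5?[case: eqP => //= _].
    + by rewrite addn1.
    + by move=> v; rewrite addn1 => -[<-]; split=> //; lia.
  move=> le; apply: ok_skip; split=> //; split=> /=; regs.
  + by move=> x xn; rewrite -h1 //; move: xn; rewrite !inE /upd; do 4?[case: eqP => //= _].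
  + move=> f0 j; rewrite ltnS leq_eqVlt => /orP[/eqP->|]; last exact: h2.
    rewrite -ru; lia.
  + exact: h3.
- by split=> //; rewrite rf.
move=> t s' [tt -> [h1 h2 h3]]; split=> //.
move=> f0 u /(nthP 0)[j]; rewrite size_map => jN <-.
by rewrite (nth_map (0, 0)) //; apply: h2.
Qed.

Lemma ok_augment c d f rg m : base rg -> readonly m -> rg xd = d.+1 -> rg xf = f ->
  d <= V -> augment_inv c d.+1 f (arr B m aOwn) (arr B m aHome) (arr B m aStk) ->
  ok W augment (rg, m) (fun t s' => [/\ t <= 7 * d.+1 + 1, base s'.1, readonly s'.2,
    forall x, x \notin [:: xd; xh; xt; xf] -> s'.1 x = rg x &
    [/\ s'.1 xd = 0, arr B s'.2 aMark = arr B m aMark,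
      matching (arr B s'.2 aOwn) (arr B s'.2 aHome), arr B s'.2 aHome c != 0 &
      forall e, arr B m aHome e != 0 -> arr B s'.2 aHome e != 0]]).
Proof.
move=> ba ro rd rf dV au.
pose keep (s : state) := [/\ base s.1, readonly s.2,
  forall x, x \notin [:: xd; xh; xt; xf] -> s.1 x = rg x,
  arr B s.2 aMark = arr B m aMark &
  forall e, arr B m aHome e != 0 -> arr B s.2 aHome e != 0].
pose fin (s : state) := matching (arr B s.2 aOwn) (arr B s.2 aHome) /\
  arr B s.2 aHome c != 0.
pose I k (s : state) := keep s /\ exists n, [/\ s.1 xd = n, n <= d.+1, k = 7 * n + 1 &
  if n == 0 then fin s else
  augment_inv c n (s.1 xf) (arr B s.2 aOwn) (arr B s.2 aHome) (arr B s.2 aStk)].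
apply: (ok_conseq (Q := fun t s' => exists k, t + k <= 7 * d.+1 + 1 /\
   [/\ keep s', s'.1 xd = 0 & fin s'])); last first.
  move=> t s' [k [tk [[h1 h2 h3 h4 h5] h6 [h7 h8]]]]; split=> //; lia.
apply: (ok_while (I := I) (Q := fun _ s' => [/\ keep s', s'.1 xd = 0 & fin s'])); last first.
  by split; [split|exists d.+1; split; rewrite //= rf].
move=> k [r m'] /= [[/= [sV sC sB] sro sfr sM smono] [n [/= sd nd -> al]]].
split=> //=; rewrite sd.
  by move=> n0; move: al; rewrite n0 /= => fi; split; [lia|split=> //; split].
case: n sd nd al => [//|n] sd nd /= al _.
have [e eC se] := aug_stk al (leqnn n.+1).
have [w fE we] := aug_top al se; have wV := nb_var eC we.
apply: ok_seq; apply: ok_asg => /=; first lia.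
apply: ok_seq; apply: ok_get => //=; regs; rewrite sd ?subSS ?subn0; [lia|].
rewrite se; apply: ok_seq; apply: ok_set => //=; regs; rewrite ?fE; [lia|lia|].
apply: ok_seq; apply: ok_get => //=; regs; [lia|lia|].
apply: ok_seq; apply: ok_set => //=; regs; [lia|lia|].
apply: ok_asg => //=; regs; arrs; rewrite !subSS !subn0.
exists (7 * n + 1); split; first lia.
split.
  split=> //=; arrs.
  - by do 2!apply: readonly_upd => //.
  - move=> x xn; rewrite -sfr //; move: xn; rewrite !inE /upd.
    by do 4?[case: eqP => //= _].
  - by [].
  - by move=> x /smono; rewrite updE fE; case: (x =P e).
exists n; split=> //=; first lia.
arrs; case: n => [|n] in sd nd al se *.
  have ce : c = e by have := aug_stk0 al; rewrite se => -[].
  rewrite -ce /=; split=> /=; arrs.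
    by have := augment_last al; rewrite fE.
  by rewrite updE eqxx fE.
have := augment_step al se; by rewrite fE.
Qed.

Lemma ok_search c rg m : c < C -> base rg -> readonly m -> rg xc = c ->
  matching (arr B m aOwn) (arr B m aHome) -> arr B m aHome c = 0 ->
  (forall v, v < V -> arr B m aMark v <= c) ->
  ok W search (rg, m) (fun t s' => [/\ t <= 150 * V + 80, base s'.1, readonly s'.2,
    s'.1 xc = c & [/\ matching (arr B s'.2 aOwn) (arr B s'.2 aHome),
      arr B s'.2 aHome c != 0,
      forall e, arr B m aHome e != 0 -> arr B s'.2 aHome e != 0 &
      forall v, v < V -> arr B s'.2 aMark v <= c.+1]]).
Proof.
move=> cC [rV rC rB] ro rc mt hc mc.
apply: ok_seq; apply: ok_asg => /=; first lia.
apply: ok_seq; apply: ok_asg; first by rewrite /=; lia.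
apply: ok_seq; apply: ok_set => //=.
apply: ok_seq; apply: ok_asg; first by rewrite /=; lia.
regs; rewrite rc addn1 muln0 add0n /=; regs.
pose keep (s : state) := [/\ base s.1, readonly s.2 & s.1 xc = c].
pose fin (s : state) := [/\ matching (arr B s.2 aOwn) (arr B s.2 aHome),
      arr B s.2 aHome c != 0,
      forall e, arr B m aHome e != 0 -> arr B s.2 aHome e != 0 &
      forall v, v < V -> arr B s.2 aMark v <= c.+1].
(* A pop lowers [2 * unmarked + depth] by one, and so does a push, which marks one variable and adds
   one entry. What is left also covers the augmentation, linear in the depth. *)
pose I k (s : state) := keep s /\ if s.1 xd == 0 then fin s /\ k = 1 else
  [/\ s.1 xs = c.+1, arr B s.2 aHome = arr B m aHome,
      dfs c (s.1 xd) (arr B s.2 aOwn) (arr B s.2 aHome) (arr B s.2 aMark) (arr B s.2 aStk) &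
      k = 75 * (2 * unmarked c (arr B s.2 aMark) + s.1 xd) + 1].
apply: (ok_conseq (Q := fun t s' => exists k, t + k <= 150 * V + 76 /\
   (keep s' /\ fin s'))); last first.
  by move=> t s' [k [tk [[h1 h2 h3] [h4 h5 h6 h7]]]]; split=> //; lia.
set s0 : state := (_, _).
have dfs0 : dfs c 1 (arr B s0.2 aOwn) (arr B s0.2 aHome) (arr B s0.2 aMark) (arr B s0.2 aStk).
  rewrite /s0 /=; have -> : B + 5 = B + (8 * 0 + 5) by [].
  by arrs; apply: dfs_init.
have unV : unmarked c (arr B s0.2 aMark) <= V by have := dfs_cnt dfs0; lia.
apply: ok_conseq.
  apply: (ok_while (I := I) (n := 75 * (2 * unmarked c (arr B s0.2 aMark) + 1) + 1)
    (Q := fun _ s' => keep s' /\ fin s')); last first.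
    split.
      split=> //=; have -> : B + 5 = B + (8 * 0 + 5) by [].
      exact: readonly_upd.
    rewrite /=; regs; split=> //=; have -> : B + 5 = B + (8 * 0 + 5) by [].
    by arrs.
  move=> k [r m'] [[[/= sV sC sB] /= sro src] /= al].
  split=> //=; first by move=> d0; move: al; rewrite d0 /= => -[fi ->]; split.
  case dE : (r xd) al => [//|d] /= [rs hE df ->] _.
  have [e eC se] := dfs_stk df (leqnn d.+1).
  have dV : d <= V by have := dfs_cnt df; lia.
  apply: ok_seq; apply: ok_get => //=; rewrite ?dE; [lia|lia|].
  rewrite subSS subn0 se.
  apply: ok_seq; apply: ok_asg; first by rewrite /=; lia.
  apply: ok_seq; apply: ok_conseq (@ok_unmarked _ _ c e cC _ _ eC _ _ sro) _ => //.
  move=> t [r' m''] /= [t61 -> fr f0 fS].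
  have f x : x \notin [:: xp; xk; xu; xt; xf; xh] -> r' x = r x.
    rewrite !inE !negb_or => /and5P[n1 n2 n3 n4 /andP[n5 n6]].
    by rewrite fr ?inE ?negb_or ?n1 ?n2 ?n3 ?n4 ?n5 // !updE (negPf n5) (negPf n6).
  have fV : r' 0 = V by rewrite f.
  have fC : r' 1 = C by rewrite f.
  have fB : r' 2 = B by rewrite f.
  have fc : r' 4 = c by rewrite f.
  have fs : r' 15 = c.+1 by rewrite f.
  have fd : r' 12 = d.+1 by rewrite f.
  apply: ok_if => //=.
    case fE : (r' xf) => [//|v] _; have [ve mv] := fS _ fE.
    have vV := nb_var eC ve.
    have mv' : arr B m' aMark v != c.+1 by rewrite ltn_eqF.
    apply: ok_seq; apply: ok_set => //=; rewrite ?fE; [lia|lia|].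
    apply: ok_seq; apply: ok_get => //=; rewrite ?fE; [lia|lia|].
    rewrite subSS subn0 fs; arrs.
    apply: ok_if => //=; regs.
      case oE : (arr B m' aOwn v) => [//|e2] _.
      apply: ok_seq; apply: ok_set => //=; regs; rewrite ?fd; [lia|].
      apply: ok_asg => /=; regs; first by rewrite fd; lia.
      have df' := dfs_push df se ve vV mv' oE.
      have un' := unmarked_upd vV mv'.
      exists (75 * (2 * unmarked c (upd (arr B m' aMark) v c.+1) + d.+2) + 1).
      split; first lia.
      split; first by split=> //=; do 2!apply: readonly_upd => //.
      by rewrite /=; regs; rewrite fd addn1 /=; arrs; rewrite fs.
    move=> o0; have au := augment_init df se ve o0.
    apply: ok_conseq.
      apply: (@ok_augment c d v.+1) => //=; regs; arrs => //.
      exact: readonly_upd.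
    move=> t2 [r2 m2] /= [t2b ba2 ro2 fr2 [d2 mk2 mt2 hc2 mo2]].
    exists 1; split.
      by have := unmarked_upd vV mv'; lia.
    split; first by split=> //=; rewrite fr2.
    rewrite /= d2 /=; split=> //; split=> //.
      by move=> x hx; apply: mo2; move: hx; arrs; rewrite hE.
    move=> u uV; rewrite mk2; arrs; rewrite updE; case: eqP => // _.
    exact: dfs_mark df _ uV.
  move=> fE; have em u : u \in nb e -> arr B m' aMark u = c.+1.
    move=> ue; apply/eqP; rewrite eqn_leq (dfs_mark df (nb_var eC ue)).
    exact: f0.
  case: d => [|d] in dE df se dV fd *.
    have ce : c = e by have := dfs_stk0 df; rewrite se => -[].
    by exfalso; apply: (dfs_stuck df) => u uc; apply: em; rewrite -ce.
  apply: ok_asg => /=; first by lia.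
  exists (75 * (2 * unmarked c (arr B m' aMark) + d.+1) + 1); split; first lia.
  split; first by split.
  rewrite /=; regs; rewrite fd subSS subn0 /=; split=> //.
  exact: dfs_pop df se em.
move=> t s' [k [tk h]]; exists k; split=> //; lia.
Qed.

Definition unmatched n home := count (fun e => home e == 0) (iota n (C - n)).

Lemma ok_search_loop rg m : base rg -> readonly m ->
  matching (arr B m aOwn) (arr B m aHome) -> arr B m aMark = (fun=> 0) ->
  ok W search_loop (rg, m) (fun t s' =>
    [/\ t <= (150 * V + 100) * unmatched 0 (arr B m aHome) + 10 * C + 2, base s'.1,
      readonly s'.2, matching (arr B s'.2 aOwn) (arr B s'.2 aHome) &
      forall e, e < C -> arr B s'.2 aHome e != 0]).
Proof.
move=> [rV rC rB] ro mt mk0.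
pose fin (s : state) := forall e, e < C -> arr B s.2 aHome e != 0.
pose keep (s : state) := [/\ base s.1, readonly s.2 &
  matching (arr B s.2 aOwn) (arr B s.2 aHome)].
pose I k (s : state) := exists n, [/\ keep s, n <= C, s.1 xc = n,
  (forall e, e < n -> arr B s.2 aHome e != 0) /\
  (forall v, v < V -> arr B s.2 aMark v <= n) &
  k = (150 * V + 100) * unmatched n (arr B s.2 aHome) + 10 * (C - n) + 1].
apply: ok_seq; apply: ok_asg; first by rewrite /=; lia.
apply: (ok_conseq (Q := fun t s' => exists k,
  t + k <= (150 * V + 100) * unmatched 0 (arr B m aHome) + 10 * C + 1 /\
   (keep s' /\ fin s'))); last first.
  move=> t s' [k [tk [[h1 h2 h3] h4]]]; split=> //; lia.
apply: (ok_while (I := I) (Q := fun _ s' => keep s' /\ fin s')); last first.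
  exists 0; split=> //=; last by rewrite subn0.
  by split=> // v _; rewrite mk0.
move=> k [r m'] [n [[[/= sV sC sB] /= sro smt] nC /= sn [hn mn] ->]].
split=> //=; rewrite sC sn.
  move=> Cn; split; first lia; split; first by split.
  by have nE : n = C by [lia]; rewrite nE in hn.
move=> Cn; have nC' : n < C by lia.
have unE home : unmatched n home = (home n == 0) + unmatched n.+1 home.
  by rewrite /unmatched; have -> : C - n = (C - n.+1).+1 by lia.
apply: ok_seq; apply: ok_get => //=; first lia.
rewrite sn; apply: ok_seq; apply: ok_if => //=; regs => h0.
  apply: ok_skip; apply: ok_asg => /=; regs; first by rewrite sn; lia.
  exists ((150 * V + 100) * unmatched n.+1 (arr B m' aHome) + 10 * (C - n.+1) + 1).
  split; first by rewrite unE (negPf h0) add0n; lia.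
  exists n.+1; split=> //=; regs; rewrite ?sn ?addn1 //; split.
    by move=> e; rewrite ltnS leq_eqVlt => /orP[/eqP->|/hn].
  by move=> v /mn; apply: leqW.
apply: ok_conseq.
  by apply: (@ok_search n) => //=; regs.
move=> t [r2 m2] /= [tb [eV eC eB] ro2 c2 [mt2 hn2 mo2 mk2]].
apply: ok_asg => /=; first by rewrite c2; lia.
exists ((150 * V + 100) * unmatched n.+1 (arr B m2 aHome) + 10 * (C - n.+1) + 1).
have le : unmatched n.+1 (arr B m2 aHome) <= unmatched n.+1 (arr B m' aHome).
  by apply: sub_count => e /=; apply: contraTT; apply: mo2.
split.
  rewrite unE h0 eqxx mulnDr muln1.
  have := leq_mul (leqnn (150 * V + 100)) le; lia.
exists n.+1; split=> //=; regs; rewrite ?c2 ?addn1 //; split=> //.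
by move=> e; rewrite ltnS leq_eqVlt => /orP[/eqP->|/hn/mo2].
Qed.

Lemma ok_sign rg m e v : e < C -> base rg -> rg xh = e.+1 -> rg xv = v ->
  readonly m -> v \in nb e ->
  ok W (scan sign_body) (rg, m) (fun t s' => [/\ t <= 54, s'.2 = m,
    forall x, x \notin [:: xp; xk; xu; xo] -> s'.1 x = rg x & (v, s'.1 xo) \in ls e]).
Proof.
move=> eC [rV rC rB] rh rv ro ve.
have vV := nb_var eC ve.
pose J i (r : nat -> nat) := [/\ forall x, x \notin [:: xp; xk; xu; xo] -> r x = rg x &
    forall j, j < i -> (nth (0, 0) (ls e) j).1 = v -> (v, r xo) \in ls e].
apply: ok_conseq (@ok_scan _ 2 J _ _ _ eC rB rh ro _ _ _) _.
- move=> i r r' rr [h1 h2]; split.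
  + move=> x xn; rewrite rr ?h1 //; apply: contra xn; rewrite !inE.
    by case/or3P => ->; rewrite ?orbT.
  + by move=> j ji; rewrite rr //; apply: h2 ji.
- move=> i r iN [h1 h2] ru rp.
  have lin := mem_nth (0, 0) iN.
  have uV : r xu < V by rewrite ru; apply: ls_var eC lin.
  have rv' : r xv = v by rewrite h1.
  have aoff : off e + 2 + 2 * i < off C.
    have := off_mono eC (leqnn C); rewrite offS //.
    by have := ls_size eC; lia.
  apply: ok_if => /=; rewrite rv'; first lia.
    move=> ne; apply: ok_skip; split=> //; split=> // j.
    rewrite ltnS leq_eqVlt => /orP[/eqP->|]; last exact: h2.
    by rewrite -ru => uv; rewrite uv subnn in ne.
  move=> eq0; apply: ok_asg => /=; first by rewrite rp; lia.
  have uv : r xu = v by lia.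
  have -> : m (r 6 + 1) = (nth (0, 0) (ls e) i).2.
    have -> : r 6 + 1 = off e + 2 + 2 * i by rewrite rp; lia.
    by rewrite (proj1 ro) // (proj2 (ls_mem eC iN)).
  split=> //; split=> /=; regs.
  + by move=> x xn; rewrite -h1 //; move: xn; rewrite !inE /upd; do 4?[case: eqP => //= _].
  + by move=> j _ _; rewrite -uv ru -surjective_pairing.
- by split.
move=> t s' [tt -> [h1 h2]]; split=> //.
have /(nthP 0)[j] := ve; rewrite size_map => jN; rewrite (nth_map (0, 0)) // => jv.
exact: h2 jN jv.
Qed.

Definition signs (own out : nat -> nat) n := forall v, v < n ->
  (own v = 0 -> out v = 0) /\ (forall e, own v = e.+1 -> (v, out v) \in ls e).

Lemma ok_out rg m home : base rg -> readonly m -> matching (arr B m aOwn) home ->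
  ok W out_loop (rg, m) (fun t s' => [/\ t <= 70 * V + 2, base s'.1 &
    signs (arr B m aOwn) (arr B s'.2 aOut) V]).
Proof.
move=> [rV rC rB] ro [m1 _].
pose keep (s : state) := [/\ base s.1, readonly s.2 & arr B s.2 aOwn = arr B m aOwn].
pose fin n (s : state) := signs (arr B m aOwn) (arr B s.2 aOut) n.
pose I k (s : state) := exists n, [/\ keep s, n <= V, s.1 xv = n, fin n s &
  k = 70 * (V - n) + 1].
apply: ok_seq; apply: ok_asg; first by rewrite /=; lia.
apply: (ok_conseq (Q := fun t s' => exists k, t + k <= 70 * V + 1 /\
   (keep s' /\ fin V s'))); last first.
  by move=> t s' [k [tk [[h1 h2 h3] h4]]]; split=> //; lia.
apply: (ok_while (I := I) (Q := fun _ s' => keep s' /\ fin V s')); last first.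
  by exists 0; split=> //=; rewrite subn0.
move=> k [r m'] [n [[[/= sV sC sB] /= sro sO] nV /= sn fi ->]].
split=> //=; rewrite sV sn.
  move=> Vn; split; first lia; split; first by split.
  by have nE : n = V by [lia]; rewrite nE in fi.
move=> Vn; have nV' : n < V by lia.
apply: ok_seq; apply: ok_get => //=; first lia.
apply: ok_seq; apply: ok_asg; first by rewrite /=; lia.
rewrite /= sO sn.
have finish t1 r1 : t1 <= 60 -> base r1 -> r1 xv = n ->
    (arr B m aOwn n = 0 -> r1 xo = 0) ->
    (forall e, arr B m aOwn n = e.+1 -> (n, r1 xo) \in ls e) ->
    ok W (arr_set aOut (EVar xv) (EVar xo) ;; CAsg xv (succ_exp xv))%cmd (r1, m')
      (fun t2 s2 => exists k', 1 + (1 + (t1 + t2)) + k' < 70 * (V - n) + 1 /\ I k' s2).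
  move=> t1b [eV eC eB] rv o0 oS.
  apply: ok_seq; apply: ok_set => //=; rewrite ?rv; first lia.
  apply: ok_asg => /=; first by rewrite rv; lia.
  exists (70 * (V - n.+1) + 1); split; first lia.
  exists n.+1; split=> //=; regs; rewrite ?rv ?addn1 //.
    by split=> //=; [apply: readonly_upd|arrs].
  rewrite /fin /=; arrs => v; rewrite ltnS leq_eqVlt updE => /orP[/eqP->|vn].
    by rewrite eqxx.
  by rewrite ltn_eqF //; apply: fi.
apply: ok_seq; apply: ok_if => //=; regs.
  case oE : (arr B m aOwn n) => [//|e] _.
  have [eC ne _] := m1 _ _ nV' oE.
  apply: ok_conseq (@ok_sign _ m' e n eC _ _ _ sro ne) _ => //.
  move=> t [r1 m1'] /= [tb -> fr inl]; apply: finish.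
  - lia.
  - by split; rewrite fr.
  - by rewrite fr.
  - by rewrite oE.
  - by move=> e'; rewrite oE => -[<-].
move=> o0; apply: ok_skip; apply: finish => //.
by rewrite o0.
Qed.

Lemma ok_copy rg m : base rg -> ok W copy_loop (rg, m) (fun t s' =>
  t <= 5 * V + 2 /\ forall v, v < V -> s'.2 v = arr B m aOut v).
Proof.
move=> [rV rC rB].
pose keep (s : state) := base s.1 /\ arr B s.2 aOut = arr B m aOut.
pose fin n (s : state) := forall v, v < n -> s.2 v = arr B m aOut v.
pose I k (s : state) := exists n, [/\ keep s, n <= V, s.1 xv = n, fin n s &
  k = 5 * (V - n) + 1].
apply: ok_seq; apply: ok_asg; first by rewrite /=; lia.
apply: (ok_conseq (Q := fun t s' => exists k, t + k <= 5 * V + 1 /\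
   (keep s' /\ fin V s'))); last first.
  by move=> t s' [k [tk [h1 h2]]]; split=> //; lia.
apply: (ok_while (I := I) (Q := fun _ s' => keep s' /\ fin V s')); last first.
  by exists 0; split=> //=; rewrite subn0.
move=> k [r m'] [n [[[/= sV sC sB] /= sO] nV /= sn fi ->]].
split=> //=; rewrite sV sn.
  move=> Vn; split; first lia; split; first by split.
  by have nE : n = V by [lia]; rewrite nE in fi.
move=> Vn; have nV' : n < V by lia.
apply: ok_seq; apply: ok_get => //=; first lia.
apply: ok_seq; apply: ok_sto => //=; regs; rewrite sO sn.
apply: ok_asg => /=; regs; first by rewrite sn; lia.
exists (5 * (V - n.+1) + 1); split; first lia.
exists n.+1; split=> //=; regs; rewrite ?sn ?addn1 //.
  split=> //=; rewrite -sO; apply: funext => i; rewrite /arr /upd gtn_eqF //.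
  by rewrite /B; lia.
move=> v; rewrite ltnS leq_eqVlt /= updE => /orP[/eqP->|vn]; first by rewrite eqxx.
by rewrite ltn_eqF //; apply: fi.
Qed.

(** * Initialisation and the complete solver *)

Hypothesis m0_V : m0 0 = V.
Hypothesis m0_C : m0 1 = C.
Hypothesis m0_high : forall a, off C <= a -> m0 a = 0.

Lemma off_le c : c <= C -> off c <= off C. Proof. by move=> cC; apply: off_mono. Qed.

Lemma ok_skip_clause c rg m (Q : nat -> state -> Prop) : c < C -> rg xp = off c ->
  m (off c) = m0 (off c) ->
  Q 2 (upd (upd rg xt (m0 (off c))) xp (off c.+1), m) -> ok W skip_clause (rg, m) Q.
Proof.
move=> cC rp mE q; have := off_le cC; rewrite offS // => oC.
apply: ok_seq; apply: ok_asg => //=; rewrite rp mE.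
apply: ok_asg => /=; regs; first by rewrite rp; lia.
move: q; rewrite offS // rp; congr (Q 2 (upd _ _ _, _)); lia.
Qed.

Lemma ok_length rg : rg xV = V -> rg xC = C ->
  ok W length_loop (rg, m0) (fun t s' => [/\ t <= 4 * C + 3, s'.2 = m0,
    s'.1 xV = V, s'.1 xC = C & s'.1 xp = off C]).
Proof.
move=> rV rC.
pose I k (s : state) := exists n, [/\ s.2 = m0, s.1 xV = V, s.1 xC = C, n <= C &
  [/\ s.1 xc = C - n, s.1 xp = off n & k = 4 * (C - n) + 1]].
apply: ok_seq; apply: ok_asg; first by rewrite /=; lia.
apply: ok_seq; apply: ok_asg => //=; regs; rewrite rC.
apply: (ok_conseq (Q := fun t s' => exists k, t + k <= 4 * C + 1 /\
   [/\ s'.2 = m0, s'.1 xV = V, s'.1 xC = C & s'.1 xp = off C])); last first.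
  by move=> t s' [k [tk [h1 h2 h3 h4]]]; split=> //; lia.
apply: (ok_while (I := I) (Q := fun _ s' =>
   [/\ s'.2 = m0, s'.1 xV = V, s'.1 xC = C & s'.1 xp = off C])); last first.
  by exists 0; split=> //=; regs; rewrite subn0 off0.
move=> k [r m'] [n [/= -> sV sC nC [sc sp ->]]].
split=> //=; rewrite sc.
  move=> Cn; split; first lia; split=> //; rewrite sp; congr off; lia.
move=> Cn; have nC' : n < C by lia.
apply: ok_seq; apply: (ok_skip_clause nC') => //.
apply: ok_asg => /=; first by lia.
regs; exists (4 * (C - n.+1) + 1); split; first lia.
exists n.+1; split=> //=; regs; split=> //; rewrite sc; lia.
Qed.

Lemma ok_start rg : base rg ->
  ok W start_loop (rg, m0) (fun t s' => [/\ t <= 5 * C + 3, base s'.1, readonly s'.2 &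
    forall k, 0 < k < 8 -> arr B s'.2 k = (fun=> 0)]).
Proof.
move=> [rV rC rB].
have arr0 k : arr B m0 k = (fun=> 0).
  by apply: funext => i; apply: m0_high; rewrite /B; lia.
pose inv n (s : state) := [/\ base s.1, forall a, a < off C -> s.2 a = m0 a,
  forall c, c < n -> arr B s.2 aStart c = off c &
  forall k, 0 < k < 8 -> arr B s.2 k = (fun=> 0)].
pose I k (s : state) := exists n, [/\ inv n s, n <= C, s.1 xc = n, s.1 xp = off n &
  k = 5 * (C - n) + 1].
apply: ok_seq; apply: ok_asg; first by rewrite /=; lia.
apply: ok_seq; apply: ok_asg; first by rewrite /=; lia.
apply: (ok_conseq (Q := fun t s' => exists k, t + k <= 5 * C + 1 /\ inv C s')); last first.
  by move=> t s' [k [tk [h1 h2 h3 h4]]]; split=> //; lia.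
apply: (ok_while (I := I) (Q := fun _ s' => inv C s')); last first.
  by exists 0; split=> //=; regs; rewrite ?subn0 ?off0.
move=> k [r m'] [n [[[/= sV sC sB] /= low st zz] nC /= sn sp ->]].
split=> //=; rewrite sC sn.
  move=> Cn; split; first lia.
  by have nE : n = C by [lia]; rewrite nE in st; split.
move=> Cn; have nC' : n < C by lia.
apply: ok_seq; apply: ok_set => //=; rewrite ?sn; first lia.
have ooff : off n < off C by have := off_le nC'; rewrite offS //; lia.
apply: ok_seq; apply: (ok_skip_clause nC') => //.
  by rewrite low_upd ?low // /B; lia.
apply: ok_asg => /=; regs; first by rewrite sn; lia.
exists (5 * (C - n.+1) + 1); split; first lia.
exists n.+1; split=> //=; regs; rewrite ?sn ?addn1 //.
split=> //=.
- by move=> a aC; rewrite low_upd ?low // /B; lia.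
- arrs => c; rewrite ltnS leq_eqVlt updE => /orP[/eqP->|cn]; first by rewrite eqxx.
  by rewrite ltn_eqF //; apply: st.
- by move=> k' k8; rewrite arr_upd_other ?zz //; lia.
Qed.

Lemma ok_sqrt rg m : base rg ->
  ok W sqrt_loop (rg, m) (fun t s' => [/\ t <= 3 * V + 3, s'.2 = m, base s'.1 &
    [/\ V <= s'.1 xL * s'.1 xL, s'.1 xL <= V &
        s'.1 xL = 0 \/ (s'.1 xL).-1 * (s'.1 xL).-1 < V]]).
Proof.
move=> [rV rC rB].
pose inv (s : state) := [/\ s.2 = m, base s.1, s.1 xL <= V, s.1 xt = s.1 xL * s.1 xL &
  s.1 xL = 0 \/ (s.1 xL).-1 * (s.1 xL).-1 < V].
pose I k (s : state) := inv s /\ k = 3 * (V - s.1 xt) + 1.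
apply: ok_seq; apply: ok_asg; first by rewrite /=; lia.
apply: ok_seq; apply: ok_asg; first by rewrite /=; lia.
apply: (ok_conseq (Q := fun t s' => exists k, t + k <= 3 * V + 1 /\
  (inv s' /\ V <= s'.1 xt))); last first.
  move=> t s' [k [tk [[h1 h2 h3 h4 h5] h6]]]; split=> //; first lia.
  by rewrite -h4.
apply: (ok_while (I := I) (Q := fun _ s' => inv s' /\ V <= s'.1 xt)); last first.
  by split=> /=; [split=> //=; left|regs; rewrite subn0].
move=> k [r m'] [[/= -> [sV sC sB] sL st so] ->].
split=> //=; rewrite sV.
  by move=> Vt; split; [lia|split; [|lia]].
move=> Vt; have LL : r xL <= r xL * r xL by case: (r xL) => // n; rewrite leq_pmull.
apply: ok_seq; apply: ok_asg => /=; first by lia.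
apply: ok_asg => /=; regs; first by lia.
have tE : r 11 + 1 + (r 3 + r 3) = (r 3 + 1) * (r 3 + 1) by rewrite st; lia.
exists (3 * (V - (r 11 + 1 + (r 3 + r 3))) + 1); split; first lia.
split=> //; split=> //=; regs.
- by lia.
- by right; rewrite addn1 /=; lia.
Qed.

Theorem ok_solver : ok W solver (fun=> 0, m0) (fun t s' => exists L, [/\
  t <= 90 * (L * V) + (150 * V + 100) * L + 200 * (V + C) + 100,
  L = 0 \/ L.-1 * L.-1 < V &
  exists own home sg, [/\ matching own home, forall e, e < C -> home e != 0,
    signs own sg V & forall v, v < V -> s'.2 v = sg v]]).
Proof.
(* For [V = 0] the label limit is 0, and the estimate of unmatched clauses by level sets is void. *)
have V0 : V = 0 -> C = 0.
  move=> V0; case: (posnP C) => // C0.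
  have : size [:: 0] <= size ([::] : seq nat).
    apply: hall => // c; rewrite inE => /eqP->; split=> // u /(nb_var C0).
    by rewrite V0.
  by [].
apply: ok_seq; apply: ok_asg; first by rewrite /=; lia.
apply: ok_seq; apply: ok_asg; first by rewrite /=; lia.
rewrite /= m0_V m0_C.
apply: ok_seq; apply: ok_conseq; first by apply: ok_length.
move=> t1 [r1 m1] /= [t1b -> r1V r1C r1p].
apply: ok_seq; apply: ok_asg => /=; first by rewrite r1p r1V -/B; lia.
rewrite r1p r1V -/B.
apply: ok_seq; apply: ok_conseq; first by apply: ok_start.
move=> t2 [r2 m2] /= [t2b b2 ro2 zz].
apply: ok_seq; apply: ok_conseq; first by apply: ok_sqrt.
move=> t3 [r3 m3] /= [t3b -> [eV eC eB] [LL LV Lo]].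
set L := r3 3 in LL LV Lo.
have L_le : L <= V + 2 by lia.
apply: ok_seq; apply: ok_conseq.
  by apply: (@ok_auction L L_le); [split|exact: ro2|exact: zz|exact: zz].
move=> t4 [r4 m4] /= [t4b [e4V e4C e4B e4L] ro4 [H4 M4 au]].
apply: ok_seq; apply: ok_conseq.
  apply: ok_home => //.
  - by rewrite H4; apply: zz.
  - by move=> v d vV /(auction_own au vV)[].
  - exact: auction_inj au.
move=> t5 [r5 m5] /= [t5b b5 ro5 M5 [own5 mt5]].
apply: ok_seq; apply: ok_conseq.
  by apply: ok_search_loop => //; rewrite M5 M4; apply: zz.
move=> t6 [r6 m6] /= [t6b b6 ro6 mt6 h6].
apply: ok_seq; apply: ok_conseq; first by apply: (ok_out b6 ro6 mt6).
move=> t7 [r7 m7] /= [t7b b7 sg7].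
apply: ok_conseq; first by apply: ok_copy.
move=> t8 [r8 m8] /= [t8b out8].
exists L; split=> //; last by exists (arr B m6 aOwn), (arr B m6 aHome), (arr B m7 aOut).
(* The level sets give [L * unmatched <= V], and [V <= L * L]. *)
have un : unmatched 0 (arr B m5 aHome) <= L.
  have h : L * unmatched 0 (arr B m5 aHome) <= V.
    rewrite /unmatched -size_filter; apply: (auction_unmatched au).
      by rewrite filter_uniq ?iota_uniq.
    move=> d; rewrite mem_filter mem_iota subn0 add0n => /andP[/eqP hd dC].
    split=> // v vV; apply/eqP; rewrite -own5 => od.
    by have [_ _] := mt5.1 v d vV od; rewrite hd.
  have [V0'|V0'] := posnP V.
    by rewrite /unmatched V0.
  have L0 : 0 < L by case: (posnP L) => // L0; rewrite L0 in LL; lia.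
  by rewrite -(leq_pmul2l L0); apply: leq_trans h LL.
have := leq_mul (leqnn (150 * V + 100)) un; lia.
Qed.

End Correctness.

(** * Formulas and the running time *)

Section Encoding.
Local Arguments encode_clause {m} c : simpl never.
Variable phi : cnf.
Local Notation V := (nvars phi).
Local Notation C := (nclauses phi).
Local Notation cl := (nth [::] (clauses phi)).
Local Notation m0 := (nth 0 (encode phi)).

Definition clause_off c :=
  (size (flatten (map (@encode_clause V) (take c (clauses phi))))).+2.
Definition short_clause c : seq (nat * nat) :=
  [seq (nat_of_ord l.1, nat_of_bool l.2) | l <- take 7 (cl c)].

Lemma encode_clause_nth c i : c < C -> i < size (encode_clause (cl c)) ->
  m0 (clause_off c + i) = nth 0 (encode_clause (cl c)) i.
Proof.
move=> cC ic; rewrite /encode /clause_off addSn addSn /=.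
rewrite -{1}(cat_take_drop c (clauses phi)) (drop_nth [::]) // map_cat flatten_cat.
rewrite nth_cat ltnNge leq_addr addKn.
change (nth 0 (encode_clause (cl c) ++
  flatten (map (@encode_clause V) (drop c.+1 (clauses phi)))) i
  = nth 0 (encode_clause (cl c)) i).
by rewrite nth_cat ic.
Qed.

Lemma size_encode_clause (c : seq (literal V)) :
  size (encode_clause c) = 1 + 2 * size c.
Proof. by rewrite /encode_clause /=; elim: c => //= l c; lia. Qed.

Lemma encode_literals_nth (c : seq (literal V)) l0 i : i < size c ->
  (nth 0 (encode_clause c) (1 + 2 * i) = (nth l0 c i).1) *
  (nth 0 (encode_clause c) (2 + 2 * i) = (nth l0 c i).2).
Proof.
elim: c i => // l c IH [|i] ic //; have -> : 1 + 2 * i.+1 = (1 + 2 * i).+2 by lia.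
have -> : 2 + 2 * i.+1 = (2 + 2 * i).+2 by lia.
exact: IH i ic.
Qed.

Lemma clause_size c : c < C -> m0 (clause_off c) = size (cl c).
Proof. by move=> cC; rewrite -[clause_off c]addn0 encode_clause_nth. Qed.

Lemma clause_offS c : c < C ->
  clause_off c.+1 = clause_off c + 1 + 2 * m0 (clause_off c).
Proof.
move=> cC; rewrite clause_size // /clause_off (take_nth [::]) // map_rcons.
rewrite -cats1 flatten_cat size_cat.
have -> : flatten [:: encode_clause (cl c)] = encode_clause (cl c) by exact: cats0.
by rewrite size_encode_clause; lia.
Qed.

Lemma size_clause_le c : c < C -> size (cl c) <= 2 * V.
Proof.
move=> cC; have /allP/(_ (cl c)) u := clauses_uniq phi.
have {}u := u (mem_nth _ cC).
rewrite -(card_uniqP u); apply: leq_trans (max_card _) _.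
by rewrite card_prod card_ord card_bool mulnC.
Qed.

(** A quadratic bound suffices: it only has to make addresses fit into O(log n) bits, as no loop
    runs through the whole encoding. *)
Lemma clause_off_le c : c <= C -> clause_off c <= 2 + c * (1 + 4 * V).
Proof.
elim: c => [|c IH] cC; first by rewrite /clause_off take0.
rewrite clause_offS // clause_size //; have := size_clause_le cC.
by have := IH (ltnW cC); lia.
Qed.

Lemma short_clause_size c : c < C ->
  minn (m0 (clause_off c)) 7 = size (short_clause c).
Proof. by move=> cC; rewrite clause_size // size_map size_take; case: ltnP; lia. Qed.

Lemma short_clause_mem c i : c < C -> i < size (short_clause c) ->
  m0 (clause_off c + 1 + 2 * i) = (nth (0, 0) (short_clause c) i).1 /\
  m0 (clause_off c + 2 + 2 * i) = (nth (0, 0) (short_clause c) i).2.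
Proof.
move=> cC; rewrite size_map => ic.
have /andP[i7 ic'] : (i < 7) && (i < size (cl c)).
  by move: ic; rewrite size_take_min leq_min.
have [l0 _] : exists l0 : literal V, True by case: (cl c) ic' => // l; exists l.
rewrite (nth_map l0) // nth_take // -!addnA.
by split; rewrite encode_clause_nth ?size_encode_clause ?(encode_literals_nth l0) //; lia.
Qed.

Lemma encode_high a : clause_off C <= a -> m0 a = 0.
Proof.
by move=> ca; apply: nth_default; move: ca; rewrite /clause_off take_size.
Qed.

Lemma encode_bound n i : V <= n -> C <= n -> 2 * V <= n -> 1 <= n -> m0 i <= n.
Proof.
move=> Vn Cn V2n n1; suff /allP h : all (fun x => x <= n) (encode phi).
  have [ii|ii] := ltnP i (size (encode phi)); first by apply: h; apply: mem_nth.
  by rewrite nth_default.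
rewrite /= Vn Cn /=; apply/allP => x /flattenP[_ /mapP[c cP ->]].
rewrite inE => /orP[/eqP->|/flattenP[_ /mapP[l _ ->]]].
  have /(nthP [::])[j jC <-] := cP; exact: leq_trans (size_clause_le jC) V2n.
rewrite !inE => /orP[]/eqP->; first exact: leq_trans (ltnW (ltn_ord _)) Vn.
exact: leq_trans (leq_b1 _) n1.
Qed.

Definition short_vars (j : 'I_C) : {set 'I_V} :=
  finset (fun v : 'I_V => nat_of_ord v \in unzip1 (short_clause j)).

Lemma short_varsP (j : 'I_C) (v : 'I_V) :
  reflect (exists2 l, l \in take 7 (clause j) & l.1 = v) (v \in short_vars j).
Proof.
rewrite inE /unzip1 -map_comp; apply: (iffP mapP) => -[l ll lv].
  by exists l => //; apply: val_inj.
by exists l => //=; rewrite lv.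
Qed.

Lemma short_vars_sub j : short_vars j \subset clause_vars j.
Proof.
apply/fintype.subsetP => v /short_varsP[l ll <-].
by apply/imsetP; exists l => //; apply: mem_take ll.
Qed.

(** Three variables have only six literals, so seven distinct literals need a fourth variable. *)
Lemma short_vars_ge4 j : 4 <= #|clause_vars j| -> 4 <= #|short_vars j|.
Proof.
have [le7|gt7] := leqP (size (clause j)) 7.
  move=> h; apply: leq_trans h _; apply: subset_leq_card; apply/fintype.subsetP => v.
  by move=> /imsetP[l ll ->]; apply/short_varsP; exists l => //; rewrite take_oversize.
move=> _; have u : uniq (take 7 (clause j)).
  by apply: take_uniq; apply: (allP (clauses_uniq phi)); apply: mem_nth.
have : 7 <= #|finset.setX (short_vars j) [set: bool]%SET|.
  have <- : size (take 7 (clause j)) = 7 by rewrite size_take gt7.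
  rewrite -(card_uniqP u); apply: subset_leq_card; apply/fintype.subsetP => -[v b] vb.
  by rewrite finset.in_setX finset.in_setT andbT; apply/short_varsP; exists (v, b).
rewrite cardsX cardsT card_bool; lia.
Qed.

Lemma short_hall (R : realType) : planar R (incidence phi) ->
  (forall j : 'I_C, 4 <= #|clause_vars j|) -> forall S T : seq nat, uniq S ->
  (forall c, c \in S -> c < C /\ {subset unzip1 (short_clause c) <= T}) ->
  size S <= size T.
Proof.
move=> pl h4 S T uS ST.
pose S' : {set 'I_C} := finset (fun j : 'I_C => nat_of_ord j \in S).
have hS := planar_hall pl short_vars_sub (fun j => short_vars_ge4 (h4 j)) S'.
apply: (@leq_trans #|S'|).
  rewrite cardE -(size_map (@nat_of_ord C)); apply: uniq_leq_size => // c cS.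
  have [cC _] := ST c cS; apply/mapP; exists (Ordinal cC) => //.
  by rewrite mem_enum inE.
apply: leq_trans hS _; rewrite cardE -(size_map (@nat_of_ord V)).
apply: uniq_leq_size; first by rewrite map_inj_uniq ?enum_uniq //; apply: val_inj.
move=> _ /mapP[v + ->]; rewrite mem_enum => /bigcupP[j].
rewrite !inE => jS vj; have [_] := ST _ jS; exact.
Qed.

End Encoding.

(** * Asymptotics of the running time *)

Section Time.
Local Open Scope classical_set_scope.
Local Open Scope ring_scope.

(** The factor 40 is the number of machine steps per tick in [solver_wf], and [r] bounds the label
    limit; the rest is the tick count of [ok_solver] with [n] for the numbers of variables and
    clauses. *)
Definition time_bound (R : realType) (n : nat) : nat :=
  let r := (Num.truncn (Num.sqrt (n%:R : R))).+2 in
  (40 * (90 * (r * n) + (150 * n + 100) * r + 200 * n + 100))%N.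

Lemma time_boundO (R : realType) :
  (fun n : nat => (time_bound R n)%:R : R) =O_\oo
  (fun n : nat => (n%:R : R) `^ (3 / 2)).
Proof.
apply/eqOP; near=> k; near=> n.
have n1 : (1 <= n)%N by near: n; exists 1%N.
have N1 : (1 <= n%:R :> R)%R by rewrite ler1n.
pose q : R := Num.sqrt n%:R.
have q2 : (q * q = n%:R)%R by rewrite -expr2 sqr_sqrtr // ler0n.
have q1 : (1 <= q)%R by rewrite -sqrtr1 ler_wsqrtr.
have -> : ((n%:R : R) `^ (3 / 2) = n%:R * q)%R.
  have -> : (3 / 2 = 1 + 2^-1 :> R)%R by field.
  rewrite powRD; last by rewrite implybE pnatr_eq0 -lt0n n1 orbT.
  by rewrite powRr1 ?powR12_sqrt ?ler0n.
rewrite !ger0_norm ?mulr_ge0 ?ler0n //; last by lra.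
have rq : ((Num.truncn q).+2%:R <= 3 * q :> R)%R.
  have /andP[tq _] := truncn_itv (le_trans ler01 q1).
  by rewrite -!natr1; lra.
have nq : (n%:R <= n%:R * q :> R)%R by rewrite ler_peMr // ler0n.
have nrq : (n%:R * (Num.truncn q).+2%:R <= n%:R * q * 3 :> R)%R.
  by rewrite -mulrA ler_wpM2l ?ler0n // mulrC.
(* Since [r <= 3 * q], and [q], [n] and [1] are at most [n * q], the sum is at most
   [52800 * n * q]. *)
apply: (@le_trans _ _ (60 * 1000 * (n%:R * q))%R); last first.
  apply: ler_wpM2r; first by rewrite mulr_ge0 ?ler0n //; lra.
  by near: k; apply: nbhs_pinfty_ge; rewrite num_real.
rewrite /time_bound -/q; move: (Num.truncn q).+2 rq nrq => r rq nrq.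
rewrite !(natrM, natrD).
have -> : (40%:R * (90%:R * (r%:R * n%:R) + (150%:R * n%:R + 100%:R) * r%:R + 200%:R * n%:R + 100%:R)
  = 9600 * (n%:R * r%:R) + 4000 * r%:R + 8000 * n%:R + 4000 :> R)%R by ring.
have qn : (q <= n%:R * q :> R)%R by rewrite ler_peMl //; lra.
lra.
Unshelve. all: by end_near. Qed.

End Time.

(** Registers 0 to 15 are the program variables [xV] to [xs]. *)
Definition solver_program : program := rcons (compile 16 0 solver) IHalt.

Lemma solver_wf : wf 16 40 solver.
Proof. by vm_compute. Qed.

(** Of the factor 20, two units yield the square of [n.+1]; the other eighteen give at least 18 bits
    for the constant 300. *)
Lemma word_size_big n : 300 * (n.+1 * n.+1) < 2 ^ word_size 20 n.
Proof.
rewrite /word_size; set x := (trunc_log 2 n).+1.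
have xn : n.+1 <= 2 ^ x by apply: trunc_log_ltn.
have -> : 20 * x = x + x + 18 * x by lia.
rewrite !expnD mulnC; apply: (@leq_trans (n.+1 * n.+1 * 2 ^ 18)).
  by rewrite ltn_pmul2l.
by rewrite leq_mul ?leq_mul // leq_exp2l // /x; lia.
Qed.

Theorem solver_correct (R : realType) (phi : cnf) :
  planar R (incidence phi) ->
  (forall j : 'I_(nclauses phi), 4 <= #|clause_vars j|) ->
  exists (a : assignment phi) (t : nat) (s : config),
    [/\ halts_in (word_size 20 #|ivertex phi|) solver_program (encode phi) t s,
        t <= time_bound R #|ivertex phi|, outputs s a & satisfies a].
Proof.
move=> pl h4.
have nE : #|ivertex phi| = nvars phi + nclauses phi by rewrite card_sum !card_ord.
set n := #|ivertex phi| in nE *; set V := nvars phi in nE; set C := nclauses phi in nE.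
have W1 := word_size_big n; set w := word_size 20 n in W1 *.
have oC := @clause_off_le phi C (leqnn C).
have CV : C * (1 + 4 * V) <= 5 * (n.+1 * n.+1).
  have : C * V <= n * n by apply: leq_mul; lia.
  lia.
have nn : n.+1 <= n.+1 * n.+1 by rewrite leq_pmulr.
have ib i : nth 0 (encode phi) i < 2 ^ w.
  apply: leq_ltn_trans (@encode_bound phi (2 * n + 1) i _ _ _ _) _; rewrite -/V -/C; lia.
have Wb : clause_off phi C + V + 8 * (V + C) + 200 < 2 ^ w by lia.
have [] := ok_halts solver_wf ib (@ok_solver (2 ^ w) V C (clause_off phi) (short_clause phi)
   (nth 0 (encode phi)) (@short_clause_size phi) (@short_clause_mem phi) _
   (@clause_offS phi) _ Wb (short_hall pl h4) erefl erefl (@encode_high phi)).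
- by rewrite /clause_off take0.
- move=> c l cC /mapP[l' _ ->]; exact: ltn_ord.
move=> t [s [[L [tb Lb [own [home [sg [mt hC sgP out]]]]]] [N [f [hN [NK fE]]]]]].
have sg_bool (v : 'I_V) : sg v = nat_of_bool (sg v == 1).
  have [s0 sS] := sgP v (ltn_ord v); case ov : (own v) => [|e]; first by rewrite s0.
  by have /mapP[l _ [_ ->]] := sS e ov; case: (l.2).
exists (fun v => sg v == 1), N, f; split=> //.
- apply: leq_trans NK _; rewrite /time_bound leq_mul2l /=.
  set r := (Num.truncn _).+2.
  have Lr : L <= r.
    case: Lb => [->//|Lb].
    rewrite /r; case: L Lb {tb} => // L /= Lb; apply: ltnW; rewrite ltnS.
    have : (L%:R < (Num.truncn (Num.sqrt (n%:R : R))).+1%:R :> R)%R.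
      have /andP[_ h] := truncn_itv (sqrtr_ge0 (n%:R : R)); apply: le_lt_trans h.
      rewrite -[X in (X <= _)%R]ger0_norm ?ler0n // -sqrtr_sqr ler_wsqrtr //.
      by rewrite -natrX ler_nat expnS expn1; lia.
    by rewrite ltr_nat ltnS.
  have Vn : V <= n by lia.
  have h1 : L * V <= r * n by apply: leq_mul.
  have h2 : (150 * V + 100) * L <= (150 * n + 100) * r by apply: leq_mul => //; lia.
  lia.
- by move=> v; rewrite fE out ?ltn_ord // {1}sg_bool.
- move=> j; have := hC j (ltn_ord j); case hj : (home j) => [//|v] _.
  have [vV ov] := mt.2 _ _ (ltn_ord j) hj.
  have /mapP[l ll [lv ls]] := (sgP v vV).2 _ ov.
  exists l; first exact: mem_take ll.
  by have := sg_bool l.1; rewrite -lv ls; case: (l.2).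
Qed.

Local Open Scope classical_set_scope.
Local Open Scope ring_scope.

Theorem theorem16 (R : realType) :
  (forall phi : cnf,
     planar R (incidence phi) ->
     (forall j : 'I_(nclauses phi), (4 <= #|clause_vars j|)%N) ->
     exists a : assignment phi, satisfies a)
  /\
  (exists (p : program) (k : nat) (T : nat -> nat),
     (forall phi : cnf,
        planar R (incidence phi) ->
        (forall j : 'I_(nclauses phi), (4 <= #|clause_vars j|)%N) ->
        exists (a : assignment phi) (t : nat) (s : config),
          [/\ halts_in (word_size k #|ivertex phi|) p (encode phi) t s,
              (t <= T #|ivertex phi|)%N,
              outputs s a
            & satisfies a])
     /\ (fun n : nat => (T n)%:R : R) =O_\oo
        (fun n : nat => (n%:R : R) `^ (3 / 2))).
Proof.
split=> [phi pl h4|].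
  by have [a [t [s [_ _ _ sat]]]] := solver_correct pl h4; exists a.
exists solver_program, 20, (time_bound R); split; last exact: time_boundO.
by move=> phi; apply: solver_correct.
Qed.
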